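(* Let $G$ be a uniform pro-$p$ group containing a closed normal subgroup $H$ with $G/H\cong\mathbb{Z}_p$. Let $X$ be a finite connected graph with vertices $v_1,\dots,v_m$, and let $X_\infty$ be the derived graph of a voltage assignment $\alpha\colon S\to G$. Assume every $X_n$ is connected and that $\mathrm{Pic}_\infty$ satisfies the $\mathfrak{M}_H(G)$-property. Then: 1. The matrix $D-A_\alpha^t$ is invertible in $\mathrm{Mat}_{m\times m}(\Lambda_{S^*})$ and so defines a class $[D-A_\alpha^t]\in K_1(\Lambda_{S^*})$. 2. For every finite-dimensional representation $\rho$ of $G$ which factors through $G^{(n)}$ for some $n$ and is defined over a commutative ring $O$ of characteristic zero with quotient field $L$, we have $\rho([D-A_\alpha^t])=h(\rho,X_n/X,1)$ in $L\cup\{\infty\}$. 3. $\partial([D-A_\alpha^t])=[\mathrm{Pic}_\infty]$ in $K_0(\Lambda\text{ on }S^* )$.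
   Context: A uniform pro-$p$ group $G$ of dimension $l$ is a finitely generated pro-$p$ group topologically generated by $l$ elements such that, with $G_n=G^{p^n}$, each $G_{n+1}$ is normal in $G_n$ and $G_n/G_{n+1}\cong(\mathbb{Z}/p\mathbb{Z})^l$. Put $G^{(n)}=G/G_n$ and $\Lambda=\mathbb{Z}_p[[G]]$. A finitely generated $\Lambda$-module $M$ has the $\mathfrak{M}_H(G)$-property if $M/M[p^\infty]$ is finitely generated over $\mathbb{Z}_p[[H]]$. Let $\mathcal{S}=\{f\in\Lambda:\Lambda/\Lambda f\text{ is finitely generated over }\mathbb{Z}_p[[H]]\}$ and $S^*=\bigcup_{k\ge0}p^k\mathcal{S}$; this is an Ore set (Coates–Fukaya–Kato–Sujatha–Venjakob). $\Lambda_{S^*}$ is the localization, and $\partial\colon K_1(\Lambda_{S^*})\to K_0(\Lambda\text{ on }S^* )$ is the connecting map of localization $K$-theory. Here $K_0(\Lambda\text{ on }S^* )$ is $K_0$ of the Waldhausen category of bounded complexes of finitely generated projective $\Lambda$-modules whose cohomology is $S^*$-torsion. $\partial$ sends the class of an endomorphism $\Lambda^k\to\Lambda^k$ invertible over $\Lambda_{S^*}$ to the class of its cone. $[\mathrm{Pic}_\infty]$ is the class of a finite projective resolution of $\mathrm{Pic}_\infty$. A representation $\rho\colon G\to\mathrm{GL}_d(O)$ induces the evaluation map $K_1(\Lambda_{S^*})\to L\cup\{\infty\}$ of Coates–Fukaya–Kato–Sujatha–Venjakob. Graph setting: graphs may have multiple edges and loops. $S$ is a chosen orientation of the edges of $X$,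 and a voltage assignment is a map $\alpha\colon S\to G$ with $\alpha(\bar e)=\alpha(e)^{-1}$. The derived graph $X_n$ (resp. $X_\infty$) has vertices $V(X)\times G^{(n)}$ (resp. $V(X)\times G$) and, for each $e\in S$ from $v$ to $v'$ and each group element $g$, an edge joining $(v,g)$ and $(v',g\alpha(e))$ (voltages taken modulo $G_n$). For a finite graph $Y$, $\mathrm{Pic}(Y)=\mathrm{Div}(Y)/\mathrm{Pr}(Y)$, where $\mathrm{Div}(Y)$ is the free $\mathbb{Z}_p$-module on $V(Y)$ and $\mathrm{Pr}(Y)$ is spanned by the divisors $\delta(y)=\sum_{e\text{ at }y}(y-w_e)$, with $w_e$ the other endpoint of $e$. Set $\mathrm{Pic}_\infty=\varprojlim_n\mathrm{Pic}(X_n)$. $D=\mathrm{diag}(\deg v_i)$, with loops counted twice. $A_\alpha=(\alpha_{ij})\in\mathrm{Mat}_{m\times m}(\Lambda)$ with $\alpha_{ij}=\sum_{e\in E(v_i,v_j)}\alpha(e)$ for $i\ne j$ (edges oriented from $v_i$ to $v_j$) and $\alpha_{ii}=\sum_{\text{loops } e\text{ at } v_i}(\alpha(e)+\alpha(e)^{-1})$. For $\rho$ of dimension $d$ factoring through $G^{(n)}$, let $A(\sigma)$ ($\sigma\in G^{(n)}$) be the $m\times m$ matrix with $(i,j)$ entry equal to the number of edges of $X_n$ from $(v_i,1)$ to $(v_j,\sigma)$, except that for $i=j,\sigma=1$ it is twice the number of loops at $(v_i,1)$. Put $A_\rho=\sum_\sigma A(\sigma)\otimes\rho(\sigma)$,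 $D_\rho=D\otimes I_d$, and \[h(\rho,X_n/X,u)=\det(I-A_\rho u+(D_\rho-I)u^2).\]
   Formalization: The matrix D − A_α^t is read as the matrix (images of basis vectors in columns) of an endomorphism of the free left Λ-module, so its class in K_1 is that of D − A_α; read literally over noncommutative Λ, claim 2 fails. O is taken to be a Z_p-algebra, as evaluation needs. *)

(* Defs.v *)
From HB Require Import structures.
From mathcomp Require Import all_boot all_order all_algebra finmap.
From mathcomp Require Import all_classical topology.
From mathcomp Require Import freeg mxtens.
From Stdlib Require Import Relation_Operators.

Set Implicit Arguments.
Unset Strict Implicit.
Unset Printing Implicit Defensive.

Import GRing.Theory.
Local Open Scope ring_scope.
Local Open Scope classical_set_scope.
Local Open Scope quotient_scope.

Definition Zpadic_coherent (p : nat) (x : forall k : nat, 'Z_(p ^ k.+1)) :=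
  forall k, (val (x k.+1))%:R = x k.

Record Zpadic (p : nat) := MkZpadic {
  zp_res :> forall k : nat, 'Z_(p ^ k.+1);
  zp_coherent : Zpadic_coherent zp_res
}.

Lemma Zp_trunc_dvd p k :
  ((Zp_trunc (p ^ k.+1)).+2 %| (Zp_trunc (p ^ k.+2)).+2)%N.
Proof.
case: p => [|[|p]]; [by rewrite !exp0n | by rewrite !exp1n | ].
by rewrite !Zp_cast ?dvdn_exp2l// -(expn0 p.+2) ltn_exp2l.
Qed.

Section ZpRing.
Variable p : nat.
Implicit Types x y z : Zpadic p.

HB.instance Definition _ := Choice.copy (Zpadic p) {classic (Zpadic p)}.

Lemma zp_ext x y : (forall k, x k = y k) -> x = y.
Proof.
case: x y => x cx [y cy] /= e; have {}e : x = y.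
  by apply: functional_extensionality_dep.
by move: cx cy; rewrite e => cx cy; congr MkZpadic; exact: Prop_irrelevance.
Qed.

Let tr k (a : 'Z_(p ^ k.+2)) : 'Z_(p ^ k.+1) := (val a)%:R.

Let valtr k a : val (@tr k a) = (val a %% (Zp_trunc (p ^ k.+1)).+2)%N.
Proof. by rewrite /tr Zp_nat. Qed.

Let trD k a b : @tr k (a + b) = tr a + tr b.
Proof.
apply: val_inj; rewrite valtr /= !valtr modn_dvdm ?Zp_trunc_dvd//.
by rewrite modnDm.
Qed.

Let trM k a b : @tr k (a * b) = tr a * tr b.
Proof.
apply: val_inj; rewrite valtr /= !valtr modn_dvdm ?Zp_trunc_dvd//.
by rewrite modnMm.
Qed.

Let tr0 k : @tr k 0 = 0. Proof. by rewrite /tr. Qed.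

Let tr1 k : @tr k 1 = 1. Proof. by rewrite /tr. Qed.

Let trN k a : @tr k (- a) = - tr a.
Proof. by apply/eqP; rewrite -addr_eq0 -trD addNr tr0. Qed.

Definition zp_zero := @MkZpadic p (fun=> 0) (fun k => tr0 k).
Definition zp_one := @MkZpadic p (fun=> 1) (fun k => tr1 k).

Let coherentN x : Zpadic_coherent (fun k => - x k).
Proof. by move=> k; rewrite -(zp_coherent x k); exact: trN. Qed.
Let coherentD x y : Zpadic_coherent (fun k => x k + y k).
Proof.
by move=> k; rewrite -(zp_coherent x k) -(zp_coherent y k); exact: trD.
Qed.
Let coherentM x y : Zpadic_coherent (fun k => x k * y k).
Proof.
by move=> k; rewrite -(zp_coherent x k) -(zp_coherent y k); exact: trM.
Qed.

Definition zp_opp x := MkZpadic (coherentN x).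
Definition zp_add x y := MkZpadic (coherentD x y).
Definition zp_mul x y := MkZpadic (coherentM x y).

Let addA : associative zp_add.
Proof. by move=> x y z; apply: zp_ext => k /=; rewrite addrA. Qed.
Let addC : commutative zp_add.
Proof. by move=> x y; apply: zp_ext => k /=; rewrite addrC. Qed.
Let add0 : left_id zp_zero zp_add.
Proof. by move=> x; apply: zp_ext => k /=; rewrite add0r. Qed.
Let addN : left_inverse zp_zero zp_opp zp_add.
Proof. by move=> x; apply: zp_ext => k /=; rewrite addNr. Qed.
Let mulA : associative zp_mul.
Proof. by move=> x y z; apply: zp_ext => k /=; rewrite mulrA. Qed.
Let mulC : commutative zp_mul.
Proof. by move=> x y; apply: zp_ext => k /=; rewrite mulrC. Qed.
Let mul1 : left_id zp_one zp_mul.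
Proof. by move=> x; apply: zp_ext => k /=; rewrite mul1r. Qed.
Let mulDl : left_distributive zp_mul zp_add.
Proof. by move=> x y z; apply: zp_ext => k /=; rewrite mulrDl. Qed.
Let oneN0 : zp_one != zp_zero.
Proof. by apply/eqP => /(congr1 (fun x : Zpadic p => x 0)) /= /eqP; rewrite oner_eq0. Qed.

HB.instance Definition _ := GRing.isZmodule.Build (Zpadic p) addA addC add0 addN.
HB.instance Definition _ :=
  GRing.Zmodule_isComNzRing.Build (Zpadic p) mulA mulC mul1 mulDl oneN0.
End ZpRing.

HB.mixin Record isTopologicalGroup G of Group G & Topological G := {
  mulg_continuous : continuous (fun xy : G * G => (xy.1 * xy.2)%g);
  invg_continuous : continuous (fun x : G => x^-1%g)
}.

#[short(type="topGroupType")]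
HB.structure Definition TopologicalGroup :=
  {G of isTopologicalGroup G & Group G & Topological G}.

Section Subgroups.
Variable G : groupType.
Implicit Types (K N : set G).

Definition subgroup K := K 1%g /\ forall x y, K x -> K y -> K (x * y^-1)%g.

Definition normal_subgroup N := subgroup N /\ forall x g, N x -> N (x ^ g)%g.

Definition left_cosets N : set (set G) :=
  [set C | exists g, C = [set x | N (g^-1 * x)%g]].

Lemma subgroup1 K : subgroup K -> K 1%g. Proof. by case. Qed.

Lemma subgroupV K x : subgroup K -> K x -> K x^-1%g.
Proof. by case=> K1 KB Kx; rewrite -[x^-1%g]mul1g; apply: KB. Qed.

Lemma subgroupM K x y : subgroup K -> K x -> K y -> K (x * y)%g.
Proof.
by move=> sK Kx Ky; rewrite -[y]invgK; apply: sK.2 => //; apply: subgroupV.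
Qed.

Lemma subgroupX K x n : subgroup K -> K x -> K (x ^+ n)%g.
Proof.
move=> sK Kx; elim: n => [|n ih]; first by rewrite expg0; exact: subgroup1.
by rewrite expgS; exact: subgroupM.
Qed.
End Subgroups.

(* [Gpow p G n] is the closed subgroup $G_n = G^{p^n}$ topologically generated
   by the [p ^ n]-th powers. *)
Definition Gpow (p : nat) (G : topGroupType) (n : nat) : set G :=
  [set x | forall K : set G, subgroup K -> closed K ->
             (forall g, K (g ^+ (p ^ n))%g) -> K x].
Arguments Gpow p {G} n.

Definition top_generated (G : topGroupType) (A : set G) :=
  forall K : set G, subgroup K -> closed K -> A `<=` K -> K = setT.

Definition profinite (G : topGroupType) :=
  [/\ compact [set: G], hausdorff_space G & totally_disconnected [set: G]].

Definition pro_p (p : nat) (G : topGroupType) :=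
  profinite G /\
  forall N : set G, normal_subgroup N -> open N ->
    exists k, (left_cosets N #= `I_(p ^ k))%card.

(* The map [f] induces an isomorphism $G_n/G_{n+1} \cong \mathbb{F}_p^l$. *)
Definition uniform_pro_p (p l : nat) (G : topGroupType) :=
  [/\ pro_p p G,
      exists g : 'I_l -> G, top_generated (range g)
    & forall n,
        (forall x g, Gpow p n.+1 x -> Gpow p n g -> @Gpow p G n.+1 (x ^ g)%g) /\
        exists f : G -> 'rV['F_p]_l,
          [/\ forall x y, Gpow p n x -> Gpow p n y -> f (x * y)%g = f x + f y,
              forall v, exists2 x, Gpow p n x & f x = v
            & forall x, Gpow p n x -> (f x = 0 <-> Gpow p n.+1 x)]].

Section GpowTheory.
Variables (p : nat) (G : topGroupType).

Lemma Gpow_subgroup n : subgroup (@Gpow p G n).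
Proof.
split=> [K [] //|x y Gx Gy K sK cK powK].
by apply: sK.2; [apply: Gx | apply: Gy].
Qed.

Lemma conjg_continuous (g : G) : continuous (fun x : G => (x ^ g)%g).
Proof.
have mcont (u v : G -> G) : continuous u -> continuous v ->
    continuous (fun x => (u x * v x)%g).
  move=> cu cv x; apply: (@cvg_comp _ _ _ (fun x => (u x, v x))
    (fun xy : G * G => (xy.1 * xy.2)%g) _ (nbhs (u x, v x)) _ _
    (mulg_continuous (u x, v x))).
  exact: cvg_pair (cu x) (cv x).
by apply: (mcont); [exact: cst_continuous | apply: (mcont) => // x;
  [exact: cvg_id | exact: cvg_cst]].
Qed.

Lemma Gpow_normal n : normal_subgroup (@Gpow p G n).
Proof.
split=> [|x g Gx K sK cK powK]; first exact: Gpow_subgroup.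
apply: (Gx (fun x => K (x ^ g)%g)).
- split=> [|y z Ky Kz]; first by rewrite conj1g; exact: subgroup1.
  by rewrite conjMg conjVg; apply: sK.2.
- exact: (closed_comp (fun x _ => @conjg_continuous g x) cK).
- by move=> h; rewrite conjXg.
Qed.

Lemma GpowS n : @Gpow p G n.+1 `<=` Gpow p n.
Proof.
move=> x Gx K sK cK powK; apply: Gx => // g.
by rewrite expnSr expgnA; exact: subgroupX.
Qed.

Definition Gpow_rel n (x y : G) : bool := `[< Gpow p n (x^-1 * y)%g >].

Lemma Gpow_relP n : equiv_class_of (Gpow_rel n).
Proof.
have sG := Gpow_subgroup n.
split=> [x|x y|y x z]; rewrite /Gpow_rel.
- by apply/asboolP; rewrite mulVg; exact: subgroup1.
- by apply/asboolP/asboolP => /(subgroupV sG); rewrite invgM invgK.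
- move=> /asboolP xy /asboolP yz; apply/asboolP.
  by have := subgroupM sG xy yz; rewrite -mulgA mulVKg.
Qed.
End GpowTheory.

Section GpowQuotient.
Variables (p n : nat) (G : topGroupType).

Definition Gpow_equiv : equiv_rel G := EquivRelPack (Gpow_relP p G n).

Definition Gquo := {eq_quot Gpow_equiv}.
HB.instance Definition _ : EqQuotient _ Gpow_equiv Gquo := EqQuotient.on Gquo.
HB.instance Definition _ := Choice.on Gquo.

Definition Gproj (g : G) : Gquo := \pi_Gquo g.

Lemma GprojP g h : Gproj g = Gproj h <-> Gpow p n (g^-1 * h)%g.
Proof.
split=> [/eqP|gh]; first by rewrite /Gproj eqmodE => /asboolP.
by apply/eqP; rewrite /Gproj eqmodE; apply/asboolP.
Qed.

Lemma Gproj_repr (x : Gquo) : Gproj (repr x) = x.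
Proof. exact: reprK. Qed.

Definition Gquo_mul (x y : Gquo) : Gquo := Gproj (repr x * repr y)%g.
Definition Gquo_inv (x : Gquo) : Gquo := Gproj (repr x)^-1%g.

Let nG := @Gpow_normal p G n.

Lemma Gproj_mul g h : Gquo_mul (Gproj g) (Gproj h) = Gproj (g * h)%g.
Proof.
have /GprojP a := Gproj_repr (Gproj g); have /GprojP b := Gproj_repr (Gproj h).
move: a b; rewrite /Gquo_mul; move: (repr (Gproj g)) (repr (Gproj h)) => u v a b.
apply/GprojP; rewrite invgM -!mulgA (mulgA u^-1%g).
set c := (u^-1 * g)%g in a *.
have -> : (v^-1 * (c * h))%g = (c ^ v * (v^-1 * h))%g.
  by rewrite conjgE -!mulgA mulVKg.
exact: subgroupM nG.1 (nG.2 _ _ a) b.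
Qed.

Lemma Gproj_inv g : Gquo_inv (Gproj g) = Gproj g^-1%g.
Proof.
have /GprojP a := Gproj_repr (Gproj g).
move: a; rewrite /Gquo_inv; move: (repr _) => u a.
apply/GprojP; rewrite invgK.
have -> : (u * g^-1 = (u^-1 * g)^-1 ^ u^-1)%g.
  by rewrite conjgE invgM !invgK -!mulgA mulgV mulg1.
exact: nG.2 _ _ (subgroupV nG.1 a).
Qed.

Let mulA : associative Gquo_mul.
Proof.
move=> x y z; rewrite -(Gproj_repr x) -(Gproj_repr y) -(Gproj_repr z).
by rewrite !Gproj_mul mulgA.
Qed.
Let mul1 : left_id (Gproj 1%g) Gquo_mul.
Proof. by move=> x; rewrite -(Gproj_repr x) Gproj_mul mul1g. Qed.
Let mulx1 : right_id (Gproj 1%g) Gquo_mul.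
Proof. by move=> x; rewrite -(Gproj_repr x) Gproj_mul mulg1. Qed.
Let mulV : left_inverse (Gproj 1%g) Gquo_inv Gquo_mul.
Proof. by move=> x; rewrite -(Gproj_repr x) Gproj_inv Gproj_mul mulVg. Qed.
Let mulxV : right_inverse (Gproj 1%g) Gquo_inv Gquo_mul.
Proof. by move=> x; rewrite -(Gproj_repr x) Gproj_inv Gproj_mul mulgV. Qed.

HB.instance Definition _ := isGroup.Build Gquo mulA mul1 mulx1 mulV mulxV.

Lemma GprojM g h : Gproj (g * h)%g = (Gproj g * Gproj h)%g.
Proof. by rewrite -Gproj_mul. Qed.

End GpowQuotient.
Arguments Gproj p n {G} g.

Section GpowTransition.
Variables (p n : nat) (G : topGroupType).

Definition Gtrans (x : Gquo p n.+1 G) : Gquo p n G := Gproj p n (repr x).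

Lemma Gtrans_proj g : Gtrans (Gproj p n.+1 g) = Gproj p n g.
Proof.
have /GprojP/GpowS := Gproj_repr (Gproj p n.+1 g).
by move=> h; apply/GprojP.
Qed.

Lemma GtransM x y : Gtrans (x * y)%g = (Gtrans x * Gtrans y)%g.
Proof.
rewrite -(Gproj_repr x) -(Gproj_repr y) -GprojM !Gtrans_proj.
exact: GprojM.
Qed.

Lemma Gtrans1 : Gtrans 1%g = 1%g.
Proof. exact: (Gtrans_proj 1%g). Qed.
End GpowTransition.

Section FreeModule.
Variables (R : comNzRingType) (K : choiceType) (M : lmodType R).
Implicit Types (D : {freeg K / R}) (f g : K -> M).

Lemma freegU_scale (k : R) (x : K) :
  << k *g x >> = k *: << x >> :> {freeg K / R}.
Proof. by apply/eqP/freeg_eqP => y; rewrite coeffZ !coeffU mul1r. Qed.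

Lemma freeg_lin_ind (P : {freeg K / R} -> Prop) :
  P 0 -> (forall k x D, P D -> P (k *: << x >> + D)) -> forall D, P D.
Proof.
move=> P0 PD; elim/freeg_ind_dom0 => // k x D _ _ PkD.
by rewrite freegU_scale; exact: PD.
Qed.

Lemma fgliftE f x : fglift f << x >> = f x.
Proof. by rewrite liftU scale1r. Qed.

Lemma fgliftB f : zmod_morphism (fglift f).
Proof. exact: lift_is_additive. Qed.

Lemma fglift0 f : fglift f 0 = 0.
Proof. by rewrite -(subrr (0 : {freeg K / R})) fgliftB subrr. Qed.

Lemma fgliftD f D D' : fglift f (D + D') = fglift f D + fglift f D'.
Proof.
by rewrite -[D' in LHS]opprK fgliftB -[- D']sub0r fgliftB fglift0 sub0r opprK.
Qed.

Lemma fgliftZ f k D : fglift f (k *: D) = k *: fglift f D.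
Proof.
elim/freeg_lin_ind: D => [|c x D ih]; first by rewrite scaler0 fglift0 scaler0.
rewrite scalerDr !fgliftD ih scalerDr scalerA -!freegU_scale !liftU.
by rewrite scalerA.
Qed.

Lemma fglift_linear f : linear (fglift f).
Proof. by move=> k D D'; rewrite fgliftD fgliftZ. Qed.

HB.instance Definition _ f :=
  GRing.isLinear.Build R {freeg K / R} M *:%R (fglift f) (fglift_linear f).

Lemma fglift_funD f g D :
  fglift (fun x => f x + g x) D = fglift f D + fglift g D.
Proof.
elim/freeg_lin_ind: D => [|c x D ih]; first by rewrite !fglift0 addr0.
by rewrite !fgliftD !fgliftZ !fgliftE ih scalerDr addrACA.
Qed.

Lemma fglift_fun0 D : fglift (fun=> 0 : M) D = 0.
Proof.
elim/freeg_lin_ind: D => [|c x D ih]; first by rewrite fglift0.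
by rewrite fgliftD fgliftZ fgliftE ih scaler0 addr0.
Qed.

Lemma fglift_funZ f k D : fglift (fun x => k *: f x) D = k *: fglift f D.
Proof.
elim/freeg_lin_ind: D => [|c x D ih]; first by rewrite !fglift0 scaler0.
by rewrite !fgliftD !fgliftZ !fgliftE ih scalerDr !scalerA mulrC.
Qed.

Lemma eq_fglift f g : f =1 g -> fglift f =1 fglift g.
Proof. by move=> /funext ->. Qed.
End FreeModule.

Definition freeg_map (R : comNzRingType) (K K' : choiceType) (h : K -> K') :
    {freeg K / R} -> {freeg K' / R} :=
  fglift (fun x => << h x >>).
HB.instance Definition _ R K K' h := GRing.Linear.on (@freeg_map R K K' h).

Lemma freeg_map_basis R K K' h x : @freeg_map R K K' h << x >> = << h x >>.
Proof. exact: fgliftE. Qed.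

Lemma freeg_mapU R K K' h k x : @freeg_map R K K' h << k *g x >> = << k *g h x >>.
Proof. by rewrite [LHS]liftU -freegU_scale. Qed.

Lemma freeg_mapZ R K K' h k D :
  @freeg_map R K K' h (k *: D) = k *: freeg_map h D.
Proof. exact: fgliftZ. Qed.

Definition grpring (R : comNzRingType) (Q : groupType) := {freeg Q / R}.

Section GroupRing.
Variables (R : comNzRingType) (Q : groupType).
Implicit Types (x y z : grpring R Q).

HB.instance Definition _ := GRing.Lmodule.on (grpring R Q).

Definition grpring_one : grpring R Q := << 1%g >>.
Definition grpring_mul x y : grpring R Q :=
  fglift (fun a => fglift (fun b => << (a * b)%g >>) y) x.

Let mulDl : left_distributive grpring_mul +%R.
Proof. by move=> x y z; rewrite /grpring_mul fgliftD. Qed.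
Let mulDr : right_distributive grpring_mul +%R.
Proof.
move=> x y z; rewrite /grpring_mul -fglift_funD.
by apply: eq_fglift => a; rewrite fgliftD.
Qed.
Let mulZl k x y : grpring_mul (k *: x) y = k *: grpring_mul x y.
Proof. exact: fgliftZ. Qed.
Let mulZr k x y : grpring_mul x (k *: y) = k *: grpring_mul x y.
Proof.
rewrite /grpring_mul -fglift_funZ.
by apply: eq_fglift => a; rewrite fgliftZ.
Qed.
Let mul0 x : grpring_mul 0 x = 0. Proof. exact: fglift0. Qed.
Let mulx0 x : grpring_mul x 0 = 0.
Proof.
rewrite /grpring_mul -[RHS](fglift_fun0 _ x).
by apply: eq_fglift => a; rewrite fglift0.
Qed.
Let mulUU a b : grpring_mul << a >> << b >> = << (a * b)%g >>.
Proof. by rewrite /grpring_mul !fgliftE. Qed.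
Let mulA : associative grpring_mul.
Proof.
move=> x y z; elim/freeg_lin_ind: x => [|k a x ihx]; first by rewrite !mul0.
rewrite !mulDl {}ihx; congr (_ + _); rewrite !mulZl; congr (_ *: _).
elim/freeg_lin_ind: y => [|l b y ihy]; first by rewrite !(mul0, mulx0).
rewrite !(mulDl, mulDr) {}ihy; congr (_ + _); rewrite !(mulZl, mulZr).
congr (_ *: _).
elim/freeg_lin_ind: z => [|m c z ihz]; first by rewrite !mulx0.
rewrite !mulDr ihz; congr (_ + _); rewrite !mulZr; congr (_ *: _).
by rewrite !mulUU mulgA.
Qed.
Let mul1 : left_id grpring_one grpring_mul.
Proof.
move=> x; elim/freeg_lin_ind: x => [|k a x ihx]; first by rewrite mulx0.
by rewrite mulDr ihx mulZr mulUU mul1g.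
Qed.
Let mulx1 : right_id grpring_one grpring_mul.
Proof.
move=> x; elim/freeg_lin_ind: x => [|k a x ihx]; first by rewrite mul0.
by rewrite mulDl ihx mulZl mulUU mulg1.
Qed.
Let one_neq0 : grpring_one != 0.
Proof. by rewrite freegU_eq0 oner_neq0. Qed.

HB.instance Definition _ := GRing.Zmodule_isNzRing.Build (grpring R Q)
  mulA mul1 mulx1 mulDl mulDr one_neq0.

Lemma grpring_mulUU (a b : Q) :
  (<< a >> : grpring R Q) * << b >> = << (a * b)%g >>.
Proof. exact: mulUU. Qed.

Lemma grpring_scalerAl k x y : (k *: x) * y = k *: (x * y).
Proof. exact: mulZl. Qed.

Lemma grpring_scalerAr k x y : x * (k *: y) = k *: (x * y).
Proof. exact: mulZr. Qed.
End GroupRing.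

Section GroupRingMap.
Variables (R : comNzRingType) (Q Q' : groupType) (h : Q -> Q').
Hypothesis hM : forall x y, h (x * y)%g = (h x * h y)%g.

Lemma grpring_mapM (x y : grpring R Q) :
  freeg_map h (x * y) = (freeg_map h x : grpring R Q') * freeg_map h y.
Proof.
elim/freeg_lin_ind: x => [|k a x ihx]; first by rewrite mul0r !raddf0 mul0r.
rewrite mulrDl !raddfD /= mulrDl {}ihx; congr (_ + _).
rewrite grpring_scalerAl !freeg_mapZ.
rewrite grpring_scalerAl; congr (_ *: _).
elim/freeg_lin_ind: y => [|l b y ihy]; first by rewrite mulr0 !raddf0 mulr0.
rewrite mulrDr !raddfD /= mulrDr ihy; congr (_ + _).
rewrite grpring_scalerAr !freeg_mapZ.
rewrite grpring_scalerAr; congr (_ *: _).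
by rewrite grpring_mulUU !freeg_map_basis grpring_mulUU hM.
Qed.
End GroupRingMap.

(* [iwasawa p R G] is the completed group ring $R[[G]] = \varprojlim_n
   R[G/G^{p^n}]$; the Iwasawa algebra of $G$ is [iwasawa p (Zpadic p) G]. *)
Record iwasawa (p : nat) (R : comNzRingType) (G : topGroupType) := MkIwasawa {
  iw_level :> forall n, grpring R (Gquo p n G);
  iw_coherent : forall n, freeg_map (@Gtrans p n G) (iw_level n.+1) = iw_level n
}.

Section IwasawaRing.
Variables (p : nat) (R : comNzRingType) (G : topGroupType).
Notation L := (iwasawa p R G).
Implicit Types x y z : L.

HB.instance Definition _ := Choice.copy L {classic L}.

Lemma iwasawa_ext x y : (forall n, x n = y n) -> x = y.
Proof.
case: x y => x cx [y cy] /= e; have {}e : x = y.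
  by apply: functional_extensionality_dep.
by move: cx cy; rewrite e => cx cy; congr MkIwasawa; exact: Prop_irrelevance.
Qed.

Let coh0 n : freeg_map (@Gtrans p n G) (0 : grpring R _) = 0.
Proof. exact: raddf0. Qed.
Let coh1 n : freeg_map (@Gtrans p n G) (1 : grpring R _) = (1 : grpring R _).
Proof. by rewrite freeg_map_basis Gtrans1. Qed.
Let cohN x n : freeg_map (@Gtrans p n G) (- x n.+1) = - x n.
Proof. by rewrite raddfN /= iw_coherent. Qed.
Let cohD x y n : freeg_map (@Gtrans p n G) (x n.+1 + y n.+1) = x n + y n.
Proof. by rewrite raddfD /= !iw_coherent. Qed.
Let cohM x y n : freeg_map (@Gtrans p n G) (x n.+1 * y n.+1) = x n * y n.
Proof. by rewrite (grpring_mapM (@GtransM p n G)) !iw_coherent. Qed.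

Definition iw_zero : L := MkIwasawa coh0.
Definition iw_one : L := MkIwasawa coh1.
Definition iw_opp x : L := MkIwasawa (cohN x).
Definition iw_add x y : L := MkIwasawa (cohD x y).
Definition iw_mul x y : L := MkIwasawa (cohM x y).

Let addA : associative iw_add.
Proof. by move=> x y z; apply: iwasawa_ext => n /=; rewrite addrA. Qed.
Let addC : commutative iw_add.
Proof. by move=> x y; apply: iwasawa_ext => n /=; rewrite addrC. Qed.
Let add0 : left_id iw_zero iw_add.
Proof. by move=> x; apply: iwasawa_ext => n /=; rewrite add0r. Qed.
Let addN : left_inverse iw_zero iw_opp iw_add.
Proof. by move=> x; apply: iwasawa_ext => n /=; rewrite addNr. Qed.
Let mulA : associative iw_mul.
Proof. by move=> x y z; apply: iwasawa_ext => n /=; rewrite mulrA. Qed.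
Let mul1 : left_id iw_one iw_mul.
Proof. by move=> x; apply: iwasawa_ext => n /=; rewrite mul1r. Qed.
Let mulx1 : right_id iw_one iw_mul.
Proof. by move=> x; apply: iwasawa_ext => n /=; rewrite mulr1. Qed.
Let mulDl : left_distributive iw_mul iw_add.
Proof. by move=> x y z; apply: iwasawa_ext => n /=; rewrite mulrDl. Qed.
Let mulDr : right_distributive iw_mul iw_add.
Proof. by move=> x y z; apply: iwasawa_ext => n /=; rewrite mulrDr. Qed.
Let one_neq0 : iw_one != iw_zero.
Proof.
by apply/eqP => /(congr1 (fun x : L => x 0)) /= /eqP; rewrite oner_eq0.
Qed.

HB.instance Definition _ := GRing.isZmodule.Build L addA addC add0 addN.
HB.instance Definition _ := GRing.Zmodule_isNzRing.Build L
  mulA mul1 mulx1 mulDl mulDr one_neq0.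

Lemma iw_group_coherent (g : G) n :
  freeg_map (@Gtrans p n G) << Gproj p n.+1 g >> = << Gproj p n g >>
    :> grpring R _.
Proof. by rewrite freeg_map_basis Gtrans_proj. Qed.

Definition iw_group (g : G) : L := MkIwasawa (iw_group_coherent g).

Lemma iw_const_coherent (r : R) n :
  freeg_map (@Gtrans p n G) << r *g 1%g >> = << r *g 1%g >> :> grpring R _.
Proof. by rewrite freeg_mapU Gtrans1. Qed.

Definition iw_const (r : R) : L := MkIwasawa (iw_const_coherent r).

(* The augmentation; $G/G^{p^0}$ is the trivial group. *)
Definition iw_aug (x : L) : R := fglift (fun=> 1 : R^o) (x 0).
End IwasawaRing.

Section IwasawaCoefficients.
Variables (R R' : comNzRingType) (f : {rmorphism R -> R'}).

Definition freeg_coef (K : choiceType) (D : {freeg K / R}) : {freeg K / R'} :=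
  \sum_(x <- dom D) << f (coeff x D) *g x >>.

Lemma coeff_freeg_coef (K : choiceType) (D : {freeg K / R}) x :
  coeff x (freeg_coef D) = f (coeff x D).
Proof.
rewrite -{2}[D]freeg_sumE /freeg_coef !raddf_sum /=.
by apply: eq_bigr => y _; rewrite !coeffU rmorphM rmorph_nat.
Qed.

Lemma freeg_coef_map (K K' : choiceType) (h : K -> K') (D : {freeg K / R}) :
  freeg_map h (freeg_coef D) = freeg_coef (freeg_map h D).
Proof.
have coefB (I : choiceType) (E F : {freeg I / R}) :
    freeg_coef (E + F) = freeg_coef E + freeg_coef F.
  by apply/eqP/freeg_eqP => y; rewrite coeffD !coeff_freeg_coef coeffD rmorphD.
have coefU (I : choiceType) k (x : I) :
    freeg_coef (k *: << x >>) = f k *: << x >>.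
  apply/eqP/freeg_eqP => y.
  by rewrite coeff_freeg_coef !coeffZ !coeffU !mul1r rmorphM rmorph_nat.
have coef0 (I : choiceType) : freeg_coef (0 : {freeg I / R}) = 0.
  by apply/eqP/freeg_eqP => y; rewrite coeff_freeg_coef !coeff0 rmorph0.
elim/freeg_lin_ind: D => [|k x D ih]; first by rewrite !(coef0, raddf0).
rewrite coefB !raddfD /= coefB ih; congr (_ + _).
by rewrite coefU !freeg_mapZ !freeg_map_basis coefU.
Qed.

Lemma iw_coef_coherent p G (x : iwasawa p R G) n :
  freeg_map (@Gtrans p n G) (freeg_coef (x n.+1)) = freeg_coef (x n).
Proof. by rewrite freeg_coef_map iw_coherent. Qed.

Definition iw_coef p G (x : iwasawa p R G) : iwasawa p R' G :=
  MkIwasawa (iw_coef_coherent x).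
End IwasawaCoefficients.

Definition Gam (p : nat) : Type := Zpadic p.

Section Gamma.
Variable p : nat.

HB.instance Definition _ := Choice.on (Gam p).

Let mulA : associative (fun x y : Gam p => (x : Zpadic p) + y : Gam p).
Proof. exact: addrA. Qed.
Let mul1 : left_id (0 : Zpadic p) (fun x y : Gam p => (x : Zpadic p) + y : Gam p).
Proof. exact: add0r. Qed.
Let mulx1 : right_id (0 : Zpadic p) (fun x y : Gam p => (x : Zpadic p) + y : Gam p).
Proof. exact: addr0. Qed.
Let mulV : left_inverse (0 : Zpadic p) (fun x : Gam p => - (x : Zpadic p) : Gam p)
  (fun x y : Gam p => (x : Zpadic p) + y : Gam p).
Proof. exact: addNr. Qed.
Let mulxV : right_inverse (0 : Zpadic p) (fun x : Gam p => - (x : Zpadic p) : Gam p)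
  (fun x y : Gam p => (x : Zpadic p) + y : Gam p).
Proof. exact: addrN. Qed.

HB.instance Definition _ := isGroup.Build (Gam p) mulA mul1 mulx1 mulV mulxV.

(* p-adic neighbourhoods: $A \supseteq x + p^k \mathbb{Z}_p$ for some $k$. *)
Definition Gam_nbhs (x : Gam p) : set_system (Gam p) :=
  [set A | exists k, forall y : Gam p,
    (forall i, (i < k)%N -> (y : Zpadic p) i = (x : Zpadic p) i) -> A y].

HB.instance Definition _ := hasNbhs.Build (Gam p) Gam_nbhs.

Let nbhs_filter (x : Gam p) : ProperFilter (nbhs x).
Proof.
apply: Build_ProperFilter_ex => [A [k Ak]|]; first by exists x; exact: Ak.
split=> [|A B [k Ak] [l Bl]|A B AB [k Ak]].
- by exists 0%N.
- exists (maxn k l) => y xy; split; [apply: Ak | apply: Bl] => i ilt;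
    apply: xy; rewrite leq_max ilt ?orbT //.
- by exists k => y /Ak /AB.
Qed.
Let nbhs_singleton (x : Gam p) (A : set (Gam p)) : nbhs x A -> A x.
Proof. by case=> k; apply. Qed.
Let nbhs_nbhs (x : Gam p) (A : set (Gam p)) :
  nbhs x A -> nbhs x (nbhs^~ A).
Proof.
case=> k Ak; exists k => y xy; exists k => z yz; apply: Ak => i ik.
by rewrite yz // xy.
Qed.

HB.instance Definition _ := Nbhs_isNbhsTopological.Build (Gam p)
  nbhs_filter nbhs_singleton nbhs_nbhs.

Let mul_cont : continuous (fun xy : Gam p * Gam p => (xy.1 * xy.2)%g).
Proof.
move=> [x y] A [k Ak].
exists ([set z : Gam p | forall i, (i < k)%N -> (z : Zpadic p) i = (x : Zpadic p) i],
        [set z : Gam p | forall i, (i < k)%N -> (z : Zpadic p) i = (y : Zpadic p) i]).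
  by split; exists k.
move=> [u v] /= [ux vy]; apply: Ak => i ik.
by rewrite /= ux // vy.
Qed.
Let inv_cont : continuous (fun x : Gam p => x^-1%g).
Proof.
move=> x A [k Ak]; exists k => y yx; apply: Ak => i ik.
by rewrite /= yx.
Qed.

HB.instance Definition _ := isTopologicalGroup.Build (Gam p) mul_cont inv_cont.
End Gamma.

Lemma iwasawa_Gam_mulC p R : commutative (@GRing.mul (iwasawa p R (Gam p))).
Proof.
move=> x y; apply: iwasawa_ext => n /=.
move: (x n) (y n) => {x y} x y.
have comm (a b : Gquo p n (Gam p)) : (a * b = b * a)%g.
  rewrite -(Gproj_repr a) -(Gproj_repr b) -!GprojM; congr Gproj.
  exact: (@addrC (Zpadic p)).
elim/freeg_lin_ind: x => [|k a x ihx]; first by rewrite mul0r mulr0.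
rewrite mulrDl mulrDr {}ihx; congr (_ + _).
rewrite grpring_scalerAl grpring_scalerAr; congr (_ *: _).
elim/freeg_lin_ind: y => [|l b y ihy]; first by rewrite mul0r mulr0.
rewrite mulrDl mulrDr {}ihy; congr (_ + _).
rewrite grpring_scalerAl grpring_scalerAr; congr (_ *: _).
by rewrite !grpring_mulUU comm.
Qed.

HB.instance Definition _ p R :=
  GRing.PzRing_hasCommutativeMul.Build (iwasawa p R (Gam p))
    (@iwasawa_Gam_mulC p R).

(* [LamO p O alg] is $\Lambda_O(\Gamma) = O \otimes_{\mathbb{Z}_p}
   \mathbb{Z}_p[[\Gamma]]$, realised in $\varprojlim_n O[\Gamma/\Gamma^{p^n}]$
   as the subring generated by $O$ and $\mathbb{Z}_p[[\Gamma]]$; it is the whole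
   inverse limit when $O$ is finite over $\mathbb{Z}_p$. *)
Definition LamO_pred (p : nat) (O : comNzRingType)
    (alg : {rmorphism Zpadic p -> O}) :
    {pred iwasawa p O (Gam p)} := fun b =>
  `[< forall B : {pred iwasawa p O (Gam p)}, subring_closed B ->
        (forall o, iw_const p (Gam p) o \in B) ->
        (forall x : iwasawa p (Zpadic p) (Gam p), iw_coef alg x \in B) ->
        b \in B >].

Section LamO.
Variables (p : nat) (O : comNzRingType) (alg : {rmorphism Zpadic p -> O}).

Lemma LamO_closed : subring_closed (LamO_pred alg).
Proof.
split=> [|x y /asboolP Bx /asboolP By|x y /asboolP Bx /asboolP By];
  apply/asboolP => B sB Bo Bl.
- by case: sB.
- by have [_ BB _] := sB; apply: BB; [exact: Bx | exact: By].
- by have [_ _ BM] := sB; apply: BM; [exact: Bx | exact: By].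
Qed.

HB.instance Definition _ :=
  GRing.isSubringClosed.Build _ (LamO_pred alg) LamO_closed.

Record LamO := MkLamO { lamO_val :> iwasawa p O (Gam p);
                        _ : lamO_val \in LamO_pred alg }.
HB.instance Definition _ := [isSub for lamO_val].
HB.instance Definition _ := [Choice of LamO by <:].
HB.instance Definition _ := [SubChoice_isSubComNzRing of LamO by <:].
End LamO.

Definition zspan (V : zmodType) (A : set V) : {pred V} := fun x =>
  `[< forall B : {pred V}, zmod_closed B -> (forall a, A a -> a \in B) ->
        x \in B >].

Section Zspan.
Variables (V : zmodType) (A : set V).

Lemma zspan_closed : zmod_closed (zspan A).
Proof.
split=> [|x y /asboolP Ax /asboolP Ay]; apply/asboolP => B cB AB.
  by case: cB.
by have [_ BB] := cB; apply: BB; [exact: Ax | exact: Ay].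
Qed.

HB.instance Definition _ := GRing.isZmodClosed.Build V (zspan A) zspan_closed.

Lemma zspan_gen a : A a -> a \in zspan A.
Proof. by move=> Aa; apply/asboolP => B _; exact. Qed.

Lemma zspan_ind (P : V -> Prop) : P 0 -> (forall x y, P x -> P y -> P (x - y)) ->
  (forall a, A a -> P a) -> forall x, x \in zspan A -> P x.
Proof.
move=> P0 PB PA x /asboolP/(_ (fun x => `[< P x >])) xP; apply/asboolP/xP.
  split=> [|y z /asboolP Py /asboolP Pz]; apply/asboolP => //.
  exact: PB.
by move=> a /PA Pa; apply/asboolP.
Qed.

Definition zquo := @Quotient.quot V (zspan A).
HB.instance Definition _ := GRing.Zmodule.on zquo.
HB.instance Definition _ := EqQuotient.on zquo.
HB.instance Definition _ := ZmodQuotient.on zquo.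

Definition zclass (x : V) : zquo := \pi_zquo x.

Lemma zclass_eq x y : zclass x = zclass y <-> x - y \in zspan A.
Proof. by rewrite Quotient.idealrBE; split=> [e|/eqP //]; apply/eqP. Qed.

Lemma zclassD x y : zclass (x + y) = zclass x + zclass y.
Proof. exact: (raddfD (\pi_zquo : {additive V -> zquo})). Qed.

Lemma zclass_repr (x : zquo) : zclass (repr x) = x.
Proof. exact: reprK. Qed.

Lemma zrepr_class x : repr (zclass x) - x \in zspan A.
Proof. by apply/zclass_eq; rewrite zclass_repr. Qed.
End Zspan.

(* A multigraph with loops, given by an orientation: [edge] has one element for
   each unoriented edge.  All the graphs considered below are finite. *)
Record graph := Graph {
  vert : choiceType;
  edge : choiceType;
  esrc : edge -> vert;
  etgt : edge -> vert
}.

Definition adjacent (Y : graph) (y z : vert Y) :=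
  exists e : edge Y, esrc e = y /\ etgt e = z.

Definition connected_graph (Y : graph) :=
  inhabited (vert Y) /\
  forall y z : vert Y, clos_refl_sym_trans _ (@adjacent Y) y z.

Section Pic.
Variables (p : nat) (Y : graph).

Definition Div := {freeg (vert Y) / (Zpadic p)}.
HB.instance Definition _ := GRing.Lmodule.on Div.

Definition lapdiv (y : vert Y) : Div :=
  \sum_(e \in [set e | esrc e = y])
      (<< y >> - << etgt e >> : {freeg (vert Y) / (Zpadic p)})
  + \sum_(e \in [set e | etgt e = y])
      (<< y >> - << esrc e >> : {freeg (vert Y) / (Zpadic p)}).

Definition Pr : pred Div := zspan [set D | exists a y, D = a *: lapdiv y].

Definition Pic := zquo [set D : Div | exists a y, D = a *: lapdiv y].
HB.instance Definition _ := GRing.Zmodule.on Pic.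
End Pic.
Arguments lapdiv p {Y} y.
Arguments Pr p Y : clear implicits.

Section Cover.
Variables (p : nat) (Y Y' : graph).
Variables (hv : vert Y -> vert Y') (he : edge Y -> edge Y').
Hypothesis fin_src : forall y : vert Y, finite_set [set e : edge Y | esrc e = y].
Hypothesis fin_tgt : forall y : vert Y, finite_set [set e : edge Y | etgt e = y].
Hypothesis hsrc : forall e, esrc (he e) = hv (esrc e).
Hypothesis htgt : forall e, etgt (he e) = hv (etgt e).
Hypothesis src_bij : forall y,
  set_bij [set e | esrc e = y] [set e | esrc e = hv y] he.
Hypothesis tgt_bij : forall y,
  set_bij [set e | etgt e = y] [set e | etgt e = hv y] he.

Lemma freeg_map_lapdiv y :
  freeg_map hv (lapdiv p y : {freeg (vert Y) / (Zpadic p)}) = lapdiv p (hv y).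
Proof.
rewrite /lapdiv.
rewrite (@reindex_fsbig _ _ _ _ _ he _ _ _ (src_bij y)).
rewrite (@reindex_fsbig _ _ _ _ _ he _ _ _ (tgt_bij y)).
rewrite !fsbig_finite //= raddfD /= !raddf_sum /=; congr (_ + _);
  by apply: eq_bigr => e _; rewrite raddfB /= !freeg_map_basis ?htgt ?hsrc.
Qed.

Lemma freeg_map_Pr (D : Div p Y) : D \in Pr p Y -> freeg_map hv D \in Pr p Y'.
Proof.
elim/zspan_ind => [|x z Px Pz|a [c [y ->]]].
- by rewrite raddf0 rpred0.
- by rewrite raddfB /= rpredB.
- apply: zspan_gen; exists c, (hv y).
  by rewrite freeg_mapZ freeg_map_lapdiv.
Qed.
End Cover.

(* [derived p alpha n] is the graph $X_n$ derived from the voltage assignment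
   [alpha], taken modulo $G_n$: the edge $(e, g)$ joins $(v, g)$ to
   $(v', g\alpha(e))$. *)
Definition derived (p : nat) (G : topGroupType) (X : graph)
    (alpha : edge X -> G) (n : nat) : graph :=
  @Graph (vert X * Gquo p n G)%type (edge X * Gquo p n G)%type
    (fun e => (esrc e.1, e.2))
    (fun e => (etgt e.1, (e.2 * Gproj p n (alpha e.1))%g)).
Arguments derived p {G X} alpha n.

Section PicInfinity.
Variables (p : nat) (G : topGroupType) (V : choiceType) (E : finType).
Variables (s t : E -> V) (alpha : E -> G).
Let X := @Graph V E s t.
Notation Lam := (iwasawa p (Zpadic p) G).
Notation Xn := (@derived p G X alpha).
Notation Gn n := (Gquo p n G).

(* The action of $\mathbb{Z}_p[G^{(n)}]$ on $\mathrm{Div}(X_n)$ extending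
   $\sigma \cdot (v, g) = (v, \sigma g)$. *)
Definition vertex_act n (a : Gn n) (y : vert (Xn n)) : vert (Xn n) :=
  (y.1, (a * y.2)%g).

Definition div_act n (a : grpring (Zpadic p) (Gn n)) (D : Div p (Xn n)) :
    Div p (Xn n) :=
  fglift (fun g => freeg_map (vertex_act g) D) a.

Definition vertex_push n (y : vert (Xn n.+1)) : vert (Xn n) :=
  (y.1, Gtrans y.2).

Definition div_push n : Div p (Xn n.+1) -> Div p (Xn n) :=
  freeg_map (@vertex_push n).

Let fin_src n (y : vert (Xn n)) : finite_set [set e : edge (Xn n) | esrc e = y].
Proof.
apply: (@sub_finite_set _ _ ((fun e : E => (e, y.2)) @` setT)).
  by move=> [e g] /= <-; exists e.
exact/finite_image/finite_finset.
Qed.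

Let fin_tgt n (y : vert (Xn n)) : finite_set [set e : edge (Xn n) | etgt e = y].
Proof.
apply: (@sub_finite_set _ _
  ((fun e : E => (e, (y.2 * (Gproj p n (alpha e))^-1)%g)) @` setT)).
  by move=> [e g] /= <-; exists e => //=; rewrite mulgK.
exact/finite_image/finite_finset.
Qed.

Lemma vertex_act_Pr n (a : Gn n) (D : Div p (Xn n)) :
  D \in Pr p (Xn n) -> (freeg_map (vertex_act a) D : Div p (Xn n)) \in Pr p (Xn n).
Proof.
pose he (e : edge (Xn n)) : edge (Xn n) := (e.1, (a * e.2)%g).
apply: (@freeg_map_Pr p (Xn n) (Xn n) (vertex_act a) he) => //.
- by move=> [e g]; rewrite /vertex_act /= mulgA.
- move=> [v x]; split=> [[e g] /= [-> ->] //| |].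
    by move=> [e g] [e' g'] _ _ /= [-> /mulgI ->].
  move=> [e g] /= [ev gx]; exists (e, x) => /=; rewrite ?ev //.
  by rewrite /he /= -gx.
- move=> [v x]; split=> [[e g] /= [<- <-]| |].
    by rewrite /vertex_act /= mulgA.
    by move=> [e g] [e' g'] _ _ /= [-> /mulgI ->].
  move=> [e g] /= [ev gx]; exists (e, (a^-1 * g)%g) => /=.
    by rewrite ev -mulgA gx mulKg.
  by rewrite /he /= mulVKg.
Qed.

Lemma div_push_Pr n (D : Div p (Xn n.+1)) :
  D \in Pr p (Xn n.+1) -> div_push D \in Pr p (Xn n).
Proof.
pose he (e : edge (Xn n.+1)) : edge (Xn n) := (e.1, Gtrans e.2).
apply: (@freeg_map_Pr p (Xn n.+1) (Xn n) (@vertex_push n) he) => //.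
- by move=> [e g]; rewrite /vertex_push /= GtransM Gtrans_proj.
- move=> [v x]; split=> [[e g] /= [-> ->] //| |].
    by move=> [e g] [e' g']; rewrite !inE /= => -[_ ->] [_ ->] [->].
  by move=> [e g] /= [ev gx]; exists (e, x) => //=; rewrite /he /= ?ev ?gx.
- move=> [v x]; split=> [[e g] /= [<- <-]| |].
    by rewrite /vertex_push /= GtransM Gtrans_proj.
    move=> [e g] [e' g']; rewrite !inE /= => -[_ gx] [_ gx'] [ee' _].
    by move: gx; rewrite -gx' ee' => /mulIg ->.
  move=> [e g] /= [ev gx].
  exists (e, (x * (Gproj p n.+1 (alpha e))^-1)%g) => /=.
    by rewrite ev mulgVK.
  rewrite /he /=; congr (_, _).
  apply: (@mulIg _ (Gproj p n (alpha e))).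
  by rewrite gx -(Gtrans_proj p n (alpha e)) -GtransM mulgVK.
Qed.

Lemma div_actD n (a : grpring (Zpadic p) (Gn n)) D D' :
  div_act a (D + D') = div_act a D + div_act a D'.
Proof.
rewrite /div_act -fglift_funD; apply: eq_fglift => g.
by rewrite raddfD.
Qed.

Lemma div_actZ n (a : grpring (Zpadic p) (Gn n)) k D :
  div_act a (k *: D) = k *: div_act a D.
Proof.
rewrite /div_act -fglift_funZ; apply: eq_fglift => g.
by rewrite freeg_mapZ.
Qed.

Lemma div_actDl n (a b : grpring (Zpadic p) (Gn n)) D :
  div_act (a + b) D = div_act a D + div_act b D.
Proof. exact: fgliftD. Qed.

Lemma div_act0 n D : div_act (0 : grpring (Zpadic p) (Gn n)) D = 0.
Proof. exact: fglift0. Qed.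

Lemma div_actx0 n a : div_act (a : grpring (Zpadic p) (Gn n)) 0 = 0.
Proof.
rewrite /div_act -[RHS](fglift_fun0 _ a); apply: eq_fglift => g.
by rewrite raddf0.
Qed.

Lemma div_actN n (a : grpring (Zpadic p) (Gn n)) D : div_act a (- D) = - div_act a D.
Proof. by apply/eqP; rewrite -addr_eq0 -div_actD addNr div_actx0. Qed.

Lemma div_actZl n k (a : grpring (Zpadic p) (Gn n)) D :
  div_act (k *: a) D = k *: div_act a D.
Proof. exact: fgliftZ. Qed.

Lemma div_actUU n (a : Gn n) (y : vert (Xn n)) :
  div_act << a >> << y >> = << vertex_act a y >>.
Proof. by rewrite /div_act fgliftE freeg_map_basis. Qed.

Lemma div_act1 n D : div_act (1 : grpring (Zpadic p) (Gn n)) D = D.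
Proof.
elim/freeg_lin_ind: D => [|k y D ih]; first by rewrite div_actx0.
rewrite div_actD ih div_actZ div_actUU.
by case: y => v g; rewrite /vertex_act mul1g.
Qed.

Lemma div_actM n (a b : grpring (Zpadic p) (Gn n)) D :
  div_act (a * b) D = div_act a (div_act b D).
Proof.
elim/freeg_lin_ind: a => [|k g a iha]; first by rewrite mul0r !div_act0.
rewrite mulrDl !div_actDl {}iha grpring_scalerAl !div_actZl.
congr (_ *: _ + _).
elim/freeg_lin_ind: b => [|l h b ihb].
  by rewrite mulr0 !div_act0 div_actx0.
rewrite mulrDr !div_actDl div_actD {}ihb grpring_scalerAr !div_actZl div_actZ.
congr (_ *: _ + _).
elim/freeg_lin_ind: D => [|m y D ihD]; first by rewrite !div_actx0.
rewrite !div_actD {}ihD !div_actZ; congr (_ *: _ + _).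
rewrite grpring_mulUU !div_actUU.
by case: y => v x; rewrite /vertex_act /= mulgA.
Qed.

Lemma div_pushD n D D' : @div_push n (D + D') = div_push D + div_push D'.
Proof. exact: fgliftD. Qed.

Lemma div_pushZ n k D : @div_push n (k *: D) = k *: div_push D.
Proof. exact: fgliftZ. Qed.

Lemma div_push0 n : @div_push n 0 = 0.
Proof. exact: fglift0. Qed.

Lemma div_pushU n (y : vert (Xn n.+1)) :
  div_push << y >> = << vertex_push y >>.
Proof. exact: freeg_map_basis. Qed.

Lemma div_act_push n (a : grpring (Zpadic p) (Gn n.+1)) D :
  div_push (div_act a D) = div_act (freeg_map (@Gtrans p n G) a) (div_push D).
Proof.
elim/freeg_lin_ind: a => [|k g a iha].
  by rewrite div_act0 div_push0 raddf0 div_act0.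
rewrite div_actDl div_pushD {}iha raddfD /= div_actDl.
rewrite div_actZl div_pushZ freeg_mapZ div_actZl; congr (_ *: _ + _).
rewrite freeg_map_basis.
elim/freeg_lin_ind: D => [|m y D ihD].
  by rewrite div_actx0 div_push0 div_actx0.
rewrite div_actD !div_pushD {}ihD div_actD; congr (_ + _).
rewrite div_actZ !div_pushZ div_actZ; congr (_ *: _).
rewrite div_actUU !div_pushU div_actUU.
by case: y => v x; rewrite /vertex_push /vertex_act /= GtransM.
Qed.

Lemma div_act_Pr n (a : grpring (Zpadic p) (Gn n)) D :
  D \in Pr p (Xn n) -> div_act a D \in Pr p (Xn n).
Proof.
have PrZ k (F : Div p (Xn n)) : F \in Pr p (Xn n) -> k *: F \in Pr p (Xn n).
  elim/zspan_ind => [|x z Px Pz|_ [c [y ->]]].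
  - by rewrite scaler0 rpred0.
  - by rewrite scalerBr rpredB.
  - by rewrite scalerA; apply: zspan_gen; exists (k * c), y.
move=> PD; elim/freeg_lin_ind: a => [|k g a iha]; first by rewrite div_act0 rpred0.
rewrite div_actDl rpredD // div_actZl PrZ //.
by rewrite /div_act fgliftE vertex_act_Pr.
Qed.

Definition pic_class n (D : Div p (Xn n)) : Pic p (Xn n) := zclass _ D.

Definition pic_act n (a : grpring (Zpadic p) (Gn n)) (x : Pic p (Xn n)) :
    Pic p (Xn n) :=
  pic_class (div_act a (repr x)).

Definition pic_push n (x : Pic p (Xn n.+1)) : Pic p (Xn n) :=
  pic_class (div_push (repr x)).

Lemma pic_actE n (a : grpring (Zpadic p) (Gn n)) D :
  pic_act a (pic_class D) = pic_class (div_act a D).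
Proof.
apply/zclass_eq; rewrite -div_actN -div_actD div_act_Pr //.
exact: zrepr_class.
Qed.

Lemma pic_pushE n D : @pic_push n (pic_class D) = pic_class (div_push D).
Proof.
apply/zclass_eq; rewrite -[_ - _](raddfB (freeg_map (@vertex_push n))) /=.
exact/div_push_Pr/zrepr_class.
Qed.

Lemma pic_classP n (x : Pic p (Xn n)) : exists D, x = pic_class D.
Proof. by exists (repr x); rewrite [RHS]zclass_repr. Qed.

Lemma pic_classD n D D' :
  @pic_class n (D + D') = pic_class D + pic_class D'.
Proof. exact: zclassD. Qed.

Lemma pic_pushD n x y : @pic_push n (x + y) = pic_push x + pic_push y.
Proof.
have [D ->] := pic_classP x; have [F ->] := pic_classP y.
by rewrite -pic_classD !pic_pushE -pic_classD div_pushD.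
Qed.

Record PicInf := MkPicInf {
  pic_level :> forall n, Pic p (Xn n);
  pic_coherent : forall n, pic_push (pic_level n.+1) = pic_level n
}.
HB.instance Definition _ := Choice.copy PicInf {classic PicInf}.

Lemma PicInf_ext (x y : PicInf) : (forall n, x n = y n) -> x = y.
Proof.
case: x y => x cx [y cy] /= e; have {}e : x = y.
  by apply: functional_extensionality_dep.
by move: cx cy; rewrite e => cx cy; congr MkPicInf; exact: Prop_irrelevance.
Qed.

Let coh0 n : @pic_push n 0 = 0.
Proof. by apply: (@addrI _ (pic_push 0)); rewrite -pic_pushD !addr0. Qed.
Let cohD (x y : PicInf) n : pic_push (x n.+1 + y n.+1) = x n + y n.
Proof. by rewrite pic_pushD !pic_coherent. Qed.
Let cohN (x : PicInf) n : pic_push (- x n.+1) = - x n.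
Proof.
apply/eqP; rewrite -addr_eq0 -(pic_coherent x n) -pic_pushD addNr.
by rewrite coh0.
Qed.
Let cohZ (a : Lam) (x : PicInf) n :
  pic_push (pic_act (a n.+1) (x n.+1)) = pic_act (a n) (x n).
Proof.
rewrite -(pic_coherent x n) -(iw_coherent a n).
have [D ->] := pic_classP (x n.+1).
by rewrite pic_actE !pic_pushE pic_actE div_act_push.
Qed.

Definition picinf_zero := MkPicInf coh0.
Definition picinf_add (x y : PicInf) := MkPicInf (cohD x y).
Definition picinf_opp (x : PicInf) := MkPicInf (cohN x).
Definition picinf_scale (a : Lam) (x : PicInf) := MkPicInf (cohZ a x).

Let addA : associative picinf_add.
Proof. by move=> x y z; apply: PicInf_ext => n /=; rewrite addrA. Qed.
Let addC : commutative picinf_add.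
Proof. by move=> x y; apply: PicInf_ext => n /=; rewrite addrC. Qed.
Let add0 : left_id picinf_zero picinf_add.
Proof. by move=> x; apply: PicInf_ext => n /=; rewrite add0r. Qed.
Let addN : left_inverse picinf_zero picinf_opp picinf_add.
Proof. by move=> x; apply: PicInf_ext => n /=; rewrite addNr. Qed.

HB.instance Definition _ := GRing.isZmodule.Build PicInf addA addC add0 addN.

Let scaleA (a b : Lam) x : picinf_scale a (picinf_scale b x) = picinf_scale (a * b) x.
Proof.
apply: PicInf_ext => n /=; have [D ->] := pic_classP (x n).
by rewrite !pic_actE div_actM.
Qed.
Let scale1 : left_id 1 picinf_scale.
Proof.
move=> x; apply: PicInf_ext => n /=; have [D ->] := pic_classP (x n).
by rewrite pic_actE div_act1.
Qed.
Let scaleDr : right_distributive picinf_scale +%R.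
Proof.
move=> a x y; apply: PicInf_ext => n /=.
have [D ->] := pic_classP (x n); have [F ->] := pic_classP (y n).
by rewrite -pic_classD !pic_actE div_actD pic_classD.
Qed.
Let scaleDl x : {morph picinf_scale^~ x : a b / a + b}.
Proof.
move=> a b; apply: PicInf_ext => n /=; have [D ->] := pic_classP (x n).
by rewrite !pic_actE div_actDl pic_classD.
Qed.

HB.instance Definition _ := GRing.Zmodule_isLmodule.Build Lam PicInf
  scaleA scale1 scaleDr scaleDl.
End PicInfinity.

(* [fg_quotient B N]: the quotient [M/N] is finitely generated over the subring
   [B] of [R]. *)
Definition fg_quotient (R : nzRingType) (M : lmodType R) (B : set R)
    (N : set M) :=
  exists k (g : 'I_k -> M), forall x : M, exists c : 'I_k -> R,
    (forall i, B (c i)) /\ N (x - \sum_i c i *: g i).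

Definition fg_module (R : nzRingType) (M : lmodType R) :=
  @fg_quotient R M setT [set 0].

Section IwasawaModules.
Variables (p : nat) (G : topGroupType).
Notation Lam := (iwasawa p (Zpadic p) G).
Implicit Type H : set G.

(* $\mathbb{Z}_p[[H]]$ for a closed subgroup [H], as the subring
   $\varprojlim_n \mathbb{Z}_p[HG_n/G_n]$ of $\mathbb{Z}_p[[G]]$. *)
Definition iwasawa_sub H : set Lam :=
  [set x | forall n (y : Gquo p n G), coeff y (x n) != 0 ->
             exists2 h, H h & y = Gproj p n h].

Definition p_power_torsion (M : lmodType Lam) : set M :=
  [set x | exists k, x *+ (p ^ k) = 0].

Definition MHG_property H (M : lmodType Lam) :=
  fg_module M /\ fg_quotient (iwasawa_sub H) (@p_power_torsion M).

Definition Ore_S H : set Lam :=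
  [set f | @fg_quotient Lam Lam^o (iwasawa_sub H) [set a * f | a in setT]].

Definition Ore_Sstar H : set Lam :=
  [set f | exists k g, Ore_S H g /\ f = (p ^ k)%:R * g].
End IwasawaModules.
Arguments Ore_Sstar p {G} H.
Arguments MHG_property {p G} H M.

(* [iota : R -> Q] is the localization of [R] at the (two-sided) Ore set [S]. *)
Definition Ore_localization (R : nzRingType) (S : set R) (Q : unitRingType)
    (iota : {rmorphism R -> Q}) :=
  [/\ forall s, S s -> iota s \is a GRing.unit,
      forall q, exists s a, S s /\ q = (iota s)^-1 * iota a,
      forall q, exists s a, S s /\ q = iota a * (iota s)^-1
    & forall a, iota a = 0 ->
        (exists2 s, S s & s * a = 0) /\ (exists2 s, S s & a * s = 0)].

Definition invertible_mx (R : nzRingType) n (A : 'M[R]_n) :=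
  exists B : 'M[R]_n, A *m B = 1%:M /\ B *m A = 1%:M.

Record GLmx (R : nzRingType) := MkGLmx {
  gl_size : nat;
  gl_mx : 'M[R]_gl_size;
  gl_inv : invertible_mx gl_mx
}.

Section K1.
Variable R : nzRingType.

HB.instance Definition _ := Choice.copy (GLmx R) {classic (GLmx R)}.

(* $K_1(R) = \mathrm{GL}(R)^{ab}$, $\mathrm{GL}(R) = \bigcup_n \mathrm{GL}_n(R)$,
   presented by the invertible matrices, with the relations $[AB] = [A] + [B]$
   and $[A \oplus 1] = [A]$. *)
Definition K1_rel : set {freeg (GLmx R) / int} :=
  [set D | (exists n (A B : 'M[R]_n) hA hB hAB,
              D = << @MkGLmx R n (A *m B) hAB >> - << @MkGLmx R n A hA >>
                  - << @MkGLmx R n B hB >>) \/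
           (exists n (A : 'M[R]_n) hA hA1,
              D = << @MkGLmx R (n + 1)%N (block_mx A 0 0 1%:M) hA1 >>
                  - << @MkGLmx R n A hA >>)].

Definition K1 := zquo K1_rel.
HB.instance Definition _ := GRing.Zmodule.on K1.

Definition K1_class n (A : 'M[R]_n) (hA : invertible_mx A) : K1 :=
  zclass K1_rel << MkGLmx hA >>.
End K1.

Section Complexes.
Variable R : nzRingType.

(* Bounded (cochain) complexes of finitely generated projective left
   [R]-modules.  The term of degree [i] is the image of the idempotent [cidem i]
   in the free left module of row vectors, i.e. the set of the [v] such that
   [v *m cidem i = v]; linear maps between such images correspond to the matrices
   [f] with [e *m f = f = f *m e'], acting on the right. *)
Record complex := MkComplex {
  crank : int -> nat;
  cidem : forall i, 'M[R]_(crank i);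
  cidemK : forall i, cidem i *m cidem i = cidem i;
  cdiff : forall i, 'M[R]_(crank i, crank (i + 1));
  cdiffl : forall i, cidem i *m cdiff i = cdiff i;
  cdiffr : forall i, cdiff i *m cidem (i + 1) = cdiff i;
  cdiff2 : forall i, cdiff i *m cdiff (i + 1) = 0;
  cbounded : exists N : nat, forall i, (N < absz i)%N -> cidem i = 0
}.
Arguments cidem : clear implicits.
Arguments cdiff : clear implicits.

Definition cterm (C : complex) i : set 'rV[R]_(crank C i) :=
  [set v | v *m cidem C i = v].
Arguments cterm : clear implicits.

(* In the next definitions, every integer is of the form [i + 1]. *)
Definition torsion_cohomology (S : set R) (C : complex) :=
  forall i x, cterm C (i + 1) x -> x *m cdiff C (i + 1) = 0 ->
    exists s y, [/\ S s, cterm C i y & s *: x = y *m cdiff C i].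

Record chain_map (C D : complex) := MkChainMap {
  cmap :> forall i, 'M[R]_(crank C i, crank D i);
  cmapl : forall i, cidem C i *m cmap i = cmap i;
  cmapr : forall i, cmap i *m cidem D i = cmap i;
  cmap_diff : forall i, cdiff C i *m cmap (i + 1) = cmap i *m cdiff D i
}.

Definition quasi_iso C D (f : chain_map C D) :=
  forall i,
    (forall x, cterm C (i + 1) x -> x *m cdiff C (i + 1) = 0 ->
       (exists2 y, cterm D i y & x *m f (i + 1) = y *m cdiff D i) ->
       exists2 z, cterm C i z & x = z *m cdiff C i) /\
    (forall y, cterm D (i + 1) y -> y *m cdiff D (i + 1) = 0 ->
       exists x z, [/\ cterm C (i + 1) x, x *m cdiff C (i + 1) = 0, cterm D i z
                     & y = x *m f (i + 1) + z *m cdiff D i]).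

Definition short_exact A B C (f : chain_map A B) (g : chain_map B C) :=
  forall i,
    [/\ forall x, cterm A i x -> x *m f i = 0 -> x = 0,
        forall y, cterm B i y ->
          (y *m g i = 0 <-> exists2 x, cterm A i x & y = x *m f i)
      & forall z, cterm C i z -> exists2 y, cterm B i y & z = y *m g i].

(* A projective resolution $\cdots \to P^{-1} \to P^0 \to M \to 0$. *)
Definition projective_resolution (P : complex) (M : lmodType R) :=
  [/\ forall i, 0 < i -> cidem P i = 0,
      forall i x, i + 1 != 0 -> cterm P (i + 1) x -> x *m cdiff P (i + 1) = 0 ->
        exists2 y, cterm P i y & x = y *m cdiff P i
    & exists aug : {linear 'rV[R]_(crank P 0) -> M},
        (forall m, exists2 x, cterm P 0 x & aug x = m) /\
        (forall x, cterm P 0 x ->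
           (aug x = 0 <-> exists2 y, cterm P (-1) y & x = y *m cdiff P (-1)))].

Section Cone.
Variables (k : nat) (A : 'M[R]_k).

Definition cone_rank (i : int) : nat :=
  match i with Posz 0 | Negz 0 => k | _ => 0 end.

Definition cone_diff (i : int) : 'M[R]_(cone_rank i, cone_rank (i + 1)) :=
  match i return 'M[R]_(cone_rank i, cone_rank (i + 1)) with
  | Negz 0 => A
  | _ => 0
  end.

Let cone_diff2 i : cone_diff i *m cone_diff (i + 1) = 0.
Proof. by case: i => [n|[|n]]; rewrite ?mul0mx // [cone_diff (_ + _)]/= mulmx0. Qed.

Let cone_bounded : exists N : nat, forall i, (N < absz i)%N ->
  (1%:M : 'M[R]_(cone_rank i)) = 0.
Proof.
exists 1%N => -[[|n]|[|n]] //= _; apply/matrixP => -[]//.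
Qed.

(* The cone $\cdots 0 \to R^k \to R^k \to 0 \cdots$, in degrees -1 and 0, of the
   endomorphism [v |-> v *m A] of the left module $R^k$. *)
Definition cone : complex :=
  @MkComplex cone_rank (fun i => 1%:M) (fun i => mulmx1 _) cone_diff
    (fun i => mul1mx _) (fun i => mulmx1 _) cone_diff2 cone_bounded.
End Cone.

Section K0.
Variable S : set R.

Record tcomplex := MkTcomplex {
  tcpx :> complex;
  tcpx_torsion : torsion_cohomology S tcpx
}.
HB.instance Definition _ := Choice.copy tcomplex {classic tcomplex}.

(* $K_0(R \text{ on } S)$: the Waldhausen $K_0$ of the category of bounded
   complexes of finitely generated projectives with [S]-torsion cohomology, with
   quasi-isomorphisms as weak equivalences, and as cofibrations the injections
   whose cokernel is again in the category. *)
Definition K0_rel : set {freeg tcomplex / int} :=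
  [set D | (exists (A B : tcomplex) (f : chain_map A B),
              quasi_iso f /\ D = << B >> - << A >>) \/
           (exists (A B C : tcomplex) (f : chain_map A B) (g : chain_map B C),
              short_exact f g /\ D = << B >> - << A >> - << C >>)].

Definition K0 := zquo K0_rel.
HB.instance Definition _ := GRing.Zmodule.on K0.

Definition K0_class (C : tcomplex) : K0 := zclass K0_rel << C >>.
End K0.

(* The connecting map of localization K-theory: the additive map sending the
   class of an endomorphism of $R^k$ invertible over [Q] to the class of its
   cone.  When [iota] is an Ore localization at [S], every class in $K_1(Q)$ is a
   difference of two classes of this form, so that it is unique. *)
Definition connecting_map (S : set R) (Q : nzRingType)
    (iota : {rmorphism R -> Q})
    (partial : {additive K1 Q -> K0 S}) :=
  forall k (A : 'M[R]_k) (hA : invertible_mx (map_mx iota A))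
         (tA : torsion_cohomology S (cone A)),
    partial (K1_class hA) = K0_class (MkTcomplex tA).
End Complexes.
Arguments projective_resolution {R} P M.

Section GraphMatrices.
Variables (p : nat) (G : topGroupType) (m : nat) (E : finType).
Variables (s t : E -> 'I_m) (alpha : E -> G).
Notation Lam := (iwasawa p (Zpadic p) G).

Definition degree (i : 'I_m) : nat :=
  (#|[pred e | s e == i]| + #|[pred e | t e == i]|)%N.

Definition Dmat (R : nzRingType) : 'M[R]_m := diag_mx (\row_i (degree i)%:R).

(* The edges from [i] to [j] are those of the orientation and the reversed ones,
   whose voltages are inverted; for [i = j] each loop contributes to both sums. *)
Definition Amat : 'M[Lam]_m := \matrix_(i, j)
  (\sum_(e | (s e == i) && (t e == j)) iw_group p (Zpadic p) (alpha e)
   + \sum_(e | (s e == j) && (t e == i)) iw_group p (Zpadic p) (alpha e)^-1%g).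

Section Level.
Variable n : nat.
Let Xn := derived p (alpha : edge (@Graph _ _ s t) -> G) n.

Definition edge_count (i j : 'I_m) (a : Gquo p n G) : nat :=
  if (i == j) && (a == 1%g)
  then (2 * #|` fset_set [set e : edge Xn | esrc e = (i, 1%g) /\
                                             etgt e = (i, 1%g)]|)%N
  else #|` fset_set [set e : edge Xn |
                       (esrc e = (i, 1%g) /\ etgt e = (j, a)) \/
                       (esrc e = (j, a) /\ etgt e = (i, 1%g))]|.

Variables (O : comNzRingType) (d : nat) (rho : Gquo p n G -> 'M[O]_d).

Definition Arho : 'M[O]_(m * d) :=
  \sum_(a \in [set: Gquo p n G])
    tensmx (\matrix_(i, j) (edge_count i j a)%:R) (rho a).

Definition Drho : 'M[O]_(m * d) := tensmx (Dmat O) 1%:M.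

Definition Artin_Ihara_h (u : O) : O :=
  \det (1%:M - u *: Arho + u ^+ 2 *: (Drho - 1%:M)).
End Level.
End GraphMatrices.

(* A square matrix [N] over the noncommutative ring [R] stands for the
   endomorphism of the free left module $R^m$ whose matrix is [N] in the usual
   convention, i.e. $e_j \mapsto \sum_i N_{ij} e_i$ (images in columns).  Row
   vectors being multiplied on the right by matrices, it is
   [v |-> v *m of_columns N]. *)
Definition of_columns (R : nzRingType) m (N : 'M[R]_m) : 'M[R]_m := N^T.

Section Evaluation.
Variables (p : nat) (G : topGroupType) (Q : unitRingType).
Variable iota : {rmorphism iwasawa p (Zpadic p) G -> Q}.
Variable pi : G -> Gam p.
Variables (O : idomainType) (alg : {rmorphism Zpadic p -> O}).
Variables (n d : nat) (rho : Gquo p n G -> 'M[O]_d).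

Definition representation :=
  rho 1%g = 1%:M /\ forall a b, rho (a * b)%g = rho a *m rho b.

(* [twisted x F]: [F] is the image of [x] under the continuous homomorphism
   $\Phi_\rho \colon \mathbb{Z}_p[[G]] \to M_d(\Lambda_O(\Gamma))$ extending
   $g \mapsto \rho(g) \otimes \pi(g)$; for [k <= N], $\pi$ induces a map
   $G/G_N \to \Gamma/\Gamma^{p^k}$. *)
Definition twisted (x : iwasawa p (Zpadic p) G) (F : 'M[LamO alg]_d) :=
  forall k i j, let N := maxn n k in
    (F i j : iwasawa p O (Gam p)) k =
    \sum_(a <- dom (x N))
      << alg (coeff a (x N)) * rho (Gproj p n (repr a)) i j
         *g Gproj p k (pi (repr a)) >>.

Variables (K : fieldType) (j : {rmorphism LamO alg -> K}).
Variable Psi : {rmorphism Q -> 'M[K]_d}.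

Definition fraction_field :=
  injective j /\ forall c : K, exists u w, j w != 0 /\ c = j u / j w.

(* [Psi] is the extension of $\Phi_\rho$ to the localization, with values in the
   matrices over the fraction field [K] of $\Lambda_O(\Gamma)$. *)
Definition extends_twist :=
  forall x, exists F, twisted x F /\ Psi (iota x) = map_mx j F.

Definition block_matrix k (A : 'M[Q]_k) : 'M[K]_(k * d) :=
  \matrix_(r, c) Psi (A (mxtens_unindex r).1 (mxtens_unindex c).1)
                     (mxtens_unindex r).2 (mxtens_unindex c).2.

Definition K1_det (x : K1 Q) : K :=
  if pselect (exists A : GLmx Q, K1_class (gl_inv A) = x) is left h
  then \det (block_matrix (gl_mx (sval (cid h)))) else 1.

(* The extension of the augmentation to $K \to L \cup \{\infty\}$ ([None] stands
   for $\infty$): the elements outside the localization of $\Lambda_O(\Gamma)$ at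
   the augmentation ideal are sent to $\infty$. *)
Definition augmentation_value (c : K) : option {fraction O} :=
  if pselect (exists uw : LamO alg * LamO alg,
                iw_aug uw.2 != 0 /\ c = j uw.1 / j uw.2) is left h
  then Some (tofrac (iw_aug (sval (cid h)).1)
             / tofrac (iw_aug (sval (cid h)).2))
  else None.

Definition evaluation (x : K1 Q) : option {fraction O} :=
  augmentation_value (K1_det x).
End Evaluation.

(* [pi] induces $G/H \cong \mathbb{Z}_p$; for [G] compact, a continuous bijective
   homomorphism $G/H \to \mathbb{Z}_p$ is an isomorphism of topological groups. *)
Definition Zpadic_quotient (p : nat) (G : topGroupType) (H : set G)
    (pi : G -> Gam p) :=
  [/\ forall g h, pi (g * h)%g = (pi g * pi h)%g, continuous pi,
      forall z, exists g, pi g = z & forall g, pi g = 1%g <-> H g].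

(* Main.v *)
Require Import Defs.
From HB Require Import structures.
From mathcomp Require Import all_boot all_order all_algebra finmap.
From mathcomp Require Import all_classical topology.
From mathcomp Require Import freeg mxtens.

Set Implicit Arguments.
Unset Strict Implicit.
Unset Printing Implicit Defensive.

Import GRing.Theory.
Local Open Scope ring_scope.
Local Open Scope classical_set_scope.

(* Write M = D - A, an m x m matrix over Lam = Z_p[[G]], acting on row vectors. Sending
   the i-th basis vector to the class of v_i gives a surjection Lam^m -> Pic_oo with kernel
   Lam^m M, by compactness. Since all X_n are connected, an element of the kernel of M is
   constant on every level X_n; coherence makes the constants infinitely divisible by p, so
   M is injective and Cone(M) is a projective resolution of Pic_oo.

   Let P be the kernel of Lam -> F_p[[Gamma]], Gamma = G/H. Then S is the complement of P:
   an element outside P satisfies a Weierstrass division, with remainders spanned over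
   Z_p[[H]] by finitely many powers of a lift of a generator of Gamma, obtained from F_p[[Gamma]] by Nakayama's lemma at each finite level and by
   compactness in the limit, and P is completely prime. A module that is finitely generated
   over Z_p[[H]] modulo p-power torsion is killed, modulo that torsion, by a matrix with
   diagonal entries outside P and off-diagonal entries in P (a characteristic polynomial
   argument for a lift of a generator of Gamma). Such a matrix becomes invertible over Q by
   Gaussian elimination. Applied to Pic_oo this gives a left inverse of M over Q; it is an
   inverse because M stays injective.

   The image of [M] under the connecting map is the class of Cone(M), and two resolutions of
   Pic_oo have the same class. Finally the determinant of the twist of M by rho lies in
   Lambda_O(Gamma), and its augmentation is the determinant of D_rho - A_rho. *)

(** * The p-adic integers *)

(** Over the noncommutative [Lam] no determinant is at hand to test invertibility, and a one-sided
    inverse over [Q] need not be two-sided; hence the matrices diagonal modulo P and the separate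
    injectivity. The right Ore condition used in the elimination is extracted from the localization
    [Q] itself. To keep its denominators outside P, powers of [p] have to be cancelled, which
    requires an [s] outside P to be regular on all of F_p[[G]], not only on F_p[[Gamma]]. Regularity
    is invisible in F_p[G/G_n], where [s] may be a zero divisor. The finite levels therefore carry
    two precisions, [n] for G and [N] for Gamma, with bounds independent of [N]: the number of
    remainders comes from the order of vanishing of [s] in F_p[[Gamma]], and an exponent E such that
    gam^E - 1 is a left multiple of [s] comes from the pigeonhole principle. An element killed by
    gam^E - 1 at every depth [N] is zero, since summing over fibers of order [p] multiplies by [p].
    The maximum principle needs an order, absent from Z_p; an integral determinant carries its
    conclusion over from the rationals. *)

Section Zpadic.
Variable p : nat.
Hypothesis hp : prime p.
Implicit Types x y : Zpadic p.

Lemma expS_gt1 k : (1 < p ^ k.+1)%N.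
Proof. by rewrite -(expn0 p) ltn_exp2l // prime_gt1. Qed.

Lemma Zpk_cast k : (Zp_trunc (p ^ k.+1)).+2 = (p ^ k.+1)%N.
Proof. exact/Zp_cast/expS_gt1. Qed.

Lemma val_natr_Zpk k n : val (n%:R : 'Z_(p ^ k.+1)) = (n %% p ^ k.+1)%N.
Proof. by rewrite Zp_nat /= Zpk_cast. Qed.

Lemma natr_Zpk_eq0 k n : ((n%:R : 'Z_(p ^ k.+1)) == 0) = (p ^ k.+1 %| n)%N.
Proof.
by rewrite Zp_nat -val_eqE /= Zpk_cast.
Qed.

Lemma natr_Zpk_eq k n m :
  (n%:R : 'Z_(p ^ k.+1)) = m%:R <-> (n = m %[mod p ^ k.+1])%N.
Proof.
rewrite !Zp_nat; split => [/(congr1 val)|e]; first by rewrite /= Zpk_cast.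
by apply: val_inj; rewrite /= Zpk_cast.
Qed.

Lemma zp_coh x k : x k = (val (x k.+1))%:R.
Proof. by rewrite zp_coherent. Qed.

Lemma zp_coh_le x k j : (k <= j)%N -> x k = (val (x j))%:R.
Proof.
elim: j => [|j ih]; first by rewrite leqn0 => /eqP ->; rewrite natr_Zp.
rewrite leq_eqVlt => /orP[/eqP ->|]; first by rewrite natr_Zp.
rewrite ltnS => kj; rewrite (ih kj) (zp_coh x j); apply/natr_Zpk_eq.
by rewrite val_natr_Zpk modn_dvdm // dvdn_exp2l.
Qed.

Lemma zp_eq_le x y k j : (k <= j)%N -> x j = y j -> x k = y k.
Proof. by move=> kj e; rewrite (zp_coh_le x kj) (zp_coh_le y kj) e. Qed.

Lemma zp_resD x y k : (x + y) k = x k + y k. Proof. by []. Qed.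
Lemma zp_resB x y k : (x - y) k = x k - y k. Proof. by []. Qed.
Lemma zp_resMn x n k : (x *+ n) k = x k *+ n.
Proof. by elim: n => [|n ih] //; rewrite !mulrS zp_resD ih. Qed.

Lemma zp_natr n k : (n%:R : Zpadic p) k = n%:R.
Proof. exact: zp_resMn. Qed.

Lemma dvdn_logn_mul k n v :
  (0 < n)%N -> (p ^ (k + logn p n).+1 %| v * n)%N -> (p ^ k.+1 %| v)%N.
Proof.
move=> n0; case: (posnP v) => [->//|v0].
by rewrite !pfactor_dvdn ?muln_gt0 ?v0 // lognM // -addSn leq_add2r.
Qed.

(** The residue modulo $p^{k+1+v}$, with $v$ the valuation of [n], is divisible by $p^{k+1}$ because
    [n] absorbs only $p^v$. *)
Lemma zp_torsion_free x n : (0 < n)%N -> x *+ n = 0 -> x = 0.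
Proof.
move=> n0 xn; apply: zp_ext => k.
have : (x *+ n) (k + logn p n)%N = 0 by rewrite xn.
rewrite zp_resMn -[X in X *+ n]natr_Zp -mulrnA => /eqP.
rewrite natr_Zpk_eq0 => dv.
rewrite (zp_coh_le x (leq_addr (logn p n) k)); apply/eqP; rewrite natr_Zpk_eq0.
exact: dvdn_logn_mul dv.
Qed.

(** Division by [p] loses one digit, so level [k] of the quotient is read off level [k.+1] of
    [x]. *)
Lemma zp_divp x : x 0 = 0 -> exists y, x = y *+ p.
Proof.
move=> x0.
have dv k : (p %| val (x k))%N.
  have /eqP : (val (x k))%:R = 0 :> 'Z_(p ^ 1) by rewrite -(zp_coh_le x (leq0n k)).
  by rewrite natr_Zpk_eq0 expn1.
have coh : Zpadic_coherent (fun k => ((val (x k.+1) %/ p)%:R : 'Z_(p ^ k.+1))).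
  move=> k; apply/natr_Zpk_eq; rewrite val_natr_Zpk.
  rewrite modn_dvdm ?dvdn_exp2l //.
  have : val (x k.+1) = (val (x k.+2) %% p ^ k.+2)%N.
    by rewrite {1}(zp_coh x k.+1) val_natr_Zpk.
  by move: (val _) (val _) => a b ->; rewrite [(p ^ k.+2)%N]expnSr -modn_divl modn_mod.
exists (MkZpadic coh); apply: zp_ext => k; rewrite zp_resMn /= -mulrnA.
have e := divnK (dv k.+1). rewrite [RHS](congr1 (fun n => n%:R : 'Z_(p ^ k.+1)) e). exact: zp_coh.
Qed.

Lemma natr_Fp_mod n m : (n = m %[mod p])%N -> (n%:R : 'F_p) = m%:R.
Proof.
by move=> e; apply: val_inj; rewrite /= !val_Fp_nat.
Qed.

Lemma natr_Fp_eq0 n : ((n%:R : 'F_p) == 0) = (p %| n)%N.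
Proof. by rewrite -(dvdn_pcharf (pchar_Fp hp)). Qed.
End Zpadic.

Definition zp_mod (p : nat) (k : nat) (x : Zpadic p) : 'Z_(p ^ k.+1) := x k.
HB.instance Definition _ p k := GRing.isZmodMorphism.Build (Zpadic p) 'Z_(p ^ k.+1)
  (@zp_mod p k) (fun x y => erefl).
HB.instance Definition _ p k := GRing.isMonoidMorphism.Build (Zpadic p) 'Z_(p ^ k.+1)
  (@zp_mod p k) (erefl, fun x y => erefl).

Definition zp_modp (p : nat) (hp : prime p) (x : Zpadic p) : 'F_p := (val (x 0))%:R.

Section ZpModp.
Variables (p : nat) (hp : prime p).

Let modpE n : (val (n%:R : 'Z_(p ^ 1)))%:R = n%:R :> 'F_p.
Proof. by apply: natr_Fp_mod; rewrite // val_natr_Zpk // expn1 modn_mod. Qed.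

Let modp_nat (x : Zpadic p) n : x 0 = n%:R -> zp_modp hp x = n%:R.
Proof. by move=> e; rewrite /zp_modp e modpE. Qed.

Let zp0 (x : Zpadic p) : x 0 = (val (x 0))%:R. Proof. by rewrite natr_Zp. Qed.

Let modpB : zmod_morphism (zp_modp hp).
Proof.
move=> x y; apply/eqP; rewrite eq_sym subr_eq; apply/eqP.
rewrite [zp_modp hp x](@modp_nat _ (val ((x - y) 0) + val (y 0))) ?natrD //.
by rewrite -!zp0 zp_resB subrK.
Qed.

Let modpM : GRing.monoid_morphism (zp_modp hp).
Proof.
split; first by rewrite (@modp_nat 1 1).
move=> x y; rewrite [LHS](@modp_nat _ (val (x 0) * val (y 0))) ?natrM //.
by rewrite -!zp0.
Qed.

HB.instance Definition _ := GRing.isZmodMorphism.Build _ _ (zp_modp hp) modpB.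
HB.instance Definition _ := GRing.isMonoidMorphism.Build _ _ (zp_modp hp) modpM.

Lemma zp_modp_eq0 x : zp_modp hp x = 0 -> x 0 = 0.
Proof.
move=> /eqP; rewrite /zp_modp natr_Fp_eq0 // => dv; apply/eqP.
by rewrite -[x 0]natr_Zp natr_Zpk_eq0 // expn1.
Qed.
End ZpModp.

(** * The determinant on K_1 *)

Section Nonzero.
Variable K : fieldType.

(* The multiplicative group of [K], written additively, so that a function with
   values in it extends linearly to free abelian groups. *)
Record nonzero := Nonzero { nz_val :> K; nz_valP : nz_val != 0 }.
HB.instance Definition _ := [isSub for nz_val].
HB.instance Definition _ := [Choice of nonzero by <:].

Implicit Types x y z : nonzero.
Definition nz_one := Nonzero (oner_neq0 K).
Definition nz_inv x := @Nonzero (nz_val x)^-1 ltac:(by rewrite invr_eq0 nz_valP).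
Definition nz_mul x y := @Nonzero (nz_val x * nz_val y) ltac:(by rewrite mulf_neq0 ?nz_valP).

Let mulA : associative nz_mul. Proof. by move=> x y z; apply: val_inj; rewrite /= mulrA. Qed.
Let mulC : commutative nz_mul. Proof. by move=> x y; apply: val_inj; rewrite /= mulrC. Qed.
Let mul1 : left_id nz_one nz_mul. Proof. by move=> x; apply: val_inj; rewrite /= mul1r. Qed.
Let mulV : left_inverse nz_one nz_inv nz_mul.
Proof. by move=> x; apply: val_inj; rewrite /= mulVf ?nz_valP. Qed.

HB.instance Definition _ := GRing.isZmodule.Build nonzero mulA mulC mul1 mulV.
End Nonzero.

Section BlockMatrix.
Variables (Q : unitRingType) (K : fieldType) (d : nat) (Psi : {rmorphism Q -> 'M[K]_d}).

Lemma sum_mxtens (V : nmodType) k e (F : 'I_(k * e) -> V) :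
  \sum_x F x = \sum_i \sum_j F (mxtens_index (i, j)).
Proof.
rewrite pair_big /= (reindex (@mxtens_index k e)) /=; last first.
  by exists (@mxtens_unindex k e) => x _; rewrite (mxtens_indexK, mxtens_unindexK).
by apply: eq_bigr => -[].
Qed.

Lemma block_matrixE k (A : 'M[Q]_k) r c : block_matrix Psi A r c =
  Psi (A (mxtens_unindex r).1 (mxtens_unindex c).1) (mxtens_unindex r).2 (mxtens_unindex c).2.
Proof. by rewrite mxE. Qed.

Lemma block_matrixM k (A B : 'M[Q]_k) :
  block_matrix Psi (A *m B) = block_matrix Psi A *m block_matrix Psi B.
Proof.
apply/matrixP => r c; rewrite !mxE sum_mxtens rmorph_sum summxE.
apply: eq_bigr => i _; rewrite rmorphM mxE.
by apply: eq_bigr => b _; rewrite !mxE mxtens_indexK.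
Qed.

Lemma block_matrix1 k : block_matrix Psi (1%:M : 'M[Q]_k) = 1%:M.
Proof.
apply/matrixP => r c; rewrite !mxE -[r in RHS]mxtens_unindexK -[c in RHS]mxtens_unindexK.
rewrite (inj_eq (can_inj (@mxtens_indexK k d))).
case: (mxtens_unindex r) => i a; case: (mxtens_unindex c) => i' b /=.
rewrite xpair_eqE; case: eqP => _; first by rewrite rmorph1 mxE.
by rewrite rmorph0 mxE.
Qed.

Lemma det_block_neq0 k (A : 'M[Q]_k) : invertible_mx A -> \det (block_matrix Psi A) != 0.
Proof.
case=> B [AB _]; apply/eqP => e.
have := congr1 (fun M => \det (block_matrix Psi M)) AB.
by rewrite block_matrixM det_mulmx e mul0r block_matrix1 det1 => /esym/eqP; rewrite oner_eq0.
Qed.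

Lemma block_matrix_stab k (A : 'M[Q]_k) :
  \det (block_matrix Psi (block_mx A 0 0 (1%:M : 'M_1))) = \det (block_matrix Psi A).
Proof.
have e : (k * d + 1 * d = (k + 1) * d)%N by rewrite mulnDl.
have -> : block_matrix Psi (block_mx A 0 0 1%:M)
   = castmx (e, e) (block_mx (block_matrix Psi A) 0 0 (block_matrix Psi (1%:M : 'M_1))).
  apply/matrixP => r c; rewrite castmxE.
  (* [mxtens_index] orders by block first, so the first [k] blocks and the last one are consecutive
     intervals, and the cast matches them with the block decomposition. *)
  have split_row (x : 'I_((k + 1) * d)) :
     (exists y, cast_ord (esym e) x = lshift (1 * d) y /\
        mxtens_unindex x = (lshift 1 (mxtens_unindex y).1, (mxtens_unindex y).2)) \/
     (exists y, cast_ord (esym e) x = rshift (k * d) y /\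
        mxtens_unindex x = (rshift k (mxtens_unindex y).1, (mxtens_unindex y).2)).
    rewrite -[x]mxtens_unindexK; case: (mxtens_unindex x) => i a.
    rewrite mxtens_indexK; case: (split_ordP i) => u ->.
      left; exists (mxtens_index (u, a)); rewrite mxtens_indexK; split=> //.
      exact: val_inj.
    right; exists (mxtens_index (u, a)); rewrite mxtens_indexK; split=> //.
    by apply: val_inj; rewrite /= mulnDl addnA.
  have [[y [-> ey]]|[y [-> ey]]] := split_row r;
    have [[z [-> ez]]|[z [-> ez]]] := split_row c;
    rewrite block_matrixE ey ez ?(block_mxEul, block_mxEur, block_mxEdl, block_mxEdr)
      ?block_matrixE // [X in Psi X]mxE [RHS]mxE rmorph0 mxE //.
rewrite -[RHS]mulr1 -(det1 K (1 * d)) -block_matrix1 -(det_ublock _ 0).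
by move: (block_mx _ _ _ _); case: _ / e => M; rewrite castmx_id.
Qed.

Definition gl_det (A : GLmx Q) : zmodule (nonzero K) := Nonzero (det_block_neq0 (gl_inv A)).

(** [K1_det] uses a chosen representative. Independence of the choice reduces to this: the
    determinant is multiplicative and stable, so its linear extension kills the relations of
    [K1]. *)
Lemma fglift_gl_det D : D \in zspan (@K1_rel Q) -> fglift gl_det D = 0.
Proof.
elim/zspan_ind => [|x y ex ey|D' [[k [A [B [hA [hB [hAB ->]]]]]]|[k [A [hA [hA1 ->]]]]]].
- by rewrite raddf0.
- by rewrite raddfB /= ex ey subrr.
- rewrite !raddfB /= !fgliftE; apply/eqP; rewrite -addrA -opprD subr_eq0; apply/eqP.
  by apply: val_inj; rewrite /= block_matrixM det_mulmx.
- rewrite raddfB /= !fgliftE; apply/eqP; rewrite subr_eq0; apply/eqP.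
  by apply: val_inj; rewrite /= block_matrix_stab.
Qed.

Lemma K1_det_class k (A : 'M[Q]_k) (hA : invertible_mx A) :
  K1_det Psi (K1_class hA) = \det (block_matrix Psi A).
Proof.
rewrite /K1_det; case: pselect => [h|]; last by case; exists (MkGLmx hA).
case: (cid h) => B /= /zclass_eq/fglift_gl_det.
rewrite raddfB /= !fgliftE => /eqP; rewrite subr_eq0 => /eqP/(congr1 (@nz_val K)).
by case: B.
Qed.
End BlockMatrix.

(** * The augmentation *)

Section Augmentation.

Lemma grpring_augM (R : comNzRingType) (Y : groupType) (x y : grpring R Y) :
  fglift (fun=> 1 : R^o) (x * y) = fglift (fun=> 1 : R^o) x * fglift (fun=> 1 : R^o) y.
Proof.
elim/freeg_lin_ind: x => [|k a x ihx]; first by rewrite mul0r raddf0 mul0r.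
rewrite mulrDl !raddfD /= mulrDl ihx; congr (_ + _).
rewrite grpring_scalerAl !fgliftZ fgliftE -scalerAl mul1r; congr (_ *: _).
elim/freeg_lin_ind: y {ihx} => [|c b y ihy]; first by rewrite mulr0 raddf0.
rewrite mulrDr !raddfD /= ihy grpring_scalerAr grpring_mulUU.
by rewrite !fgliftZ !fgliftE.
Qed.

Lemma iw_aug_zmod p R G : zmod_morphism (@iw_aug p R G).
Proof. by move=> x y; rewrite /iw_aug raddfB. Qed.
Lemma iw_aug_monoid p R G : GRing.monoid_morphism (@iw_aug p R G).
Proof. by split=> [|x y]; rewrite /iw_aug ?grpring_augM // fgliftE. Qed.
HB.instance Definition _ p R G :=
  GRing.isZmodMorphism.Build (iwasawa p R G) R (@iw_aug p R G) (@iw_aug_zmod p R G).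
HB.instance Definition _ p R G :=
  GRing.isMonoidMorphism.Build (iwasawa p R G) R (@iw_aug p R G) (@iw_aug_monoid p R G).

Variables (p : nat) (O : idomainType) (alg : {rmorphism Zpadic p -> O}).

Definition lamO_aug (b : LamO alg) : O := iw_aug (lamO_val b).
Lemma lamO_aug_zmod : zmod_morphism lamO_aug.
Proof. by move=> x y; rewrite /lamO_aug raddfB. Qed.
Lemma lamO_aug_monoid : GRing.monoid_morphism lamO_aug.
Proof. by split=> [|x y]; rewrite /lamO_aug ?rmorph1 // rmorphM. Qed.
HB.instance Definition _ := GRing.isZmodMorphism.Build (LamO alg) O lamO_aug lamO_aug_zmod.
HB.instance Definition _ := GRing.isMonoidMorphism.Build (LamO alg) O lamO_aug lamO_aug_monoid.

(* The value does not depend on the fraction chosen in [augmentation_value]. *)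
Lemma augmentation_value_integral (K : fieldType) (j : {rmorphism LamO alg -> K}) b :
  injective j -> augmentation_value j (j b) = Some (tofrac (lamO_aug b)).
Proof.
move=> jI; rewrite /augmentation_value; case: pselect => [h|]; last first.
  by case; exists (b, 1); rewrite /= -/(lamO_aug 1) !rmorph1 divr1 oner_neq0.
case: (cid h) => -[u w] /= [w0 e]; congr Some.
have jw : j w != 0.
  by apply: contraNneq w0 => /eqP; rewrite -(rmorph0 j) (inj_eq jI) => /eqP ->; rewrite rmorph0.
have {}e : u = b * w by apply: jI; rewrite rmorphM e divfK.
rewrite -!/(lamO_aug _) e rmorphM tofracM mulfK // tofrac_eq0 //.
Qed.
End Augmentation.

(** * Harmonic functions on a finite graph *)

Section Laplacian.
Import Order.TTheory Num.Theory.
Variables (T : finType) (nb : T -> seq T).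
Hypothesis conn : forall A : {pred T}, (exists x, x \in A) ->
  (forall x y, x \in A -> y \in nb x -> y \in A) -> forall x, x \in A.

(** Maximum principle: at a maximum other than [x0] the differences are nonnegative with sum 0, so
    all neighbours are maxima too. If [x0] were not a maximum, the set of maxima would be closed
    under neighbours and hence contain [x0]. *)
Lemma harmonic_le (u : T -> rat) x0 :
  (forall x, x != x0 -> \sum_(y <- nb x) (u x - u y) = 0) -> forall x, u x <= u x0.
Proof.
move=> harm; pose z := [arg max_(x > x0) u x]%O.
have zmax x : u x <= u z by rewrite /z; case: arg_maxP => // i _; apply.
suff : u x0 = u z by move=> ->.
apply/eqP; apply: contraT => uz.
suff /(_ x0) : forall x, x \in [pred x | u x == u z] by rewrite inE (negPf uz).
apply: conn => [|x y]; first by exists z; rewrite inE.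
rewrite !inE => /eqP xz yx; have xx0 : x != x0 by apply: contraNneq uz => <-; rewrite xz.
have /eqP := harm x xx0; rewrite psumr_eq0 => [|w _]; last by rewrite subr_ge0 xz.
by move=> /allP/(_ y yx); rewrite /= subr_eq0 xz eq_sym.
Qed.

Lemma harmonic_eq0 (u : T -> rat) x0 : u x0 = 0 ->
  (forall x, x != x0 -> \sum_(y <- nb x) (u x - u y) = 0) -> forall x, u x = 0.
Proof.
move=> u0 harm x; apply: le_anti; rewrite -u0 harmonic_le //=.
rewrite -[u x0]opprK -[u x]opprK lerN2.
apply: (@harmonic_le (fun x => - u x) x0) => w wx0.
rewrite -[RHS]oppr0 -[in RHS](harm w wx0) -sumrN; apply: eq_bigr => y _.
by rewrite opprB opprK addrC.
Qed.

(* The Laplacian with the row of [x0] replaced by the evaluation at [x0] is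
   nonsingular over the rationals, hence has a nonzero integral determinant. *)
Lemma harmonic_const (p : nat) (hp : prime p) (v : T -> Zpadic p) :
  (forall x, \sum_(y <- nb x) (v x - v y) = 0) -> forall x y, v x = v y.
Proof.
move=> harm x0 x; symmetry; move: x.
pose L : 'M[int]_#|T| := \matrix_(i, j)
  if enum_val i == x0 then ((enum_val j == x0)%:R : int)
  else \sum_(y <- nb (enum_val i)) ((enum_val i == enum_val j)%:R - (y == enum_val j)%:R).
have LE (R : comNzRingType) (u : T -> R) x :
    \sum_(j < #|T|) (L (enum_rank x) j)%:~R * u (enum_val j)
    = if x == x0 then u x0 else \sum_(y <- nb x) (u x - u y).
  have delta (w : T) : \sum_(j < #|T|) (w == enum_val j)%:R * u (enum_val j) = u w.
    rewrite (bigD1 (enum_rank w)) //= enum_rankK eqxx mul1r big1 ?addr0 // => j jw.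
    case: eqP => [wj|_]; last by rewrite mul0r.
    by rewrite wj enum_valK eqxx in jw.
  under eq_bigr do rewrite mxE enum_rankK.
  case: ifP => [_|_].
    by rewrite -[RHS]delta; apply: eq_bigr => j _; rewrite eq_sym rmorph_nat.
  under eq_bigr do rewrite rmorph_sum mulr_suml.
  rewrite exchange_big; apply: eq_bigr => y _ /=.
  under eq_bigr do rewrite rmorphB !rmorph_nat mulrBl.
  by rewrite sumrB !delta.
have detL : \det L != 0.
  rewrite -(intr_eq0 rat) -det_map_mx -det_tr; apply/det0P => -[u u0 uL].
  apply/negP: u0; rewrite negbK; apply/eqP/rowP => i; rewrite mxE.
  pose f x := u 0 (enum_rank x).
  have Lf x : \sum_j (L (enum_rank x) j)%:~R * f (enum_val j) = 0.
    have /rowP/(_ (enum_rank x)) := uL; rewrite !mxE => e; rewrite -[RHS]e.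
    by apply: eq_bigr => j _; rewrite !mxE mulrC /f enum_valK.
  rewrite -[i]enum_valK; apply: (@harmonic_eq0 f x0) => [|x xx0].
    by have := Lf x0; rewrite LE eqxx.
  by have := Lf x; rewrite LE (negPf xx0).
(* After subtraction of the value at [x0], the modified row of [L] kills [w] as well, and the
   adjugate gives [\det L] times [w] equal to 0. *)
pose w : 'cV[Zpadic p]_#|T| := \col_j (v (enum_val j) - v x0).
have Lw : map_mx intr L *m w = 0.
  apply/colP => i; rewrite mxE [RHS]mxE -[i]enum_valK.
  rewrite (eq_bigr (fun j => (L (enum_rank (enum_val i)) j)%:~R * (v (enum_val j) - v x0))); last first.
    by move=> j _; rewrite [map_mx _ _ _ _]mxE [w _ _]mxE.
  rewrite (LE _ (fun x => v x - v x0)); case: ifP => [_|_]; first exact: subrr.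
  rewrite -[RHS](harm (enum_val i)); apply: eq_bigr => y _.
  by rewrite opprB addrA subrK.
have : (\det L)%:~R *: w = 0.
  by rewrite -mul_scalar_mx -det_map_mx -mul_adj_mx -mulmxA Lw mulmx0.
move=> /colP w0 x; have := w0 (enum_rank x); rewrite !mxE enum_rankK => /eqP.
have tf (k : int) (a : Zpadic p) : k != 0 -> k%:~R * a = 0 -> a = 0.
  case: k => k k0; rewrite ?NegzE ?mulrNz ?mulNr -?pmulrn mulr_natl.
    by apply: zp_torsion_free => //; rewrite lt0n.
  by move=> /eqP; rewrite oppr_eq0 => /eqP; apply: zp_torsion_free.
by move=> /eqP /(tf _ _ detL)/eqP; rewrite subr_eq0 => /eqP.
Qed.
End Laplacian.

(** * Resolutions by a cone *)

Section ConeResolution.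
Variable R : nzRingType.

Lemma row_rank0 k (x y : 'rV[R]_k) : k = 0%N -> x = y.
Proof. by move=> k0; apply/rowP => -[i ik]; exfalso; rewrite k0 in ik. Qed.

Lemma matrix_rank0 k n (A B : 'M[R]_(k, n)) : k = 0%N -> A = B.
Proof. by move=> k0; apply/matrixP => -[i ik]; exfalso; rewrite k0 in ik. Qed.

Lemma cone_rank_pos k n : cone_rank k (Posz n + 1) = 0%N.
Proof. by rewrite -PoszD addn1. Qed.

Lemma cone_rank_neg k n : cone_rank k (Negz n.+2 + 1) = 0%N.
Proof. by []. Qed.

Variables (k : nat) (A : 'M[R]_k) (M : lmodType R) (P : complex R).
Hypotheses (resA : projective_resolution (cone A) M) (resP : projective_resolution P M).

Lemma cone_resolution_inj (x : 'rV[R]_k) : x *m A = 0 -> x = 0.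
Proof.
move=> xA; have [_ exA _] := resA.
have [||y _ ->] := exA (Negz 1) x _ _ xA => //; first by rewrite /cterm /= mulmx1.
exact: mulmx0.
Qed.

Lemma resolution_diff0 : cdiff P 0 = 0.
Proof.
by have [P0 _ _] := resP; rewrite -(cdiffr P 0) [cidem P _](P0 1) ?mulmx0.
Qed.

(** Comparison of projective resolutions: the cone has free terms in two degrees only, so it
    suffices to lift basis vectors, first through the augmentations and then through the
    differential of [P]. *)
Lemma cone_resolution_quasi_iso : exists f : chain_map (cone A) P, quasi_iso f.
Proof.
have [_ _ [augA [Asurj Aker]]] := resA; have [P0 Pex [augP [Psurj Pker]]] := resP.
have ct (x : 'rV[R]_k) : @cterm R (cone A) 0 x by rewrite /cterm /= mulmx1.
have lin n (N : lmodType R) (f : {linear 'rV[R]_n -> N}) q (c : 'rV[R]_q) (V : 'M[R]_(q, n)) :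
    f (c *m V) = \sum_i c 0 i *: f (row i V).
  by rewrite mulmx_sum_row raddf_sum; apply: eq_bigr => i _; exact: linearZ_LR.
pose wS (i : 'I_k) := cid2 (Psurj (augA (delta_mx 0 i))).
pose F0 : 'M[R]_(k, crank P 0) := \matrix_i s2val (wS i).
have F0e : F0 *m cidem P 0 = F0.
  by apply/row_matrixP => i; rewrite row_mul rowK; exact: (s2valP (wS i)).
have F0aug (x : 'rV[R]_k) : augP (x *m F0) = augA x.
  rewrite lin -[in RHS](mulmx1 x) lin; apply: eq_bigr => i _; congr (_ *: _).
  by rewrite rowK rowE mulmx1; exact: (s2valP' (wS i)).
have cF0 (x : 'rV[R]_k) : @cterm R P 0 (x *m F0) by rewrite /cterm /= -mulmxA F0e.
have uS (i : 'I_k) : {y : 'rV_(crank P (-1)) | @cterm R P (-1) y & row i A *m F0 = y *m cdiff P (-1)}.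
  apply: cid2; apply/(Pker _ (cF0 _)); rewrite F0aug; apply/Aker => //.
  by exists (delta_mx 0 i); rewrite ?rowE // /cterm /= mulmx1.
pose F1 : 'M[R]_(k, crank P (-1)) := \matrix_i s2val (uS i).
have F1e : F1 *m cidem P (-1) = F1.
  by apply/row_matrixP => i; rewrite row_mul rowK; exact: (s2valP (uS i)).
have F01 : A *m F0 = F1 *m cdiff P (-1).
  apply/row_matrixP => i; rewrite !row_mul rowK; exact: (s2valP' (uS i)).
pose F i : 'M[R]_(cone_rank k i, crank P i) :=
  match i return 'M[R]_(cone_rank k i, crank P i) with
  | Posz 0 => F0 | Negz 0 => F1 | _ => 0 end.
have Fl i : cidem (cone A) i *m F i = F i by exact: mul1mx.
have Fr i : F i *m cidem P i = F i by case: i => [[|n]|[|n]] //=; rewrite mul0mx.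
have Fd i : cdiff (cone A) i *m F (i + 1) = F i *m cdiff P i.
  case: i => [[|n]|[|n]].
  - transitivity (F0 *m cdiff P 0); last by [].
    by rewrite resolution_diff0 !mulmx0.
  - exact: matrix_rank0.
  - exact: F01.
  - exact: matrix_rank0.
exists (MkChainMap Fl Fr Fd) => i; split.
(* Cohomology is tested in degree [i + 1]: [Negz 0] concerns the cokernel in degree 0, [Negz 1] the
   kernel in degree -1, and the cone vanishes in all other degrees. *)
- case: i => [n|[|[|n]]] x _ dx [y cy xy].
  + by exists 0; [rewrite /cterm /= mul0mx | apply: row_rank0; exact: cone_rank_pos].
  + have : augA x = 0 by rewrite -F0aug; apply/Pker; [exact: cF0 | exists y].
    by move=> /(Aker x (ct x))[z cz xz]; exists z.
  + exists 0; first by rewrite /cterm /= mul0mx.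
    by rewrite mul0mx; exact: cone_resolution_inj.
  + by exists 0; [rewrite /cterm /= mul0mx | apply: row_rank0; exact: cone_rank_neg].
- case: i => [n|[|n]] y cy dy.
  + have [|z cz yz] := Pex n y _ cy dy; first by rewrite -PoszD addn1.
    exists 0, z; split => //; rewrite ?mul0mx ?add0r //.
    by rewrite /cterm /= mul0mx.
  + have [x _ xy] := Asurj (augP y).
    have [z cz yz] : exists2 z, @cterm R P (-1) z & y - x *m F0 = z *m cdiff P (-1).
      apply/Pker; last by rewrite raddfB /= F0aug xy subrr.
      by rewrite /cterm /= mulmxBl -mulmxA F0e; congr (_ - _).
    have yE : y = x *m F0 + z *m cdiff P (-1).
      have addBK (V : zmodType) (a b c : V) : a - b = c -> a = b + c.
        by move=> <-; rewrite addrC subrK.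
      exact: addBK yz.
    by exists x, z; split => //; exact: mulmx0.
  + have [|z cz yz] := Pex (Negz n.+1) y _ cy dy => //.
    exists 0, z; split => //; rewrite ?mul0mx ?add0r //.
    by rewrite /cterm /= mul0mx.
Qed.
End ConeResolution.

Lemma K0_class_quasi_iso (R : nzRingType) (S : set R) (A B : tcomplex S) (f : chain_map A B) :
  quasi_iso f -> K0_class A = K0_class B.
Proof.
move=> qf; apply/esym/zclass_eq/zspan_gen; left.
by exists A, B, f.
Qed.

(** * Free modules and matrices *)

Section FreegMore.
Variables (R : comNzRingType).

Lemma freeg_map_comp (K K' K'' : choiceType) (h : K -> K') (h' : K' -> K'')
    (D : {freeg K / R}) :
  freeg_map h' (freeg_map h D) = freeg_map (h' \o h) D.
Proof.
elim/freeg_lin_ind: D => [|k x D ih]; first by rewrite !raddf0.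
by rewrite !raddfD /= ih !freeg_mapZ !freeg_map_basis.
Qed.

Lemma eq_freeg_map (K K' : choiceType) (h h' : K -> K') :
  h =1 h' -> @freeg_map R K K' h =1 freeg_map h'.
Proof. by move=> /funext ->. Qed.

Lemma freeg_map_id (K : choiceType) (h : K -> K) (D : {freeg K / R}) :
  h =1 id -> freeg_map h D = D.
Proof.
move=> hid; elim/freeg_lin_ind: D => [|k x D ih]; first by rewrite !raddf0.
by rewrite !raddfD /= ih !freeg_mapZ !freeg_map_basis hid.
Qed.

Lemma eq_freeg_map_dom (K K' : choiceType) (h h' : K -> K') (D : {freeg K / R}) :
  {in dom D, h =1 h'} -> freeg_map h D = freeg_map h' D.
Proof.
move=> e; rewrite -[D]freeg_sumE !raddf_sum; apply: eq_big_seq => x xD /=.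
by rewrite !freeg_mapU e.
Qed.

Lemma coeff_map_inj (K K' : choiceType) (h : K -> K') (D : {freeg K / R}) x :
  injective h -> coeff (h x) (freeg_map h D) = coeff x D.
Proof.
move=> hi; elim/freeg_lin_ind: D => [|k y D ih]; first by rewrite raddf0 !coeff0.
by rewrite raddfD /= freeg_mapZ freeg_map_basis !coeffD !coeffZ !coeffU ih inj_eq.
Qed.
End FreegMore.

Section FreegCoef.
Variables (R R' : comNzRingType) (f : {rmorphism R -> R'}).

Lemma freeg_coef_is_zmod (K : choiceType) : zmod_morphism (@freeg_coef R R' f K).
Proof.
move=> x y; apply/eqP/freeg_eqP => z.
by rewrite coeffB !coeff_freeg_coef coeffB rmorphB.
Qed.
HB.instance Definition _ (K : choiceType) :=
  GRing.isZmodMorphism.Build {freeg K / R} {freeg K / R'} (@freeg_coef R R' f K)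
    (@freeg_coef_is_zmod K).

Lemma freeg_coefU (K : choiceType) k (x : K) :
  freeg_coef f << k *g x >> = << f k *g x >>.
Proof.
apply/eqP/freeg_eqP => y.
by rewrite coeff_freeg_coef !coeffU rmorphM rmorph_nat.
Qed.

Lemma freeg_coefZ (K : choiceType) k (D : {freeg K / R}) :
  freeg_coef f (k *: D) = f k *: freeg_coef f D.
Proof.
apply/eqP/freeg_eqP => y.
by rewrite coeff_freeg_coef !coeffZ coeff_freeg_coef rmorphM.
Qed.

Variable Q : groupType.
Lemma freeg_coef_monoid :
  GRing.monoid_morphism (@freeg_coef R R' f Q : grpring R Q -> grpring R' Q).
Proof.
split=> [|x y].
  by apply/eqP/freeg_eqP => z; rewrite coeff_freeg_coef !coeffU rmorphM rmorph1 rmorph_nat.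
elim/freeg_lin_ind: x => [|k a x ihx]; first by rewrite mul0r raddf0 mul0r.
rewrite mulrDl raddfD /= ihx raddfD /= mulrDl; congr (_ + _).
rewrite grpring_scalerAl !freeg_coefZ grpring_scalerAl; congr (_ *: _) => {ihx}.
elim/freeg_lin_ind: y => [|l b y ihy]; first by rewrite mulr0 raddf0 mulr0.
rewrite mulrDr raddfD /= ihy raddfD /= mulrDr; congr (_ + _).
rewrite grpring_scalerAr !freeg_coefZ grpring_scalerAr; congr (_ *: _).
by rewrite grpring_mulUU !freeg_coefU !rmorph1 grpring_mulUU.
Qed.
End FreegCoef.

Lemma subr1_exp_char (R : nzRingType) (q : nat) (r : R) :
  q \in [pchar R] -> (r - 1) ^+ q = r ^+ q - 1.
Proof.
move=> hq; rewrite -!(pFrobenius_autE hq).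
by rewrite pFrobenius_autB_comm ?pFrobenius_aut1 //; apply: commr1.
Qed.

Lemma subr1_expX_char (R : nzRingType) (q n : nat) (r : R) :
  q \in [pchar R] -> (r - 1) ^+ (q ^ n) = r ^+ (q ^ n) - 1.
Proof.
move=> hq; elim: n => [|n ih]; first by rewrite expn0 !expr1.
by rewrite expnSr !exprM ih subr1_exp_char.
Qed.

Lemma exp_sub1_dvd (R : nzRingType) (x : R) m k : exists u, x ^+ (m * k) - 1 = u * (x ^+ m - 1).
Proof.
rewrite exprM; elim: k => [|k [u ku]]; first by exists 0; rewrite mul0r subrr.
exists ((x ^+ m) ^+ k + u); rewrite mulrDl -ku mulrBr mulr1 -exprSr.
by rewrite addrA subrK.
Qed.

Lemma subrBDB (V : zmodType) (u v a a' b b' : V) :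
  u - v - (a - a' + (b - b')) = (u - (a + b)) - (v - (a' + b')).
Proof. by rewrite !opprD !opprK (addrACA (- a)) (addrACA u). Qed.

Lemma fsbig_fin_pred (V : zmodType) (I : finType) (P : pred I) (F : I -> V) :
  \sum_(i \in [set i | P i]) F i = \sum_(i | P i) F i.
Proof.
rewrite fsbig_finite /=; last exact: finite_finset.
rewrite -[RHS]big_filter; apply: perm_big.
apply: uniq_perm => [||i]; rewrite ?fset_uniq ?filter_uniq ?index_enum_uniq //.
rewrite mem_filter mem_index_enum andbT in_fset_set; last exact: finite_finset.
by apply/asboolP/idP.
Qed.

Lemma card_fset_setR (O : nzSemiRingType) (T : choiceType) (A : set T) : finite_set A ->
  (#|` fset_set A|)%:R = \sum_(x \in A) (1 : O).
Proof. by move=> fA; rewrite fsbig_finite // big_const_seq iter_addr_0 count_predT cardfE. Qed.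

Lemma grpring_expU (R : comNzRingType) (Y : groupType) (a : Y) n :
  (<< a >> : grpring R Y) ^+ n = << (a ^+ n)%g >>.
Proof. by elim: n => [|n ih] //; rewrite exprS ih grpring_mulUU expgS. Qed.

Lemma grpring_mulU (R : comNzRingType) (Y : groupType) (a : Y) (D : grpring R Y) :
  (<< a >> : grpring R Y) * D = freeg_map (fun b => (a * b)%g) D.
Proof.
elim/freeg_lin_ind: D => [|k x D ih]; first by rewrite mulr0 raddf0.
by rewrite mulrDr raddfD /= ih grpring_scalerAr grpring_mulUU freeg_mapZ freeg_map_basis.
Qed.

Lemma coeff_mulU (R : comNzRingType) (Y : groupType) (a y : Y) (D : grpring R Y) :
  coeff y ((<< a >> : grpring R Y) * D) = coeff (a^-1 * y)%g D.
Proof. by rewrite grpring_mulU -{1}[y](mulVKg a) coeff_map_inj //; apply: mulgI. Qed.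

Lemma coeff_mulUr (R : comNzRingType) (Y : groupType) (a y : Y) (D : grpring R Y) :
  coeff y (D * (<< a >> : grpring R Y)) = coeff (y * a^-1)%g D.
Proof.
elim/freeg_lin_ind: D => [|k x D ih]; first by rewrite mul0r !coeff0.
rewrite mulrDl !coeffD ih; congr (_ + _); rewrite grpring_scalerAl grpring_mulUU.
rewrite !coeffZ !coeffU !mul1r; congr (_ * (_)%:R).
by rewrite (can2_eq (mulgK a) (mulgVK a)).
Qed.

Lemma coeff_freeg_map_fiber (R : comNzRingType) (K K' : choiceType) (h : K -> K')
    (s : seq K) (b : K') (D : {freeg K / R}) :
  uniq s -> (forall a, (a \in s) = (h a == b)) ->
  coeff b (freeg_map h D) = \sum_(a <- s) coeff a D.
Proof.
move=> us sE; elim/freeg_lin_ind: D => [|k x D ih].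
  by rewrite raddf0 coeff0 big1 // => a _; rewrite coeff0.
rewrite raddfD /= freeg_mapZ freeg_map_basis coeffD coeffZ coeffU ih mul1r.
rewrite [RHS](eq_bigr (fun a => k * (x == a)%:R + coeff a D)); last first.
  by move=> a _; rewrite coeffD coeffZ coeffU mul1r.
rewrite big_split /= -mulr_sumr -sE; congr (k * _ + _).
have [xs|xs] := boolP (x \in s).
  rewrite (bigD1_seq x) //= eqxx big1 ?addr0 // => i /negPf; rewrite eq_sym => -> //.
rewrite big1_seq // => i /andP[_ si]; case: eqP => // xi.
by rewrite xi si in xs.
Qed.

Section InvertibleMx.
Variable R : nzRingType.

Lemma invertible_mulmx n (A B : 'M[R]_n) :
  invertible_mx A -> invertible_mx B -> invertible_mx (A *m B).
Proof.
move=> [A' [AA' A'A]] [B' [BB' B'B]]; exists (B' *m A').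
by rewrite !mulmxA -(mulmxA A) BB' mulmx1 AA' -(mulmxA B') A'A mulmx1 B'B.
Qed.

Lemma invertible_factor n (A T : 'M[R]_n) :
  invertible_mx (A *m T) -> invertible_mx T -> invertible_mx A.
Proof.
move=> AT [T' [TT' T'T]]; rewrite -[A]mulmx1 -TT' mulmxA.
by apply: invertible_mulmx => //; exists T.
Qed.

Lemma invertible_upper n1 n2 (A1 : 'M[R]_n1) X (A2 : 'M[R]_n2) :
  invertible_mx A1 -> invertible_mx A2 -> invertible_mx (block_mx A1 X 0 A2).
Proof.
move=> [B1 [AB1 BA1]] [B2 [AB2 BA2]]; exists (block_mx B1 (- (B1 *m X *m B2)) 0 B2).
rewrite !mulmx_block !mulmx0 !mul0mx !addr0 !add0r AB1 BA1 AB2 BA2.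
rewrite mulmxN !mulmxA AB1 mul1mx addNr mulNmx -!mulmxA BA2 mulmx1 subrr.
by rewrite -!scalar_mx_block.
Qed.

Lemma invertible_lower n1 n2 (A1 : 'M[R]_n1) X (A2 : 'M[R]_n2) :
  invertible_mx A1 -> invertible_mx A2 -> invertible_mx (block_mx A1 0 X A2).
Proof.
move=> [B1 [AB1 BA1]] [B2 [AB2 BA2]]; exists (block_mx B1 0 (- (B2 *m X *m B1)) B2).
rewrite !mulmx_block !mulmx0 !mul0mx !addr0 !add0r AB1 BA1 AB2 BA2.
rewrite mulmxN !mulmxA AB2 mul1mx subrr mulNmx -!mulmxA BA1 mulmx1 addNr.
by rewrite -!scalar_mx_block.
Qed.
End InvertibleMx.

Lemma invertible_scalar1 (R : unitRingType) (x : R) :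
  x \is a GRing.unit -> invertible_mx (x%:M : 'M_1).
Proof. by move=> ux; exists (x^-1)%:M; rewrite -!scalar_mxM mulrV // mulVr. Qed.

Lemma invertible_diag (R : unitRingType) n (d : 'rV[R]_n) :
  (forall i, d 0 i \is a GRing.unit) -> invertible_mx (diag_mx d).
Proof.
move=> ud; exists (diag_mx (\row_i (d 0 i)^-1)); rewrite !mulmx_diag.
by split; rewrite -[1%:M]diag_const_mx; congr diag_mx; apply/rowP => i;
  rewrite !mxE ?mulrV ?mulVr.
Qed.

(** * Completed group rings *)

(* A homomorphism on [G] factoring through [G / G_n] for some [n]. *)
Record level_hom (p : nat) (G : topGroupType) (Y : groupType) := LevelHom {
  lhom_fun :> G -> Y;
  lhom_level : nat;
  lhomM : forall g h, lhom_fun (g * h)%g = (lhom_fun g * lhom_fun h)%g;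
  lhom_triv : forall g, Gpow p lhom_level g -> lhom_fun g = 1%g
}.

Section Gpow.
Variables (p : nat) (G : topGroupType).

Lemma Gpow_le m n : (m <= n)%N -> @Gpow p G n `<=` Gpow p m.
Proof.
elim: n => [|n ih]; first by rewrite leqn0 => /eqP ->.
rewrite leq_eqVlt => /orP[/eqP -> //|]; rewrite ltnS => mn.
exact: subset_trans (@GpowS p G n) (ih mn).
Qed.

Lemma Gproj_eq_repr n g : exists2 k, Gpow p n k & repr (Gproj p n g) = (g * k)%g :> G.
Proof.
have /GprojP h := Gproj_repr (Gproj p n g).
exists (g^-1 * repr (Gproj p n g))%g; last by rewrite mulVKg.
by have := subgroupV (Gpow_subgroup p G n) h; rewrite invgM invgK.
Qed.

Lemma Gproj1P n (g : G) : Gproj p n g = 1%g <-> Gpow p n g.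
Proof.
split=> [e|e]; first by have /esym/GprojP := e; rewrite invg1 mul1g.
by apply/esym/GprojP; rewrite invg1 mul1g.
Qed.

Lemma Gpow_level0 g : @Gpow p G 0 g.
Proof. by move=> K _ _ /(_ g); rewrite expn0 expg1. Qed.
End Gpow.

Section LevelHom.
Variables (p : nat) (G : topGroupType) (Y : groupType) (phi : level_hom p G Y).

Lemma lhom1 : phi 1%g = 1%g.
Proof. by apply: (@mulgI _ (phi 1%g)); rewrite -lhomM !mulg1. Qed.

Lemma lhomV g : phi (g^-1)%g = (phi g)^-1%g.
Proof. by apply: (@mulgI _ (phi g)); rewrite -lhomM !mulgV lhom1. Qed.

Lemma lhomX g n : phi (g ^+ n)%g = (phi g ^+ n)%g.
Proof. by elim: n => [|n ih]; rewrite ?expg0 ?lhom1 // !expgS lhomM ih. Qed.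

Lemma lhom_repr n g : (lhom_level phi <= n)%N -> phi (repr (Gproj p n g)) = phi g.
Proof.
move=> ln; have [k kn ->] := Gproj_eq_repr p n g.
by rewrite lhomM (@lhom_triv _ _ _ phi k) ?mulg1 //; apply: (Gpow_le ln kn).
Qed.

Definition lhom_quo n (a : Gquo p n G) : Y := phi (repr a).

Lemma lhom_quoM n : (lhom_level phi <= n)%N ->
  forall a b : Gquo p n G, lhom_quo (a * b)%g = (lhom_quo a * lhom_quo b)%g.
Proof.
move=> ln a b; rewrite /lhom_quo -lhomM -{1}(Gproj_repr a) -{1}(Gproj_repr b).
by rewrite -GprojM lhom_repr.
Qed.

Section Phi.
Variables (A : comNzRingType) (red : {rmorphism Zpadic p -> A}).
Notation Lam := (iwasawa p (Zpadic p) G).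

(* The ring homomorphism $\mathbb{Z}_p[[G]] \to A[Y]$ induced by [phi] and [red]. *)
Definition iw_map (x : Lam) : grpring A Y :=
  freeg_map (@lhom_quo (lhom_level phi)) (freeg_coef red (x (lhom_level phi))).

Lemma iw_mapE n x : (lhom_level phi <= n)%N ->
  iw_map x = freeg_map (@lhom_quo n) (freeg_coef red (x n)).
Proof.
elim: n => [|n ih]; first by rewrite leqn0 /iw_map => /eqP ->.
rewrite leq_eqVlt => /orP[/eqP <- //|]; rewrite ltnS => ln.
rewrite ih // -(iw_coherent x n) -freeg_coef_map freeg_map_comp.
apply: eq_freeg_map => a /=; rewrite /lhom_quo /Gtrans.
by rewrite lhom_repr.
Qed.

Lemma iw_map_zmod : zmod_morphism iw_map.
Proof. by move=> x y; rewrite /iw_map !raddfB. Qed.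

Lemma iw_map_monoid : GRing.monoid_morphism iw_map.
Proof.
split=> [|x y]; rewrite /iw_map.
  rewrite [freeg_coef red _](freeg_coefU red) rmorph1 freeg_map_basis.
  by rewrite /lhom_quo lhom_repr // lhom1.
rewrite [freeg_coef red _](freeg_coef_monoid red _).2.
exact: (grpring_mapM (lhom_quoM (leqnn _))).
Qed.

HB.instance Definition _ := GRing.isZmodMorphism.Build Lam (grpring A Y) iw_map iw_map_zmod.
HB.instance Definition _ := GRing.isMonoidMorphism.Build Lam (grpring A Y) iw_map iw_map_monoid.

Lemma iw_map_group g : iw_map (iw_group p (Zpadic p) g) = << phi g >>.
Proof. by rewrite /iw_map /= freeg_coefU rmorph1 freeg_map_basis /lhom_quo lhom_repr. Qed.

Lemma iw_map_const r : iw_map (iw_const p G r) = << red r *g 1%g >>.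
Proof. by rewrite /iw_map /= freeg_coefU freeg_mapU /lhom_quo lhom_repr // lhom1. Qed.

Lemma iw_map_level0 n (x : Lam) : (lhom_level phi <= n)%N -> x n = 0 -> iw_map x = 0.
Proof. by move=> ln x0; rewrite (iw_mapE x ln) x0 !raddf0. Qed.
End Phi.
End LevelHom.

Lemma iw_map_push p G (Y Y' : groupType) (phi : level_hom p G Y) (psi : level_hom p G Y')
    (h : Y -> Y') (A : comNzRingType) (red : {rmorphism Zpadic p -> A}) x :
  (forall g, psi g = h (phi g)) -> iw_map psi red x = freeg_map h (iw_map phi red x).
Proof.
move=> e; set n := maxn (lhom_level phi) (lhom_level psi).
rewrite (@iw_mapE _ _ _ psi _ _ n) ?leq_maxr // (@iw_mapE _ _ _ phi _ _ n) ?leq_maxl //.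
by rewrite freeg_map_comp; apply: eq_freeg_map => a; rewrite /lhom_quo /= e.
Qed.

Lemma iw_groupM p R (G : topGroupType) (g h : G) : iw_group p R (g * h)%g = iw_group p R g * iw_group p R h.
Proof. by apply: iwasawa_ext => n /=; rewrite grpring_mulUU GprojM. Qed.

Lemma iw_group1 p R (G : topGroupType) : iw_group p R (1%g : G) = 1.
Proof. exact: iwasawa_ext. Qed.

Lemma iw_groupX p R (G : topGroupType) (g : G) n : iw_group p R (g ^+ n)%g = iw_group p R g ^+ n.
Proof. by elim: n => [|n ih]; rewrite ?expg0 ?iw_group1 // expgS exprS iw_groupM ih. Qed.

Section Approx.
Variables (p : nat) (G : topGroupType).
Notation Lam := (iwasawa p (Zpadic p) G).
Implicit Types x y : Lam.

Lemma iw_levelD x y n : (x + y) n = x n + y n. Proof. by []. Qed.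
Lemma iw_levelB x y n : (x - y) n = x n - y n. Proof. by []. Qed.
Lemma iw_levelM x y n : (x * y) n = x n * y n. Proof. by []. Qed.
Lemma iw_levelMn x k n : (x *+ k) n = x n *+ k.
Proof. by elim: k => [|k ih] //; rewrite !mulrS iw_levelD ih. Qed.
Lemma iw_level_sum (I : Type) (r : seq I) (P : pred I) (F : I -> Lam) n :
  (\sum_(i <- r | P i) F i) n = \sum_(i <- r | P i) F i n.
Proof. by elim/big_rec2: _ => // i y z _ <-. Qed.

Lemma iw_const_level c x n : (iw_const p G c * x) n = c *: x n.
Proof.
by rewrite /= freegU_scale grpring_scalerAl [_ * _](mul1r (x n : grpring _ _)).
Qed.

Lemma iw_lift n (D : {freeg (Gquo p n G) / (Zpadic p)}) : exists x : Lam, x n = D.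
Proof.
elim/freeg_lin_ind: D => [|k a D [x <-]]; first by exists 0.
exists (iw_const p G k * iw_group p _ (repr a) + x).
by rewrite iw_levelD iw_const_level /= Gproj_repr.
Qed.

Lemma iw_level_ind n (P : Lam -> Prop) :
  (forall x y, P x -> P y -> P (x + y)) ->
  (forall x, x n = 0 -> P x) ->
  (forall c g, P (iw_const p G c * iw_group p _ g)) -> forall x, P x.
Proof.
move=> PD P0 Pg x.
have [y Py yx] : exists2 y, P y & y n = x n.
  elim/freeg_lin_ind: (x n) => [|k a D [y Py <-]]; first by exists 0 => //; apply: P0.
  exists (iw_const p G k * iw_group p _ (repr a) + y); first exact: PD.
  by rewrite iw_levelD iw_const_level /= Gproj_repr.
by rewrite -(subrK y x); apply: PD => //; apply: P0; rewrite iw_levelB yx subrr.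
Qed.

End Approx.

(** * Uniform groups *)

Lemma Zpadic_pow_divisible p (hp : prime p) n (z : Zpadic p) :
  (forall i, (i < n)%N -> z i = 0) -> exists y, z = y *+ p ^ n.
Proof.
elim: n z => [|n ih] z z0; first by exists z; rewrite expn0 mulr1n.
have [y zy] := zp_divp hp (z0 0 isT).
have [w yw] : exists w, y = w *+ p ^ n.
  apply: ih => i i_n; have /eqP := z0 i.+1 i_n.
  rewrite zy zp_resMn -[X in X *+ p]natr_Zp -mulrnA natr_Zpk_eq0 //.
  rewrite (zp_coh y i) => dv; apply/eqP; rewrite natr_Zpk_eq0 //.
  have cancel v : (p ^ i.+2 %| v * p)%N -> (p ^ i.+1 %| v)%N.
    by rewrite [(p ^ i.+2)%N]expnSr dvdn_pmul2r ?prime_gt0.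
  exact: cancel dv.
by exists w; rewrite zy yw -mulrnA expnSr.
Qed.

Lemma Zpadic_divisible_eq0 p (hp : prime p) (x : Zpadic p) :
  (forall n, exists y, x = y *+ p ^ n) -> x = 0.
Proof.
move=> dx; apply: zp_ext => k; have [y ->] := dx k.+1.
rewrite zp_resMn -mulr_natr; apply/eqP.
by rewrite [_%:R](_ : _ = 0) ?mulr0 //; apply/eqP; rewrite natr_Zpk_eq0.
Qed.

Section GammaPow.
Variables (p : nat) (hp : prime p).
Implicit Type z : Gam p.

Lemma Gam_expg z n : (z ^+ n)%g = (z : Zpadic p) *+ n.
Proof. by elim: n => [|n ih]; rewrite ?expg0 // expgS ih mulrS. Qed.

(** Residue [i] is taken modulo $p^{i+1}$, so the condition means that $p^n$ divides [z]. Such a [z]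
    is itself a $p^n$-th power of the additive group, and these elements form a closed subgroup. *)
Lemma Gam_powP n z : Gpow p n z <-> forall i, (i < n)%N -> (z : Zpadic p) i = 0.
Proof.
split=> [Gz|z0]; last first.
  have [y ->] := Zpadic_pow_divisible hp z0.
  by move=> K _ _ /(_ y); rewrite Gam_expg.
apply: (Gz (fun z => forall i, (i < n)%N -> (z : Zpadic p) i = 0)).
- split=> [//|x y x0 y0 i i_n].
  by rewrite [LHS](_ : _ = (x : Zpadic p) i - (y : Zpadic p) i) // x0 // y0 // subrr.
- move=> x cx i i_n.
  have [|y [y0 xy]] := cx [set y | forall j, (j < n)%N -> (y : Zpadic p) j = (x : Zpadic p) j].
    by exists n.
  by rewrite -xy // y0.
- move=> g i i_n; rewrite Gam_expg zp_resMn -mulr_natr.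
  rewrite [_%:R](_ : _ = 0) ?mulr0 //; apply/eqP; rewrite natr_Zpk_eq0 //.
  exact: dvdn_exp2l.
Qed.

Lemma Gam_projP n (z z' : Gam p) :
  Gproj p n z = Gproj p n z' <->
  forall i, (i < n)%N -> (z : Zpadic p) i = (z' : Zpadic p) i.
Proof.
apply: iff_trans; first exact: GprojP. apply: iff_trans; first exact: Gam_powP.
split=> e i /e h; first by apply/eqP; rewrite -subr_eq0 -oppr_eq0 opprB -h addrC.
by rewrite [LHS](_ : _ = - (z : Zpadic p) i + (z' : Zpadic p) i) // h addNr.
Qed.

Lemma Gam_proj_nat n (z : Gam p) : exists k, Gproj p n z = Gproj p n ((1 : Zpadic p) *+ k : Gam p).
Proof.
exists (val ((z : Zpadic p) n)); apply/Gam_projP => i /ltnW i_n.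
by rewrite (zp_coh_le hp _ i_n) zp_natr.
Qed.
End GammaPow.

Section Uniform.
Variables (p l : nat) (hp : prime p) (G : topGroupType) (hG : uniform_pro_p p l G).

Lemma Gpow_grading n : exists f : G -> 'rV['F_p]_l,
  [/\ forall x y, Gpow p n x -> Gpow p n y -> f (x * y)%g = f x + f y,
      forall v, exists2 x, Gpow p n x & f x = v
    & forall x, Gpow p n x -> (f x = 0 <-> Gpow p n.+1 x)].
Proof. by have [_ _ /(_ n)[_]] := hG. Qed.

Lemma grading_eq n (f : G -> 'rV['F_p]_l) x y :
  (forall x y, Gpow p n x -> Gpow p n y -> f (x * y)%g = f x + f y) ->
  (forall x, Gpow p n x -> (f x = 0 <-> Gpow p n.+1 x)) ->
  Gpow p n x -> Gpow p n y -> (f x = f y <-> Gpow p n.+1 (x^-1 * y)%g).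
Proof.
move=> fM f0 Gx Gy; have sG := Gpow_subgroup p G n.
have Gxy : Gpow p n (x^-1 * y)%g by exact: subgroupM sG (subgroupV sG Gx) Gy.
apply: iff_trans (f0 _ Gxy).
have -> : f y = f x + f (x^-1 * y)%g by rewrite -fM // mulVKg.
split=> [e|->]; last by rewrite addr0.
by apply: (@addrI _ (f x)); rewrite -e addr0.
Qed.

Lemma Gquo_finite n : exists s : seq (Gquo p n G), uniq s /\ forall a, a \in s.
Proof.
suff : exists s : seq (Gquo p n G), forall a, a \in s.
  by case=> s h; exists (undup s); split=> [|a]; rewrite ?undup_uniq // mem_undup.
elim: n => [|n [s hs]].
  exists [:: 1%g] => a; rewrite inE -(Gproj_repr a); apply/eqP/Gproj1P.
  exact: Gpow_level0.
have [f [fM fS f0]] := Gpow_grading n.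
pose u (v : 'rV['F_p]_l) : G := sval (cid2 (fS v)).
have uP v : Gpow p n (u v) /\ f (u v) = v by rewrite /u; case: (cid2 _).
exists [seq Gproj p n.+1 (repr b * u v)%g | b <- s, v <- enum [set: 'rV['F_p]_l]%SET] => a.
have : Gpow p n ((repr (Gtrans a))^-1 * repr a)%g.
  by apply/GprojP; rewrite Gproj_repr.
set k := (_ * _)%g => Gk.
apply/allpairsP; exists (Gtrans a, f k); split => //=; first by rewrite mem_enum inE.
rewrite -{1}(Gproj_repr a); apply/esym/GprojP; rewrite invgM -mulgA -/k.
apply/(grading_eq fM f0) => //; first exact: (uP _).1.
by rewrite (uP _).2.
Qed.
End Uniform.

Section Tower.
Variables (p l : nat) (hp : prime p) (G : topGroupType) (hG : uniform_pro_p p l G).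
Variables (H : set G) (hHn : normal_subgroup H) (pi : G -> Gam p)
  (hpi : Zpadic_quotient H pi).
Implicit Types g h : G.

(** The exact cardinality $p^l$ matters: it makes a coherent sequence of constants divisible by all
    powers of [p] in [lap_mx_inj]. *)
Lemma Gtrans_fiber n (b : Gquo p n G) : exists s : seq (Gquo p n.+1 G),
  [/\ uniq s, forall a, (a \in s) = (Gtrans a == b) & size s = (p ^ l)%N].
Proof.
have [f [fM fS f0]] := Gpow_grading hG n.
pose u (v : 'rV['F_p]_l) : G := sval (cid2 (fS v)).
have uP v : Gpow p n (u v) /\ f (u v) = v by rewrite /u; case: (cid2 _).
exists [seq Gproj p n.+1 (repr b * u v)%g | v <- enum [set: 'rV['F_p]_l]%SET]; split.
- rewrite map_inj_in_uniq ?enum_uniq // => v w _ _ /GprojP.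
  rewrite invgM -mulgA mulKg => /(grading_eq fM f0) e.
  by rewrite -(uP v).2 -(uP w).2; apply: e; apply: (uP _).1.
- move=> a; apply/mapP/eqP => [[v _ ->]|<-].
    rewrite Gtrans_proj -{2}(Gproj_repr b); apply/GprojP.
    rewrite invgM -mulgA mulVg mulg1.
    exact: subgroupV (Gpow_subgroup _ _ _) (uP _).1.
  have : Gpow p n ((repr (Gtrans a))^-1 * repr a)%g.
    by apply/GprojP; rewrite Gproj_repr.
  set k := (_ * _)%g => Gk; exists (f k); first by rewrite mem_enum inE.
  rewrite -{1}(Gproj_repr a); apply/esym/GprojP; rewrite invgM -mulgA -/k.
  by apply/(grading_eq fM f0) => //; [exact: (uP _).1 | rewrite (uP _).2].
- by rewrite size_map -cardE cardsT card_mx mul1n card_Fp.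
Qed.

Lemma pi_mul g h : pi (g * h)%g = (pi g * pi h)%g. Proof. by case: hpi. Qed.
Lemma pi_one : pi 1%g = 1%g.
Proof. by apply: (@mulgI _ (pi 1%g)); rewrite -pi_mul !mulg1. Qed.
Lemma pi_inv g : pi (g^-1)%g = (pi g)^-1%g.
Proof. by apply: (@mulgI _ (pi g)); rewrite -pi_mul !mulgV pi_one. Qed.
Lemma pi_exp g n : pi (g ^+ n)%g = (pi g ^+ n)%g.
Proof. by elim: n => [|n ih]; rewrite ?expg0 ?pi_one // !expgS pi_mul ih. Qed.
Lemma pi_ker g : pi g = 1%g <-> H g. Proof. by case: hpi. Qed.

Lemma pi_Gpow n g : Gpow p n g -> Gpow p n (pi g).
Proof.
move=> Gg K sK cK powK; apply: (Gg (fun g => K (pi g))).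
- split; first by rewrite pi_one; exact: subgroup1.
  by move=> x y Kx Ky; rewrite pi_mul pi_inv; apply: sK.2.
- by apply: closed_comp cK => x _; case: hpi => _ c _ _; apply: c.
- by move=> x; rewrite pi_exp.
Qed.

Lemma pi_gen_ex : exists g, pi g = (1 : Zpadic p). Proof. by case: hpi. Qed.
Definition gam : G := sval (cid pi_gen_ex).
Lemma pi_gam n : pi (gam ^+ n)%g = (n%:R : Zpadic p).
Proof. by rewrite pi_exp Gam_expg /gam; case: (cid _) => /= g ->. Qed.

(** In dimension zero every $G_n$ would be all of $G$, whereas [pi] sends [gam] to 1, which is not
    divisible by [p]. *)
Lemma dim_gt0 : (0 < l)%N.
Proof.
rewrite lt0n; apply/eqP => l0.
have all n g : Gpow p n g.
  elim: n => [|n ih]; first exact: Gpow_level0.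
  have [f [_ _ f0]] := Gpow_grading hG n.
  by apply/f0 => //; apply/rowP => i; have := ltn_ord i; rewrite {2}l0.
have /(Gam_powP hp)/(_ 0 isT) := pi_Gpow (all 1 (gam ^+ 1)%g).
by rewrite pi_gam zp_natr => /eqP; rewrite oner_eq0.
Qed.

(** If $\pi(g) = p^n z$ and [w] lifts [z], then $w^{p^n}$ lies in $G_n$ and has the same image as
    [g]. *)
Lemma pi_decomp n g : Gpow p n (pi g) ->
  exists h v, [/\ H h, g = (h * v)%g & Gpow p n v].
Proof.
move=> /(Gam_powP hp)/(Zpadic_pow_divisible hp)[z piz].
have [w piw] : exists w, pi w = z by case: hpi.
exists (g * (w ^+ (p ^ n))^-1)%g, (w ^+ (p ^ n))%g; split.
- apply/pi_ker; rewrite pi_mul pi_inv pi_exp piw Gam_expg piz.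
  exact: (addrN (z *+ p ^ n : Zpadic p)).
- by rewrite mulgVK.
- by move=> K _ _ /(_ w).
Qed.

Definition proj_hom n : level_hom p G (Gquo p n G) :=
  @LevelHom p G _ (Gproj p n) n (@GprojM p n G) (fun g => (Gproj1P p n g).2).

Lemma gam_hom_subproof n g h :
  Gproj p n (pi (g * h)%g) = (Gproj p n (pi g) * Gproj p n (pi h))%g.
Proof. by rewrite pi_mul GprojM. Qed.

Lemma gam_triv n g : Gpow p n g -> Gproj p n (pi g) = 1%g.
Proof. by move=> /pi_Gpow /Gproj1P. Qed.

Definition gam_hom n : level_hom p G (Gquo p n (Gam p)) :=
  @LevelHom p G _ (fun g => Gproj p n (pi g)) n (@gam_hom_subproof n) (@gam_triv n).

Let pairM n N g h : (Gproj p n (g * h)%g, Gproj p N (pi (g * h)%g)) =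
  ((Gproj p n g, Gproj p N (pi g)) * (Gproj p n h, Gproj p N (pi h)))%g.
Proof. by rewrite GprojM pi_mul GprojM. Qed.
Let pair_triv n N g : Gpow p (maxn n N) g ->
  (Gproj p n g, Gproj p N (pi g)) = 1%g.
Proof.
move=> Gg; congr (_, _).
  by apply/Gproj1P; apply: Gpow_le Gg; rewrite leq_maxl.
by apply: gam_triv; apply: Gpow_le Gg; rewrite leq_maxr.
Qed.

(** The two precisions are independent: [n] is fixed for $G$ while [N] refines $\Gamma$ without
    bound. *)
Definition pair_hom n N : level_hom p G (Gquo p n G * Gquo p N (Gam p))%type :=
  @LevelHom p G _ (fun g => (Gproj p n g, Gproj p N (pi g))) (maxn n N)
    (@pairM n N) (@pair_triv n N).

Notation Lam := (iwasawa p (Zpadic p) G).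
Notation modp := (zp_modp hp).
Notation "[: g :]" := (iw_group p (Zpadic p) g) (at level 0, format "[:  g  :]").

Lemma grpring_pchar (Y : groupType) : p \in [pchar (grpring 'F_p Y)].
Proof.
rewrite inE hp /=; apply/eqP; rewrite [p%:R]freegU_muln.
by rewrite (pcharf0 (pchar_Fp hp)) freegU0.
Qed.

Lemma iw_map_pmul (Y : groupType) (phi : level_hom p G Y) (x : Lam) :
  iw_map phi modp (x *+ p) = 0.
Proof. by rewrite raddfMn /= -mulr_natr (pcharf0 (grpring_pchar Y)) mulr0. Qed.

Lemma iw_map_const_group (Y : groupType) (phi : level_hom p G Y)
    (A : comNzRingType) (red : {rmorphism Zpadic p -> A}) c g :
  iw_map phi red (iw_const p G c * [: g :]) = red c *: << phi g >>.
Proof.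
rewrite rmorphM /= iw_map_const iw_map_group freegU_scale grpring_scalerAl.
by rewrite grpring_mulUU mul1g.
Qed.

(** Its additive span is the right ideal generated by the $h - 1$ with [h] in [K]. *)
Definition group_diff (K : set G) : set Lam :=
  [set y | exists h z, K h /\ y = ([: h :] - 1) * z].

(** Fix a representative [rho] of each fiber of [psi]. Replacing the group elements that occur in
    [x] at a sufficiently deep level by their representatives costs an element of the right ideal,
    and the image of the result depends only on [iw_map psi modp x], which is 0. *)
Lemma iw_map_ker_span (Y Y' : groupType) (phi : level_hom p G Y)
    (psi : level_hom p G Y') (K : set G) (x : Lam) :
  (forall g g', psi g = psi g' -> exists2 h, K h & phi g = phi (h * g')%g) ->
  iw_map psi modp x = 0 ->
  exists2 y, y \in zspan (group_diff K) & iw_map phi modp (x - y) = 0.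
Proof.
move=> KP x0; pose M := maxn (lhom_level phi) (lhom_level psi).
pose rho (y : Y') : G :=
  if pselect (exists g, psi g = y) is left e then sval (cid e) else 1%g.
have rhoK g : psi (rho (psi g)) = psi g.
  rewrite /rho; case: pselect => [e|[]]; last by exists g.
  by case: (cid e).
have hP g : {h | K h & phi g = phi (h * rho (psi g))%g}.
  by apply: cid2; apply: KP; rewrite rhoK.
pose h g : G := s2val (hP g).
pose r := dom (x M).
pose x1 := \sum_(a <- r) iw_const p G (coeff a (x M)) * [: repr a :].
have x1M : x1 M = x M.
  rewrite iw_level_sum -[RHS]freeg_sumE; apply: eq_bigr => a _.
  by rewrite iw_const_level /= Gproj_repr -freegU_scale.
have x1_psi : iw_map psi modp x1 = 0.
  rewrite -x0; apply/eqP; rewrite -subr_eq0 -raddfB; apply/eqP.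
  apply: (@iw_map_level0 _ _ _ psi _ _ M); first exact: leq_maxr.
  by rewrite iw_levelB x1M subrr.
pose y := \sum_(a <- r) ([: h (repr a) :] - 1) *
    (iw_const p G (coeff a (x M)) * [: rho (psi (repr a)) :]).
exists y.
  rewrite rpred_sum // => a _; apply: zspan_gen.
  by exists (h (repr a)), (iw_const p G (coeff a (x M)) * [: rho (psi (repr a)) :]); split => //; rewrite /h; case: (hP _).
have -> : x - y = (x - x1) + (x1 - y) by rewrite addrA subrK.
rewrite raddfD /= (@iw_map_level0 _ _ _ phi _ _ M (x - x1)) ?leq_maxl //; last first.
  by rewrite iw_levelB x1M subrr.
rewrite add0r -sumrB raddf_sum.
transitivity (freeg_map (phi \o rho) (iw_map psi modp x1)); last first.
  by rewrite x1_psi raddf0.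
rewrite !raddf_sum /=; apply: eq_bigr => a _; rewrite raddfB /=.
rewrite !iw_map_const_group rmorphM rmorphB rmorph1 /= iw_map_const_group iw_map_group.
rewrite freeg_mapZ freeg_map_basis /= grpring_scalerAr -scalerBr; congr (_ *: _).
rewrite mulrBl mul1r grpring_mulUU -lhomM opprB addrA.
have -> : phi (repr a) = phi (h (repr a) * rho (psi (repr a)))%g.
  by rewrite /h; case: (hP _).
by rewrite addrAC subrr add0r.
Qed.

(** * Nakayama's lemma for the kernel of pi *)

Section Nakayama.
Variables (Y : groupType) (phi : level_hom p G Y) (Z : {pred Lam}).
Hypotheses (ZH : forall h x, H h -> x \in Z -> [: h :] * x \in Z)
  (Zker : forall x, iw_map phi modp x = 0 -> x \in Z).

Definition Zplus (K : set G) : {pred Lam} :=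
  zspan [set y | y \in Z \/ group_diff K y].

Lemma Zplus_Z (K : set G) x : x \in Z -> x \in Zplus K.
Proof. by move=> xZ; apply: zspan_gen; left. Qed.

Lemma Zplus_diff (K : set G) h x : K h -> ([: h :] - 1) * x \in Zplus K.
Proof. by move=> Kh; apply: zspan_gen; right; exists h, x. Qed.

(* If [z] is the head of [zs] and [T0] the span for the tail, every element is in
   [T0] modulo [([: z :] - 1)], hence modulo [([: z :] - 1) ^+ p], which is
   [[: z ^+ p :] - 1] modulo [p]. *)
Lemma nakayama_list (K K' : set G) (zs : seq G) :
  normal_subgroup K' -> K `<=` H ->
  (forall x y, K x -> K y -> K' (x * y * x^-1 * y^-1)%g) ->
  (forall x, K x -> K' (x ^+ p)%g) ->
  (forall z, z \in zs -> K z) ->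
  (forall x, x \in Zplus (fun h => K' h \/ h \in zs)) ->
  forall x, x \in Zplus K'.
Proof.
move=> nK' KH com powK; elim: zs => [|z zs ih] zsK.
  move=> all x; have := all x; elim/zspan_ind => [|u v|u [uZ|[h [w [Kh ->]]]]].
  - by rewrite rpred0.
  - by move=> Tu Tv; rewrite rpredB.
  - exact: Zplus_Z.
  - by case: Kh => // Kh; apply: Zplus_diff.
move=> all; apply: ih => [u uz|]; first by apply: zsK; rewrite inE uz orbT.
set T0 := Zplus (fun h => K' h \/ h \in zs).
have Kz : K z by apply: zsK; rewrite mem_head.
have zT x : x \in T0 -> [: z :] * x \in T0.
  elim/zspan_ind => [|u v Tu Tv|u [uZ|[h [w [Kh ->]]]]].
  - by rewrite mulr0 rpred0.
  - by rewrite mulrBr rpredB.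
  - by apply: Zplus_Z; apply: ZH => //; apply: KH.
  (* Moving [z] past [h - 1] costs the commutator of [z] and [h], which lies in [K'] by hypothesis
     or by normality. *)
  - have -> : [: z :] * (([: h :] - 1) * w) =
       ([: (z * h * z^-1 * h^-1)%g :] - 1) * ([: (h * z)%g :] * w) +
       ([: h :] - 1) * ([: z :] * w).
      rewrite !mulrA !mulrBr !mulrBl !mulr1 !mul1r -!iw_groupM !mulgA.
      by rewrite mulgVK mulgVK addrA subrK.
    rewrite rpredD //; apply: Zplus_diff => //; left.
    case: Kh => [Kh|hz]; last by apply: com => //; apply: zsK; rewrite inE hz orbT.
    have sK' := nK'.1; apply: subgroupM => //; last exact: subgroupV.
    by have := nK'.2 h (z^-1)%g Kh; rewrite conjgE invgK mulgA.
have step x : exists w, x - ([: z :] - 1) * w \in T0.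
  have := all x; elim/zspan_ind => [|u v [wu uT] [wv vT]|u [uZ|[h [w [Kh ->]]]]].
  - by exists 0; rewrite mulr0 subr0 rpred0.
  - exists (wu - wv); rewrite mulrBr.
    have -> : u - v - (([: z :] - 1) * wu - ([: z :] - 1) * wv) =
      (u - ([: z :] - 1) * wu) - (v - ([: z :] - 1) * wv).
      by rewrite !opprD !opprK addrACA.
    exact: rpredB.
  - by exists 0; rewrite mulr0 subr0; apply: Zplus_Z.
  - case: Kh => [Kh|]; first by exists 0; rewrite mulr0 subr0; apply: Zplus_diff; left.
    rewrite inE => /orP[/eqP ->|hz]; first by exists w; rewrite subrr rpred0.
    by exists 0; rewrite mulr0 subr0; apply: Zplus_diff; right.
have zT1 i x : x \in T0 -> ([: z :] - 1) ^+ i * x \in T0.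
  elim: i x => [|i ih'] x xT; first by rewrite mul1r.
  by rewrite exprSr -mulrA; apply: ih'; rewrite mulrBl mul1r rpredB // zT.
have stepn i x : exists w, x - ([: z :] - 1) ^+ i * w \in T0.
  elim: i => [|i [w wT]]; first by exists x; rewrite mul1r subrr rpred0.
  have [u uT] := step w; exists u; have := rpredD wT (zT1 i _ uT).
  by rewrite mulrBr addrA subrK mulrA -exprSr.
move=> x; have [w] := stepn p x.
suff zp : ([: z :] - 1) ^+ p * w \in T0 by move=> /(rpredD zp); rewrite addrC subrK.
rewrite -[_ ^+ p * w](subrK (([: (z ^+ p)%g :] - 1) * w)) rpredD //; last first.
  by apply: Zplus_diff; left; apply: powK.
apply: Zplus_Z; apply: Zker; rewrite -mulrBl rmorphM /= rmorphB rmorphXn /=.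
rewrite !rmorphB !rmorph1 /= !iw_map_group subr1_exp_char ?grpring_pchar //.
by rewrite lhomX grpring_expU subrr mul0r.
Qed.
End Nakayama.

Lemma Gpow_comm n x y : Gpow p n x -> Gpow p n y ->
  @Gpow p G n.+1 (x * y * x^-1 * y^-1)%g.
Proof.
move=> Gx Gy; have [f [fM fS f0]] := Gpow_grading hG n.
have sG := Gpow_subgroup p G n.
have Gx' := subgroupV sG Gx; have Gy' := subgroupV sG Gy.
have sM (a b : G) (Ga : Gpow p n a) (Gb : Gpow p n b) : Gpow p n (a * b)%g := subgroupM sG Ga Gb.
apply/f0; first by do 3!apply: (sM) => //.
have f1 : f 1%g = 0 by apply: (@addrI _ (f 1%g)); rewrite -fM ?mulg1 ?addr0 //; apply: (subgroup1 sG).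
have fV z : Gpow p n z -> f (z^-1)%g = - f z.
  move=> Gz; apply/eqP; rewrite -addr_eq0 -fM ?mulVg ?f1 //.
  exact: subgroupV sG Gz.
rewrite !fM //; do ?[by do ?apply: (sM)].
by rewrite !fV // (addrAC (f x)) subrr add0r subrr.
Qed.

Lemma Gpow_powp n x : Gpow p n x -> @Gpow p G n.+1 (x ^+ p)%g.
Proof.
move=> Gx; have [f [fM fS f0]] := Gpow_grading hG n.
have sG := Gpow_subgroup p G n.
apply/f0; first exact: (subgroupX _ sG).
have -> : f (x ^+ p)%g = f x *+ p.
  elim: {2 4}p => [|k ih].
    by apply: (@addrI _ (f 1%g)); rewrite expg0 -fM ?mulg1 ?addr0 //; apply: (subgroup1 sG).
  by rewrite expgS fM ?ih ?mulrS //; apply: (subgroupX _ sG).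
by apply/rowP => i; rewrite mulmxnE mxE -mulr_natr (pcharf0 (pchar_Fp hp)) mulr0.
Qed.

Lemma HG_normal n : normal_subgroup (fun x => H x /\ Gpow p n x).
Proof.
have nG := Gpow_normal p G n; split.
  split; first by split; [exact: subgroup1 hHn.1 | exact: subgroup1 nG.1].
  by move=> x y [Hx Gx] [Hy Gy]; split; [exact: hHn.1.2 | exact: nG.1.2].
by move=> x g [Hx Gx]; split; [exact: hHn.2 | exact: nG.2].
Qed.

(* The subgroups [H :&: G_j], [j <= n], filter [H] modulo [G_n] with finite abelian
   quotients of exponent [p]. *)
Lemma nakayama n N (Z : {pred Lam}) : (n <= N)%N -> zmod_closed Z ->
  (forall h x, H h -> x \in Z -> [: h :] * x \in Z) ->
  (forall x, iw_map (pair_hom n N) modp x = 0 -> x \in Z) ->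
  (forall x, exists2 y, y \in Z & iw_map (gam_hom N) modp (x - y) = 0) ->
  forall x, x \in Z.
Proof.
move=> nN Zc ZH Zker base.
pose K j x := H x /\ @Gpow p G j x.
have T0 x : x \in Zplus Z (K 0).
  have [y yZ ker] := base x.
  have [|w wT kw] := @iw_map_ker_span _ _ (pair_hom n N) (gam_hom N) (K 0) _ _ ker.
    (* Equality in $\Gamma/\Gamma^{p^N}$ gives $g = h g' w$ with [w] in $G_N$, and [n <= N] makes
       [w] trivial in both coordinates. *)
    move=> g g' /= e.
    have : Gpow p N (pi (g * g'^-1)%g).
      by apply/Gproj1P; rewrite pi_mul pi_inv GprojM e -GprojM mulgV.
    move=> /(pi_decomp)[h [v [Hh gE Gv]]].
    exists h; first by split => //; apply: Gpow_level0.
    have [w Gw ->] : exists2 w, Gpow p N w & g = (h * g' * w)%g.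
      exists (v ^ g')%g; first exact: (Gpow_normal p G N).2.
      by rewrite conjgE !mulgA mulgK -gE mulgVK.
    rewrite GprojM (pi_mul (h * g')%g) (GprojM p N) (gam_triv Gw) mulg1; congr (_, _).
    by rewrite (Gproj1P p n w).2 ?mulg1 //; exact: Gpow_le nN _ Gw.
  rewrite -(subrK y x) rpredD //; last exact: Zplus_Z.
  rewrite -(subrK w (x - y)) rpredD //; first by apply: Zplus_Z; apply: Zker.
  move: wT; elim/zspan_ind => [|u v Tu Tv|_ [h [z [Kh ->]]]].
  - exact: rpred0.
  - exact: rpredB.
  - exact: Zplus_diff.
have Tj j : (j <= n)%N -> forall x, x \in Zplus Z (K j).
  elim: j => [//|j ih] jn.
  have [f [fM fS f0]] := Gpow_grading hG j.
  (* One element of [K j] for each value of [f] on [K j]; every other vector gets 1, which also lies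
     in [K j]. *)
  pose u (v : 'rV['F_p]_l) : G :=
    if pselect (exists x, K j x /\ f x = v) is left e then sval (cid e) else 1%g.
  have Ku v : K j (u v).
    rewrite /u; case: pselect => [e|_]; first by case: (cid e) => x [].
    by split; [exact: subgroup1 hHn.1 | exact: subgroup1 (Gpow_subgroup _ _ _)].
  have nl := @nakayama_list _ (pair_hom n N) Z ZH Zker (K j) (K j.+1)
    (map u (enum [set: 'rV['F_p]_l]%SET)); apply: nl.
  - exact: HG_normal.
  - by move=> x [].
  - move=> x y [Hx Gx] [Hy Gy]; split; last exact: Gpow_comm.
    have sH := hHn.1; have Hx' := subgroupV sH Hx; have Hy' := subgroupV sH Hy.
    by do 3![apply: (subgroupM sH) => //].
  - by move=> x [Hx Gx]; split; [exact: (subgroupX _ hHn.1) | exact: Gpow_powp].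
  - by move=> z /mapP[v _ ->].
  move=> x; have := ih (ltnW jn) x; elim/zspan_ind => [|a b|a [aZ|[h [w [Kh ->]]]]].
  - exact: rpred0.
  - by move=> Ta Tb; rewrite rpredB.
  - exact: Zplus_Z.
  have fu : f (u (f h)) = f h.
    by rewrite /u; case: pselect => [e|[]]; [case: (cid e) => y [] | exists h].
  have Kk : K j.+1 ((u (f h))^-1 * h)%g.
    split; first exact: subgroupM hHn.1 (subgroupV hHn.1 (Ku _).1) Kh.1.
    by apply/(grading_eq fM f0); [exact: (Ku _).2 | exact: Kh.2 | ].
  set z := u _ in Kk; set k := (_ * _)%g in Kk.
  (* With $h = zk$, [z] on the list and [k] in [K j.+1], one has $h - 1 = (zkz^{-1} - 1)z + (z -
     1)$; the conjugate stays in [K j.+1] by normality. *)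
  have -> : ([: h :] - 1) * w = ([: (z * k * z^-1)%g :] - 1) * ([: z :] * w) + ([: z :] - 1) * w.
    rewrite !mulrA !mulrBl !mul1r -!iw_groupM mulgVK addrA subrK.
    by rewrite /k mulVKg.
  rewrite rpredD //; apply: Zplus_diff; last first.
    by right; apply: map_f; rewrite mem_enum inE.
  by left; have := (HG_normal j.+1).2 k (z^-1)%g Kk; rewrite conjgE invgK mulgA.
move=> x; have := Tj n (leqnn n) x; elim/zspan_ind => [|a b|a [aZ|[h [w [Kh ->]]]]] //.
- by case: Zc.
- by case: Zc => _; apply.
- apply: Zker; rewrite rmorphM rmorphB rmorph1 /= iw_map_group /=.
  rewrite (Gproj1P p n h).2 ?(pi_ker h).2; [|exact: Kh.1|exact: Kh.2].
  rewrite (Gproj1P p N (1%g : Gam p)).2 ?subrr ?mul0r //.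
  exact: subgroup1 (Gpow_subgroup _ _ _).
Qed.

(** * The prime ideal of the elements that vanish in F_p[[Gamma]] *)

Notation gm := ([: gam :]).

Lemma commr_int_gam : commr_rmorph (intr : int -> Lam) gm.
Proof. by move=> k; rewrite /GRing.comm commr_int. Qed.

(** The coefficients are integers because these commute with [gam]; polynomials over ['F_p] are
    lifted by [redp_lift], and by [redp_gev] the choice of lift is invisible modulo [p]. *)
Definition gev : {poly int} -> Lam := horner_morph commr_int_gam.
HB.instance Definition _ := GRing.RMorphism.copy gev (horner_morph commr_int_gam).

Lemma gevX : gev 'X = gm. Proof. exact: horner_morphX. Qed.
Lemma gevC k : gev k%:P = k%:~R. Proof. exact: horner_morphC. Qed.

Lemma gev_sum (q : {poly int}) r : (size q <= r)%N ->
  gev q = \sum_(i < r) (q`_i)%:~R * gm ^+ i.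
Proof.
move=> qr; rewrite -{1}[q](coefK q) (poly_def _ _) rmorph_sum /=.
rewrite (big_ord_widen _ (fun i => gev (q`_i *: 'X^i)) qr) big_mkcond /=.
apply: eq_bigr => i _; case: ifP => [_|/negbT].
  by rewrite -mul_polyC rmorphM rmorphXn /= [gev _]gevC [gev _]gevX.
by rewrite -leqNgt => /leq_sizeP/(_ i (leqnn _)) ->; rewrite mul0r.
Qed.

Notation redp := (map_poly (intr : int -> 'F_p)).

Lemma redp_lift (f : {poly 'F_p}) : exists q : {poly int}, redp q = f.
Proof.
exists (\poly_(i < size f) (val f`_i)%:Z); apply/polyP => i.
rewrite coef_map coef_poly /=; case: ltnP => [_|sf].
  by rewrite -pmulrn [LHS]natr_Zp.
by rewrite rmorph0 nth_default.
Qed.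

Lemma redp0_pmul (q : {poly int}) : redp q = 0 -> exists q', q = q' *+ p.
Proof.
move=> q0; exists (\poly_(i < size q) (q`_i %/ p)%Z); apply/polyP => i.
rewrite coefMn coef_poly; case: ltnP => [_|sf]; last by rewrite nth_default // mul0rn.
have /polyP/(_ i) := q0; rewrite coef_map coef0 /= => /eqP qi.
by rewrite -mulr_natr natz divzK // (dvdz_pcharf (pchar_Fp hp)).
Qed.

Lemma redp_gev (Y : groupType) (phi : level_hom p G Y) (q q' : {poly int}) :
  redp q = redp q' -> iw_map phi modp (gev q) = iw_map phi modp (gev q').
Proof.
move=> e; apply/eqP; rewrite -subr_eq0 -!raddfB /=.
have [|q'' ->] := @redp0_pmul (q - q'); first by rewrite raddfB /= e subrr.
by rewrite raddfMn /= iw_map_pmul.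
Qed.

Lemma gam_pow_kill N : iw_map (gam_hom N) modp ((gm - 1) ^+ (p ^ N)) = 0.
Proof.
rewrite rmorphXn rmorphB rmorph1 /= iw_map_group.
rewrite subr1_expX_char ?grpring_pchar // grpring_expU -lhomX /= pi_gam.
rewrite (Gproj1P p N _).2 ?subrr //; apply/(Gam_powP hp) => i iN.
rewrite zp_natr; apply/eqP; rewrite natr_Zpk_eq0 //; exact: dvdn_exp2l.
Qed.

Lemma gam_level_poly N x : exists q, iw_map (gam_hom N) modp (x - gev q) = 0.
Proof.
elim/(@iw_level_ind p G N): x => [x y [q qx] [q' qy]|x x0|c g].
- exists (q + q'); rewrite [gev _]rmorphD opprD addrACA rmorphD /= qx qy addr0 //.
- by exists 0; rewrite rmorph0 subr0 (@iw_map_level0 _ _ _ _ _ _ N).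
have [k gk] := Gam_proj_nat hp N (pi g).
exists ((val (c 0))%:Z *: 'X^k); rewrite -mul_polyC [gev _]rmorphM rmorphXn /= gevC gevX.
rewrite rmorphB /= iw_map_const_group rmorphM /= -pmulrn rmorph_nat -iw_groupX iw_map_group /=.
by rewrite pi_gam gk /zp_modp scaler_nat mulr_natl subrr.
Qed.

(* The kernel of $\mathbb{Z}_p[[G]] \to \mathbb{F}_p[[\Gamma]]$. *)
Definition in_PP (x : Lam) := forall N, iw_map (gam_hom N) modp x = 0.

Lemma gam_hom_le M N x : (M <= N)%N ->
  iw_map (gam_hom N) modp x = 0 -> iw_map (gam_hom M) modp x = 0.
Proof.
move=> MN x0; pose h (a : Gquo p N (Gam p)) : Gquo p M (Gam p) := Gproj p M (repr a).
rewrite (@iw_map_push _ _ _ _ (gam_hom N) _ h) ?x0 ?raddf0 // => g /=.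
rewrite /h; have [k Gk ->] := Gproj_eq_repr p N (pi g).
by rewrite GprojM (Gproj1P p M k).2 ?mulg1 //; exact: Gpow_le MN _ Gk.
Qed.

(* [Lam] modulo the kernel is a quotient of $\mathbb{F}_p[X]/(X-1)^{p^N}$, in which
   the image of [s] generates the ideal of some [('X - 1) ^+ v] with [v] independent of [N]. *)
Lemma gam_span s : ~ in_PP s -> exists r, forall N x, exists (c : 'I_r -> int) b,
  iw_map (gam_hom N) modp (x - (\sum_i (c i)%:~R * gm ^+ i + b * s)) = 0.
Proof.
(* $(X-1)^r$ with $r = p^{N_0}$ dies at level $N_0$, where [s] does not; so at every level $N \ge
   N_0$ the order of [s] at $X = 1$ is below [r]. *)
move=> /existsNP[N0 s0]; pose r := (p ^ N0)%N; exists r.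
suff main N x : (N0 <= N)%N -> exists (c : 'I_r -> int) b,
    iw_map (gam_hom N) modp (x - (\sum_i (c i)%:~R * gm ^+ i + b * s)) = 0.
  move=> N x; have [c [b cb]] := main (maxn N0 N) x (leq_maxl _ _).
  by exists c, b; apply: gam_hom_le cb; rewrite leq_maxr.
move=> NN0; have [q sq] := gam_level_poly N s; have [f xf] := gam_level_poly N x.
pose X1 : {poly 'F_p} := 'X - 1%:P.
have redX1 : redp ('X - 1) = X1 by rewrite rmorphB rmorph1 /= map_polyX.
have ndvd : ~~ (X1 ^+ r %| redp q).
  apply/negP => /dvdpP[u qu]; apply: s0.
  have := gam_hom_le NN0 sq; rewrite rmorphB /= => /eqP; rewrite subr_eq0 => /eqP ->.
  have [u' u'u] := redp_lift u.
  rewrite (@redp_gev _ _ q (u' * ('X - 1) ^+ r)).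
    rewrite rmorphM rmorphXn rmorphB rmorph1 /= gevX rmorphM /=.
    by rewrite [X in _ * X]gam_pow_kill mulr0.
  by rewrite rmorphM rmorphXn /= redX1 u'u.
have [v [u [qE ru vr]]] : exists v u, [/\ redp q = u * X1 ^+ v, ~~ root u 1 & (v < r)%N].
  have qn0 : redp q != 0 by apply: contraNneq ndvd => ->; rewrite dvdp0.
  have [v [u]] := multiplicity_XsubC (redp q) 1; rewrite qn0 /= => ru qE.
  exists v, u; split => //; rewrite ltnNge; apply: contra ndvd => rv.
  by rewrite qE dvdp_mull // dvdp_exp2l.
(* As [u] does not vanish at 1, it is invertible modulo $(X-1)^{p^N}$, so $(X-1)^r$ is a multiple of
   the image of [s], and a remainder modulo $(X-1)^r$ has [r] coefficients. *)
have cop : coprimep u (X1 ^+ (p ^ N)) by rewrite coprimep_expr // coprimep_XsubC.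
have [[a b] /= ab] := Bezout_eq1_coprimepP _ _ cop.
pose d := redp f %/ X1 ^+ r; pose e := redp f %% X1 ^+ r.
have fE : redp f = d * X1 ^+ r + e by rewrite -divp_eq.
pose a' := a * X1 ^+ (r - v).
have X1r : X1 ^+ r = a' * redp q + b * X1 ^+ r * X1 ^+ (p ^ N).
  rewrite /a' qE -[LHS]mul1r -ab mulrDl; congr (_ + _); last by rewrite mulrAC.
  by rewrite -[in LHS](subnK (ltnW vr)) exprD mulrACA.
have [t dt] := redp_lift (d * a'); have [w dw] := redp_lift (d * (b * X1 ^+ r)).
have [e' ee] := redp_lift e.
pose e2 := \poly_(i < r) e'`_i.
have e2e : redp e2 = e.
  apply/polyP => i; rewrite coef_map coef_poly /=; case: ltnP => [ir|ri].
    by rewrite -ee coef_map.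
  rewrite rmorph0 nth_default // (leq_trans _ ri) // -ltnS.
  have := ltn_modpN0 (redp f) (monic_neq0 (monic_exp r (monicXsubC (1 : 'F_p)))).
  by rewrite size_exp_XsubC.
exists (fun i => e'`_i), (gev t).
have -> : \sum_(i < r) (e'`_i)%:~R * gm ^+ i = gev e2.
  rewrite (@gev_sum e2 r) ?size_poly //; apply: eq_bigr => i _.
  by rewrite coef_poly ltn_ord.
move: sq xf; rewrite !rmorphB /= => /eqP; rewrite subr_eq0 => /eqP sq /eqP.
rewrite subr_eq0 => /eqP ->; rewrite rmorphD /= [iw_map _ _ (gev t * s)]rmorphM /= sq.
rewrite (@redp_gev _ _ f (e2 + t * q + w * ('X - 1) ^+ (p ^ N))); last first.
  rewrite !rmorphD !rmorphM rmorphXn /= redX1 e2e dt dw fE addrC.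
  by rewrite -addrA {1}X1r mulrDr !mulrA.
rewrite !rmorphD !rmorphM /= [gev (_ ^+ _)]rmorphXn rmorphB rmorph1 /= gevX.
by rewrite [X in _ + _ * X - _]gam_pow_kill mulr0 addr0 subrr.
Qed.

(** As [e] is prime to [p], the class of $p^d e$ generates the kernel of the transition map, of
    order [p]; its translates of one point sweep out the fiber. *)
Lemma Gam_fiber d e (b : Gquo p d (Gam p)) : ~~ (p %| e)%N ->
  let Z := Gproj p d.+1 (((p ^ d * e)%:R : Zpadic p) : Gam p) : Gquo p d.+1 (Gam p) in
  exists w0, uniq [seq (Z ^+ i * w0)%g | i <- iota 0 p] /\
    forall w, (w \in [seq (Z ^+ i * w0)%g | i <- iota 0 p]) = (Gtrans w == b).
Proof.
move=> pe Z; pose w0 : Gquo p d.+1 (Gam p) := Gproj p d.+1 (repr b); exists w0.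
have ZE i : (Z ^+ i * w0)%g = Gproj p d.+1 (((p ^ d * e * i)%:R + (repr b : Zpadic p) : Zpadic p) : Gam p).
  rewrite /Z /w0 -(lhomX (@LevelHom p (Gam p) _ (Gproj p d.+1) d.+1 (@GprojM p d.+1 (Gam p)) (fun x => (Gproj1P p d.+1 x).2))) /=.
  by rewrite -GprojM Gam_expg -mulrnA.
split.
- rewrite map_inj_in_uniq ?iota_uniq // => i j; rewrite !mem_iota !add0n /= => ip jp.
  rewrite !ZE => /(Gam_projP hp)/(_ d (ltnSn d)).
  rewrite !zp_resD !zp_natr => /addIr /(natr_Zpk_eq hp).
  rewrite expnSr -!mulnA -!muln_modr => /eqP; rewrite eqn_pmul2l ?expn_gt0 ?prime_gt0 // => /eqP eij.
  have : (e * i == e * j %[mod p])%N by rewrite eij.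
  wlog ij : i j ip jp {eij} / (i <= j)%N.
    by move=> W h; case: (leqP i j) => [/W|/ltnW/W h']; [apply | apply/esym/h' => //; rewrite eq_sym].
  rewrite eq_sym eqn_mod_dvd ?leq_mul2l ?ij ?orbT // -mulnBr Euclid_dvdM // (negPf pe) /=.
  move=> dv; apply/eqP; rewrite eqn_leq ij /= -subn_eq0 -leqn0 leqNgt; apply/negP => ne.
  by have := dvdn_leq ne dv; rewrite leqNgt (leq_ltn_trans (leq_subr _ _) jp).
- move=> w; apply/mapP/eqP => [[i _ ->]|wb].
    rewrite ZE Gtrans_proj -[RHS]Gproj_repr; apply/(Gam_projP hp) => j jd.
    rewrite zp_resD zp_natr (_ : _%:R = 0) ?add0r //; apply/eqP; rewrite natr_Zpk_eq0 //.
    by rewrite -mulnA dvdn_mulr // dvdn_exp2l.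
  have [y yE] : exists y, (repr w : Zpadic p) - (repr b : Zpadic p) = y *+ p ^ d.
    apply: Zpadic_pow_divisible => // i id; rewrite zp_resB; apply/eqP; rewrite subr_eq0; apply/eqP.
    by move: wb; rewrite -[w]Gproj_repr Gtrans_proj -[RHS]Gproj_repr => /(Gam_projP hp)/(_ i id); rewrite Gproj_repr.
  have [k kp ek] : exists2 k, (k < p)%N & (e * k = val (y 0) %[mod p])%N.
    have e0 : (e%:R : 'F_p) != 0 by rewrite natr_Fp_eq0.
    exists (val ((val (y 0))%:R / e%:R : 'F_p)).
      by have := ltn_ord ((val (y 0))%:R / e%:R : 'F_p); rewrite {2}Fp_cast.
    have : (e * val ((val (y 0))%:R / e%:R : 'F_p))%:R = (val (y 0))%:R :> 'F_p.
      by rewrite natrM natr_Zp mulrC divfK.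
    by move=> /(congr1 val); rewrite /= !val_Fp_nat.
  exists k; first by rewrite mem_iota.
  rewrite ZE -{1}[w]Gproj_repr; apply/(Gam_projP hp) => j; rewrite ltnS => jd.
  apply: (zp_eq_le hp jd); rewrite -[repr w : Zpadic p](subrK (repr b : Zpadic p)) yE.
  rewrite !zp_resD; congr (_ + _); rewrite zp_resMn zp_natr -[y d](natr_Zp (y d)) -mulrnA.
  have aux u : (u = e * k %[mod p])%N -> (u * p ^ d = p ^ d * e * k %[mod p ^ d.+1])%N.
    by move=> uk; rewrite mulnC [(p ^ d.+1)%N]expnSr -mulnA -!muln_modr uk.
  apply/(natr_Zpk_eq hp)/aux; rewrite ek.
  have m1 u v : (u = v %[mod p ^ 1])%N -> (v = u %[mod p])%N by rewrite expn1 => ->.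
  exact/m1/(natr_Zpk_eq hp)/(etrans (natr_Zp (y 0)) (zp_coh_le hp y (leq0n d))).
Qed.

(* Let $p^d$ exactly divide [E * p ^ N]. Then [gam ^+ (E * p ^ N)] is trivial in
   $G/G_n$ and generates $\Gamma_d/\Gamma_{d+1}$, so that the coefficients of [x] on level
   $d+1$ of $\Gamma$ are constant on the fibers over level $d$, which have [p] elements. *)
Lemma pair_hom_invariant n E x : (0 < E)%N ->
  (forall N, (n <= N)%N -> iw_map (pair_hom n N) modp ((gm ^+ E - 1) * x) = 0) ->
  forall N, (n <= N)%N -> iw_map (pair_hom n N) modp x = 0.
Proof.
move=> E0 inv N nN.
(* The factor $p^N$ pushes the valuation [d] of the exponent to at least [N], hence to at least [n],
   so that the power of [gam] is trivial in $G/G_n$. *)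
have inv' M : (n <= M)%N -> iw_map (pair_hom n M) modp ((gm ^+ (E * p ^ N) - 1) * x) = 0.
  move=> nM; have [u ->] := exp_sub1_dvd gm E (p ^ N).
  by rewrite -mulrA rmorphM /= inv ?mulr0.
have Ep : (0 < E * p ^ N)%N by rewrite muln_gt0 E0 expn_gt0 prime_gt0.
have [e pe eE] := pfactor_coprime hp Ep.
set d := logn p (E * p ^ N) in eE.
have Nd : (N <= d)%N.
  by rewrite /d lognM ?expn_gt0 ?(prime_gt0 hp) // pfactorK // leq_addl.
rewrite prime_coprime // in pe.
suff xd : iw_map (pair_hom n d) modp x = 0.
  pose h (y : Gquo p n G * Gquo p d (Gam p)) := (y.1, Gproj p N (repr y.2)).
  rewrite (@iw_map_push _ _ _ _ (pair_hom n d) _ h) ?xd ?raddf0 // => g /=.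
  have [k Gk ke] := Gproj_eq_repr p d (pi g); rewrite /h /= ke.
  by rewrite (GprojM p N) (Gproj1P p N k).2 ?mulg1 //; exact: Gpow_le Nd _ Gk.
have nd : (n <= d)%N by apply: leq_trans Nd.
pose alpha := iw_map (pair_hom n d.+1) modp x.
pose h (y : Gquo p n G * Gquo p d.+1 (Gam p)) := (y.1, Gtrans y.2).
rewrite (@iw_map_push _ _ _ _ (pair_hom n d.+1) _ h); last by move=> g; rewrite /h /= Gtrans_proj.
pose Z := Gproj p d.+1 (((p ^ d * e)%:R : Zpadic p) : Gam p) : Gquo p d.+1 (Gam p).
have ZE : pair_hom n d.+1 (gam ^+ (E * p ^ N))%g = (1%g, Z).
  rewrite /= pi_gam eE (mulnC e); congr (_, _); apply/Gproj1P.
  apply: (Gpow_le nd) => K _ _ /(_ (gam ^+ e)%g).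
  by rewrite -expgnA (mulnC e).
have Zalpha i y : coeff ((1, Z) ^+ i * y)%g alpha = coeff y alpha.
  elim: i y => [|i ih] y; first by rewrite expg0 mul1g.
  rewrite -[RHS]ih expgS -mulgA.
  have := inv' d.+1 (leqW nd); rewrite rmorphM rmorphB rmorph1 /= -iw_groupX iw_map_group.
  rewrite ZE mulrBl mul1r => /eqP; rewrite subr_eq0 => /eqP/(congr1 (coeff ((1, Z) * ((1, Z) ^+ i * y))%g)).
  by rewrite coeff_mulU mulKg.
apply/eqP/freeg_eqP => -[b1 b2]; rewrite coeff0.
have [w0 [us sE]] := Gam_fiber b2 pe.
pose s := [seq ((1, Z) ^+ i * (b1, w0))%g | i <- iota 0 p].
have sE' : s = [seq (b1, w) | w <- [seq (Z ^+ i * w0)%g | i <- iota 0 p]].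
  rewrite /s -map_comp; apply: eq_map => i /=.
  have -> : ((1, Z) ^+ i = (1, Z ^+ i) :> Gquo p n G * Gquo p d.+1 (Gam p))%g.
    elim: i => [|i ih] //; rewrite !expgS ih.
    by rewrite [LHS](_ : _ = (1 * 1, Z * Z ^+ i)%g) // mul1g.
  by rewrite [LHS](_ : _ = (1 * b1, Z ^+ i * w0)%g) // mul1g.
rewrite (@coeff_freeg_map_fiber _ _ _ _ s).
- rewrite big_map (eq_bigr (fun=> coeff (b1, w0) alpha)) => [|i _]; last exact: Zalpha.
  rewrite big_const_seq count_predT size_iota iter_addr_0 -mulr_natr.
  by rewrite (pcharf0 (pchar_Fp hp)) mulr0.
- by rewrite sE' map_inj_uniq // => w w' [].
- move=> [a1 a2]; rewrite sE' /h /= xpair_eqE -sE; apply/mapP/andP => [[w ws [-> ->]]|[/eqP -> ws]] //.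
  by exists a2.
Qed.

Lemma iw_map_sub0 (Y : groupType) (phi : level_hom p G Y) (A : comNzRingType)
    (red : {rmorphism Zpadic p -> A}) x y :
  iw_map phi red (x - y) = 0 <-> iw_map phi red x = iw_map phi red y.
Proof.
rewrite rmorphB /=; split=> [/eqP|->]; last exact: subrr.
by rewrite subr_eq0 => /eqP.
Qed.

(** * The subring Z_p[[H]] and Weierstrass division modulo p at finite level *)

Notation LamH := (@iwasawa_sub p G H).

Lemma LamH_sub x y : LamH x -> LamH y -> LamH (x - y).
Proof.
move=> Hx Hy n z; rewrite iw_levelB coeffB => xy.
have [x0|] := eqVneq (coeff z (x n)) 0; last exact: Hx.
by apply: Hy; apply: contraNneq xy => ->; rewrite x0 subr0.
Qed.

Lemma LamH0 : LamH 0.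
Proof. by move=> n z; rewrite coeff0 eqxx. Qed.

Lemma LamH_opp x : LamH x -> LamH (- x).
Proof. by move=> Hx; rewrite -sub0r; apply: LamH_sub => //; exact: LamH0. Qed.

Lemma LamH_add x y : LamH x -> LamH y -> LamH (x + y).
Proof. by move=> Hx Hy; rewrite -[y]opprK; apply: LamH_sub => //; apply: LamH_opp. Qed.

Lemma LamH1 : LamH 1.
Proof.
move=> n z; have -> : (1 : Lam) n = << 1%g >> by []; rewrite coeffU.
case: (eqVneq (1%g : Gquo p n G) z) => [<- _|_]; last by rewrite mulr0 eqxx.
exists 1%g; first exact: subgroup1 hHn.1.
by apply/esym/Gproj1P; exact: subgroup1 (Gpow_subgroup _ _ _).
Qed.

Lemma LamH_int k : LamH k%:~R.
Proof.
have Hn i : LamH i%:R by elim: i => [|i ih]; [exact: LamH0 | rewrite -addn1 natrD; exact: LamH_add ih LamH1].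
case: k => i; first exact: Hn.
by rewrite NegzE rmorphN /=; apply: LamH_opp; exact: (Hn i.+1).
Qed.

Lemma LamH_group_mul h x : H h -> LamH x -> LamH ([: h :] * x).
Proof.
move=> Hh Hx n y; rewrite iw_levelM coeff_mulU => /Hx[k Hk e].
exists (h * k)%g; first exact: subgroupM hHn.1 Hh Hk.
by rewrite GprojM -e mulVKg.
Qed.

(** [H] dies in $\Gamma$, so the image at $(n, N)$ is determined by the one in
    $\mathbb{F}_p[G/G_n]$, a finite set independent of [N]. The pigeonhole in [gam_order] rests on
    this. *)
Lemma LamH_pair n N x : (n <= N)%N -> LamH x ->
  iw_map (pair_hom n N) modp x
  = freeg_map (fun y : Gquo p n G => (y, 1%g)) (iw_map (proj_hom n) modp x).
Proof.
move=> nN Hx; rewrite (@iw_mapE _ _ _ (pair_hom n N) _ _ N) /= ?(maxn_idPr nN) //.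
rewrite (@iw_mapE _ _ _ (proj_hom n) _ _ N) // freeg_map_comp.
apply: eq_freeg_map_dom => a; rewrite mem_dom coeff_freeg_coef => a0.
have [|h Hh ->] := Hx N a; first by apply: contraNneq a0 => ->; rewrite rmorph0.
rewrite /lhom_quo [LHS](@lhom_repr _ _ _ (pair_hom n N)) /=; last by rewrite (maxn_idPr nN).
have [k Gk ->] := Gproj_eq_repr p N h.
rewrite GprojM (Gproj1P p n k).2 ?mulg1; last exact: Gpow_le nN _ Gk.
by congr (_, _); rewrite (pi_ker h).2.
Qed.

(** The [x] with such an expression form a group stable under [H] and containing the kernel, so
    [nakayama] reduces the claim to $\mathbb{F}_p[[\Gamma]]$, where [gam_span] supplies an [r]
    depending only on [s]. *)
Lemma pair_span s : ~ in_PP s -> exists r, forall n N x, (n <= N)%N ->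
  exists c : 'I_r -> Lam, (forall i, LamH (c i)) /\ exists b,
    iw_map (pair_hom n N) modp (x - (\sum_i c i * gm ^+ i + b * s)) = 0.
Proof.
move=> /gam_span[r sp]; exists r => n N x nN.
pose Zp (x : Lam) := exists c : 'I_r -> Lam, (forall i, LamH (c i)) /\ exists b,
    iw_map (pair_hom n N) modp (x - (\sum_i c i * gm ^+ i + b * s)) = 0.
suff : forall x, x \in ((fun x => `[< Zp x >]) : {pred Lam}).
  by move=> /(_ x)/asboolP.
apply: (@nakayama n N) => //.
- split=> [|u v /asboolP[c [Hc [b cb]]] /asboolP[c' [Hc' [b' cb']]]]; apply/asboolP.
    exists (fun=> 0); split=> [i|]; first exact: LamH0.
    by exists 0; rewrite big1 ?mul0r ?addr0 ?subr0 ?rmorph0 // => i _; rewrite mul0r.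
  exists (fun i => c i - c' i); split=> [i|]; first exact: LamH_sub.
  exists (b - b').
  have -> : \sum_i (c i - c' i) * gm ^+ i = \sum_i c i * gm ^+ i - \sum_i c' i * gm ^+ i.
    by rewrite -sumrB; apply: eq_bigr => i _; rewrite mulrBl.
  have -> : u - v - (\sum_i c i * gm ^+ i - \sum_i c' i * gm ^+ i + (b - b') * s)
    = (u - (\sum_i c i * gm ^+ i + b * s)) - (v - (\sum_i c' i * gm ^+ i + b' * s)).
    by rewrite mulrBl subrBDB.
  by rewrite rmorphB /= cb cb' subrr.
- move=> h u Hh /asboolP[c [Hc [b cb]]]; apply/asboolP.
  exists (fun i => [: h :] * c i); split=> [i|]; first exact: LamH_group_mul.
  exists ([: h :] * b).
  have -> : \sum_i [: h :] * c i * gm ^+ i = [: h :] * \sum_i c i * gm ^+ i.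
    by rewrite mulr_sumr; apply: eq_bigr => i _; rewrite mulrA.
  by rewrite -mulrA -mulrDr -mulrBr rmorphM /= cb mulr0.
- move=> u u0; apply/asboolP; exists (fun=> 0); split=> [i|]; first exact: LamH0.
  by exists 0; rewrite big1 ?mul0r ?addr0 ?subr0 // => i _; rewrite mul0r.
- move=> u; have [c [b cb]] := sp N u.
  exists (\sum_i (c i)%:~R * gm ^+ i + b * s) => //; apply/asboolP.
  exists (fun i => (c i)%:~R); split=> [i|]; first exact: LamH_int.
  by exists b; rewrite subrr rmorph0.
Qed.

Lemma gam_unit k : exists u, u * gm ^+ k = 1.
Proof. by exists [: (gam ^+ k)^-1%g :]; rewrite -iw_groupX -iw_groupM mulVg iw_group1. Qed.

(* Pigeonhole on the finitely many remainders of the powers of [gam] in [pair_span]. *)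
Lemma gam_order s n : ~ in_PP s -> exists E, (0 < E)%N /\ forall N, (n <= N)%N ->
  exists b, iw_map (pair_hom n N) modp (gm ^+ E - 1 - b * s) = 0.
Proof.
move=> /pair_span[r sp]; have [sG [usG allG]] := Gquo_finite hG n.
(* [B] counts the possible tuples of remainders, so two of the exponents $0, \dots, B$ share one.
   Their difference may depend on [N], but it always divides $B!$. *)
pose T := {ffun 'I_r -> {ffun 'I_(size sG) -> 'F_p}}; pose B := #|T|.
exists (B`!); split; first exact: fact_gt0.
move=> N nN.
have ch (j : 'I_B.+1) : {cb : ('I_r -> Lam) * Lam | (forall i, LamH (cb.1 i)) /\
    iw_map (pair_hom n N) modp (gm ^+ j - (\sum_i cb.1 i * gm ^+ i + cb.2 * s)) = 0}.
  by apply: cid; have [c [Hc [b cb]]] := sp n N (gm ^+ j) nN; exists (c, b).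
pose c j := (sval (ch j)).1; pose b j := (sval (ch j)).2.
have Hc j i : LamH (c j i) by rewrite /c; case: (ch j) => cb [].
have cbE (j : 'I_B.+1) : iw_map (pair_hom n N) modp (gm ^+ j - (\sum_i c j i * gm ^+ i + b j * s)) = 0.
  by rewrite /c /b; case: (ch j) => cb [].
pose code (j : 'I_B.+1) : T := [ffun i => [ffun a : 'I_(size sG) =>
  coeff (nth 1%g sG a) (iw_map (proj_hom n) modp (c j i))]].
have /injectivePn[j1 [j2 j12 cj]] : ~~ injectiveb code.
  by apply/negP => /injectiveP/leq_card; rewrite card_ord ltnn.
wlog lt12 : j1 j2 j12 cj / (j1 < j2)%N.
  move=> W; case: (ltngtP j1 j2) => [|lt21|/val_inj e]; first exact: W.
    by apply: (W j2 j1) => //; rewrite eq_sym.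
  by rewrite e eqxx in j12.
have cE i : iw_map (pair_hom n N) modp (c j1 i) = iw_map (pair_hom n N) modp (c j2 i).
  rewrite !LamH_pair //; congr freeg_map; apply/eqP/freeg_eqP => a.
  have ia : (index a sG < size sG)%N by rewrite index_mem allG.
  move/ffunP/(_ i)/ffunP/(_ (Ordinal ia)): cj; rewrite !ffunE /=.
  by rewrite nth_index ?allG.
have ker : iw_map (pair_hom n N) modp (gm ^+ j2 - gm ^+ j1 - (b j2 - b j1) * s) = 0.
  have e (j : 'I_B.+1) : iw_map (pair_hom n N) modp (gm ^+ j) =
      iw_map (pair_hom n N) modp (\sum_i c j i * gm ^+ i)
      + iw_map (pair_hom n N) modp (b j * s).
    by have /iw_map_sub0 -> := cbE j; rewrite rmorphD.
  have eS : iw_map (pair_hom n N) modp (\sum_i c j1 i * gm ^+ i) =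
      iw_map (pair_hom n N) modp (\sum_i c j2 i * gm ^+ i).
    by rewrite !rmorph_sum; apply: eq_bigr => i _; rewrite !rmorphM /= cE.
  rewrite rmorphB [X in X - _]rmorphB /= !e eS mulrBl rmorphB /=.
  by rewrite opprD addrACA subrr add0r subrr.
have [u u1] := gam_unit j1.
have e0 : (0 < j2 - j1)%N by rewrite subn_gt0.
have : ((j2 - j1) %| B`!)%N.
  by rewrite dvdn_fact // e0 /= (leq_trans (leq_subr _ _)) // -ltnS ltn_ord.
move=> /dvdnP[k ->]; rewrite mulnC.
have [w ->] := exp_sub1_dvd gm (j2 - j1) k.
have := congr1 (fun z => iw_map (pair_hom n N) modp (w * u) * z) ker.
rewrite mulr0 -rmorphM /= => h; exists (w * u * (b j2 - b j1)); rewrite -[RHS]h.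
apply: (congr1 (iw_map (pair_hom n N) modp)).
rewrite [RHS]mulrBr -!mulrA; congr (_ - _); congr (_ * _).
by rewrite mulrBr u1 -[in RHS](subnK (ltnW lt12)) addnC exprD mulrA u1 mul1r.
Qed.

(** By [gam_order], $\gamma^E - 1$ is a left multiple of [s] at level $(n, N)$, with one [E] for all
    [N]. So [x] is invariant under $\gamma^E$ at every depth, and [pair_hom_invariant] applies. *)
Lemma PP_mul_regular s n x : ~ in_PP s ->
  (forall N, (n <= N)%N -> iw_map (pair_hom n N) modp (s * x) = 0) ->
  forall N, (n <= N)%N -> iw_map (pair_hom n N) modp x = 0.
Proof.
move=> /(gam_order n)[E [E0 sE]] sx; apply: (@pair_hom_invariant n E) => // N nN.
have [b /eqP] := sE N nN; rewrite rmorphB subr_eq0 => /eqP e.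
by rewrite rmorphM /= e rmorphM -mulrA -rmorphM /= sx // mulr0.
Qed.

Lemma PP_sub x y : in_PP x -> in_PP y -> in_PP (x - y).
Proof. by move=> Px Py N; rewrite rmorphB /= Px Py subrr. Qed.
Lemma PP_mull x y : in_PP y -> in_PP (x * y).
Proof. by move=> Py N; rewrite rmorphM /= Py mulr0. Qed.
Lemma PP_mulr x y : in_PP x -> in_PP (x * y).
Proof. by move=> Py N; rewrite rmorphM /= Py mul0r. Qed.
Lemma PP0 : in_PP 0. Proof. by move=> N; rewrite rmorph0. Qed.
Lemma PP_opp x : in_PP x -> in_PP (- x).
Proof. by move=> Px; rewrite -sub0r; apply: PP_sub => //; exact: PP0. Qed.
Lemma PP_add x y : in_PP x -> in_PP y -> in_PP (x + y).
Proof. by move=> Px Py; rewrite -[y]opprK; apply: PP_sub => //; apply: PP_opp. Qed.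
Lemma PP1 : ~ in_PP 1.
Proof.
by move=> /(_ 0) /eqP; rewrite rmorph1 oner_eq0.
Qed.

Lemma pair_hom0 N x : iw_map (pair_hom 0 N) modp x = 0 <-> iw_map (gam_hom N) modp x = 0.
Proof.
split=> x0.
  by rewrite (@iw_map_push _ _ _ _ (pair_hom 0 N) _ snd) ?x0 ?raddf0.
rewrite (@iw_map_push _ _ _ _ (gam_hom N) _ (fun a => (1%g, a))) ?x0 ?raddf0 // => g /=.
by congr (_, _); apply/Gproj1P; exact: Gpow_level0.
Qed.

(** The case [n = 0] of regularity, where $G/G_0$ is trivial and only $\Gamma$ remains. *)
Lemma PP_prime s x : ~ in_PP s -> in_PP (s * x) -> in_PP x.
Proof.
move=> ns sx N; apply/pair_hom0; apply: (@PP_mul_regular s) => // M _.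
exact/pair_hom0.
Qed.

Lemma PP_mul s s' : ~ in_PP s -> ~ in_PP s' -> ~ in_PP (s * s').
Proof. by move=> Ps Ps' /(PP_prime Ps). Qed.

(** * Compactness *)

Lemma freeg_torsion_free (K : choiceType) (D : {freeg K / (Zpadic p)}) n :
  (0 < n)%N -> D *+ n = 0 -> D = 0.
Proof.
move=> n0 Dn; apply/eqP/freeg_eqP => a; rewrite coeff0.
by apply: (zp_torsion_free hp n0); rewrite -coeffMn Dn coeff0.
Qed.

Lemma Lam_torsion_free (x : Lam) n : (0 < n)%N -> x *+ n = 0 -> x = 0.
Proof.
move=> n0 xn; apply: iwasawa_ext => k; apply: (freeg_torsion_free n0).
by rewrite -[LHS](@iw_levelMn p G x n k) xn.
Qed.

Lemma proj_homE (A : comNzRingType) (red : {rmorphism Zpadic p -> A}) n x :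
  iw_map (proj_hom n) red x = freeg_coef red (x n).
Proof. by rewrite /iw_map freeg_map_id // => a; exact: Gproj_repr. Qed.

Lemma Lam_pdiv x : (forall n, iw_map (proj_hom n) modp x = 0) -> exists y, x = y *+ p.
Proof.
move=> x0.
have cE n a : {z | coeff a (x n) = z *+ p}.
  apply: cid; apply: (zp_divp hp); apply: (@zp_modp_eq0 p hp).
  by rewrite -coeff_freeg_coef -proj_homE x0 coeff0.
pose y n : grpring (Zpadic p) (Gquo p n G) := \sum_(a <- dom (x n)) << sval (cE n a) *g a >>.
have yE n : x n = y n *+ p.
  rewrite -[LHS]freeg_sumE -sumrMnl; apply: eq_bigr => a _.
  by rewrite freeg_muln; case: (cE n a) => z /= ->.
have coh n : freeg_map (@Gtrans p n G) (y n.+1) = y n.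
  apply/eqP; rewrite -subr_eq0; apply/eqP; apply: (freeg_torsion_free (prime_gt0 hp)).
  by rewrite mulrnBl -raddfMn /= -!yE iw_coherent subrr.
by exists (MkIwasawa coh); apply: iwasawa_ext => n; rewrite iw_levelMn /= yE.
Qed.

Lemma PP_pdiv (s x z : Lam) : ~ in_PP s -> s * x = z *+ p -> exists y, x = y *+ p.
Proof.
move=> ns sx; apply: Lam_pdiv => n.
rewrite (@iw_map_push _ _ _ _ (pair_hom n n) _ fst) //.
rewrite (PP_mul_regular ns) ?raddf0 // => N nN.
by rewrite sx iw_map_pmul.
Qed.

Lemma PP_pdivX (s x z : Lam) k : ~ in_PP s -> s * x = z *+ (p ^ k) ->
  exists2 y, x = y *+ (p ^ k) & s * y = z.
Proof.
move=> ns; elim: k x z => [|k ih] x z sx; first by exists x; rewrite ?mulr1n.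
have [|y xy] := @PP_pdiv s x (z *+ (p ^ k)) ns; first by rewrite -mulrnA -expnSr.
have [|w yw sw] := ih y z.
  apply/eqP; rewrite -subr_eq0; apply/eqP; apply: (Lam_torsion_free (prime_gt0 hp)).
  by rewrite mulrnBl -mulrnAr -xy -mulrnA -expnSr sx subrr.
by exists w => //; rewrite xy yw -mulrnA -expnSr.
Qed.

(** A single index refines coefficients and group together; [rd_sep], [rd_complete] and [rd_finite]
    present [Lam] as the compact limit of these finite quotients. *)
Definition rd n : Lam -> grpring 'Z_(p ^ n.+1) (Gquo p n G) := iw_map (proj_hom n) (@zp_mod p n).
HB.instance Definition _ n := GRing.RMorphism.copy (rd n) (iw_map (proj_hom n) (@zp_mod p n)).

Lemma rdE n x : rd n x = freeg_coef (@zp_mod p n) (x n). Proof. exact: proj_homE. Qed.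

Lemma rd_eqP n k N x y : (n <= N)%N -> (k <= N)%N -> rd N x = rd N y ->
  freeg_coef (@zp_mod p k) (x n) = freeg_coef (@zp_mod p k) (y n).
Proof.
move=> nN kN; rewrite !rdE => e.
have {}e : freeg_coef (@zp_mod p k) (x N) = freeg_coef (@zp_mod p k) (y N).
  apply/eqP/freeg_eqP => a; rewrite !coeff_freeg_coef; apply: (zp_eq_le hp kN).
  by have /(congr1 (coeff a)) := e; rewrite !coeff_freeg_coef.
elim: N nN {kN} e => [|N ih]; first by rewrite leqn0 => /eqP ->.
rewrite leq_eqVlt => /orP[/eqP -> //|]; rewrite ltnS => nN e; apply: ih => //.
by rewrite -(iw_coherent x N) -(iw_coherent y N) -!freeg_coef_map e.
Qed.

Lemma rd_le n N x y : (n <= N)%N -> rd N x = rd N y -> rd n x = rd n y.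
Proof. by move=> nN /(rd_eqP nN nN); rewrite !rdE. Qed.

Lemma freeg_mod_eq (K : choiceType) (D D' : {freeg K / (Zpadic p)}) :
  (forall k, freeg_coef (@zp_mod p k) D = freeg_coef (@zp_mod p k) D') -> D = D'.
Proof.
move=> e; apply/eqP/freeg_eqP => a; apply: zp_ext => k.
by have /(congr1 (coeff a)) := e k; rewrite !coeff_freeg_coef.
Qed.

Lemma rd_sep x y : (forall n, rd n x = rd n y) -> x = y.
Proof.
move=> e; apply: iwasawa_ext => n; apply: freeg_mod_eq => k.
exact: (rd_eqP (leq_maxl n k) (leq_maxr n k)).
Qed.

Lemma rd_complete (x : nat -> Lam) : (forall n, rd n (x n.+1) = rd n (x n)) ->
  exists y, forall n, rd n y = rd n (x n).
Proof.
move=> xS.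
have xle n N : (n <= N)%N -> rd n (x N) = rd n (x n).
  elim: N => [|N ih]; first by rewrite leqn0 => /eqP ->.
  rewrite leq_eqVlt => /orP[/eqP -> //|]; rewrite ltnS => nN.
  by rewrite -ih //; apply: rd_le nN _.
have res n k N a : (n <= N)%N -> (k <= N)%N ->
    coeff a (x N n) k = coeff a (x (maxn n k) n) k.
  move=> nN kN; have NN : (maxn n k <= N)%N by rewrite geq_max nN kN.
  have /(congr1 (coeff a)) := rd_eqP (leq_maxl n k) (leq_maxr n k) (xle _ _ NN).
  by rewrite !coeff_freeg_coef.
have coh n a : Zpadic_coherent (fun k => coeff a (x (maxn n k) n) k).
  move=> k; rewrite -(res n k (maxn n k.+1)) ?leq_maxl // ?(leq_trans (leqnSn k)) ?leq_maxr //.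
  by rewrite zp_coherent.
pose z n a := MkZpadic (coh n a).
have sP n : {s : seq (Gquo p n G) | uniq s /\ forall a, a \in s} by apply: cid; exact: Gquo_finite hG n.
pose y n : grpring (Zpadic p) (Gquo p n G) := \sum_(a <- sval (sP n)) << z n a *g a >>.
have yE n a : coeff a (y n) = z n a.
  have [us sall] := svalP (sP n); rewrite /y raddf_sum /=.
  rewrite (bigD1_seq a) //= coeffU eqxx mulr1 big1 ?addr0 // => b /negPf ba.
  by rewrite coeffU ba mulr0.
have yN n k N : (n <= N)%N -> (k <= N)%N ->
    freeg_coef (@zp_mod p k) (y n) = freeg_coef (@zp_mod p k) (x N n).
  move=> nN kN; apply/eqP/freeg_eqP => a; rewrite !coeff_freeg_coef yE.
  exact/esym/res.
have ycoh n : freeg_map (@Gtrans p n G) (y n.+1) = y n.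
  apply: freeg_mod_eq => k; pose N := maxn n.+1 k.
  rewrite -freeg_coef_map (yN n.+1 k N) ?leq_maxl ?leq_maxr //.
  rewrite freeg_coef_map iw_coherent (yN n k N) ?leq_maxr //.
  by rewrite (leq_trans (leqnSn n)) ?leq_maxl.
exists (MkIwasawa ycoh) => n; rewrite !rdE /=; exact: yN.
Qed.

Lemma rd_finite n : exists (F : finType) (phi : Lam -> F),
  forall x y, phi x = phi y -> rd n x = rd n y.
Proof.
have [s [us sall]] := Gquo_finite hG n.
exists {ffun 'I_(size s) -> 'Z_(p ^ n.+1)}, (fun x : Lam => [ffun i : 'I_(size s) => coeff (nth 1%g s i) (rd n x)]) => x y /ffunP e.
apply/eqP/freeg_eqP => a; have ia : (index a s < size s)%N by rewrite index_mem sall.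
by have := e (Ordinal ia); rewrite !ffunE /= nth_index.
Qed.

(* Koenig's lemma for the finite quotients [rd n]. *)
Lemma Lam_koenig (I : finType) (C : nat -> set (I -> Lam)) :
  (forall n, exists x, C n x) -> (forall n x, C n.+1 x -> C n x) ->
  (forall n x y, (forall i, rd n (x i) = rd n (y i)) -> C n x -> C n y) ->
  exists x, forall n, C n x.
Proof.
move=> Cne Cdec Csat.
have Cle n N x : (n <= N)%N -> C N x -> C n x.
  elim: N => [|N ih]; first by rewrite leqn0 => /eqP ->.
  rewrite leq_eqVlt => /orP[/eqP -> //|]; rewrite ltnS => nN /Cdec; exact: ih.
(* The class of [x] modulo [rd n] meets every [C N]: these are the nodes with arbitrarily long
   continuations. *)
pose good n (x : I -> Lam) := forall N, exists2 y, C N y & forall i, rd n (y i) = rd n (x i).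
have pigeon n (P : nat -> (I -> Lam) -> Prop) :
    (forall N, exists y, P N y) -> (forall N M y, (N <= M)%N -> P M y -> P N y) ->
    exists2 x, (exists N, P N x) & forall N, exists2 y, P N y & forall i, rd n (y i) = rd n (x i).
  move=> Pne Pdec; have [F [phi phiP]] := rd_finite n.
  pose code (x : I -> Lam) : {ffun I -> F} := [ffun i => phi (x i)].
  have codeP x y : code x = code y -> forall i, rd n (x i) = rd n (y i).
    by move=> /ffunP e i; apply: phiP; have := e i; rewrite !ffunE.
  apply: contrapT => no.
  (* Otherwise each of the finitely many codes is missed from some stage on, and nothing is left at
     the maximum of these stages. *)
  have bound c : exists N, forall y, P N y -> code y <> c.
    apply: contrapT => h; apply: no.
    have {}h N : exists2 y, P N y & code y = c.
      apply: contrapT => h'; apply: h; exists N => y Py cy; apply: h'.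
      by exists y.
    have [x Px cx] := h 0; exists x; first by exists 0.
    by move=> N; have [y Py cy] := h N; exists y => //; apply: codeP; rewrite cy cx.
  have [b bP] := choice bound.
  have [y Py] := Pne (\max_c b c).
  by apply: (bP (code y) y) => //; apply: Pdec Py; apply: leq_bigmax.
have start : {x | good 0 x}.
  apply: cid; have [|x _ xg] := pigeon 0 C Cne; last by exists x.
  by move=> N M y NM; exact: Cle.
have step n x : good n x -> {y | good n.+1 y & forall i, rd n (y i) = rd n (x i)}.
  move=> gx; apply: cid2.
  have [||y [N [_ yx]] yg] := @pigeon n.+1 (fun N y => C N y /\ forall i, rd n (y i) = rd n (x i)).
  - by move=> N; have [y Cy yx] := gx N; exists y.
  - by move=> N M y NM [/(Cle _ _ _ NM)].
  by exists y => // M; have [w [Cw _] wy] := yg M; exists w.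
pose fix xs n : {x | good n x} :=
  if n is m.+1 then let: exist2 y gy _ := step m _ (svalP (xs m)) in exist _ y gy else start.
have xsS n i : rd n (sval (xs n.+1) i) = rd n (sval (xs n) i).
  by rewrite /=; case: (step _ _ _) => y gy yx /=.
have [x xP] := choice (fun i => rd_complete (fun n => xsS n i)).
exists x => n; have [y Cy yx] := svalP (xs n) n.
by apply: Csat Cy => i; rewrite xP.
Qed.

Lemma level_pdiv n x : iw_map (proj_hom n) modp x = 0 -> exists w : Lam, x n = (w *+ p) n.
Proof.
rewrite proj_homE => x0.
have cE a : {z | coeff a (x n) = z *+ p}.
  apply: cid; apply: (zp_divp hp); apply: (@zp_modp_eq0 p hp).
  by rewrite -coeff_freeg_coef x0 coeff0.
have [w wE] := iw_lift (\sum_(a <- dom (x n)) << sval (cE a) *g a >>).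
exists w; rewrite iw_levelMn wE -sumrMnl -[LHS]freeg_sumE; apply: eq_bigr => a _.
by rewrite freeg_muln; case: (cE a) => z /= ->.
Qed.

Lemma LamH_closed x : (forall n, exists2 y, LamH y & rd n y = rd n x) -> LamH x.
Proof.
move=> cl n a a0.
have [k ak] : exists k, coeff a (x n) k <> 0.
  by apply/existsNP => h; move/eqP: a0; apply; apply: zp_ext => k; rewrite h.
have [y Hy yx] := cl (maxn n k); apply: (Hy n a).
apply: contra_notN ak => /eqP y0.
have /(congr1 (coeff a)) := rd_eqP (leq_maxl n k) (leq_maxr n k) yx.
by rewrite !coeff_freeg_coef y0 => e; exact: esym e.
Qed.

Definition span_with r s (x : Lam) := exists c : 'I_r -> Lam,
  (forall i, LamH (c i)) /\ exists b, x = \sum_i c i * gm ^+ i + b * s.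

Lemma span_withD r s x y : span_with r s x -> span_with r s y -> span_with r s (x + y).
Proof.
move=> [c [Hc [b ->]]] [c' [Hc' [b' ->]]]; exists (fun i => c i + c' i).
split=> [i|]; first exact: LamH_add.
exists (b + b'); rewrite addrACA mulrDl -big_split; congr (_ + _).
by apply: eq_bigr => i _; rewrite mulrDl.
Qed.

Lemma span_withMn r s x n : span_with r s x -> span_with r s (x *+ n).
Proof.
move=> sx; elim: n => [|n ih]; last by rewrite mulrS; apply: span_withD.
exists (fun=> 0); split=> [i|]; first exact: LamH0.
by exists 0; rewrite mul0r addr0 big1 // => i _; rewrite mul0r.
Qed.

(** [pair_span] at [N = n] leaves an error divisible by [p] at level [n]; treating the successive
    errors [n.+1] times leaves a multiple of $p^{n+1}$, which [rd n] kills. *)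
Lemma span_level s : ~ in_PP s -> exists r, forall n x,
  exists2 y, span_with r s y & rd n x = rd n y.
Proof.
move=> /pair_span[r sp]; exists r => n x.
have one (z : Lam) : exists y w, span_with r s y /\ z n = (y + w *+ p) n.
  have [c [Hc [b cb]]] := sp n n z (leqnn n).
  set y := \sum_i _ + _ in cb.
  have [|w wE] := @level_pdiv n (z - y).
    by rewrite (@iw_map_push _ _ _ _ (pair_hom n n) _ fst) // cb raddf0.
  exists y, w; split; first by exists c; split => //; exists b.
  by rewrite iw_levelD -wE iw_levelB addrC subrK.
have [y [w [sy xE]]] : exists y w, span_with r s y /\ x n = (y + w *+ (p ^ n.+1)) n.
  elim: n.+1 => [|k [y [w [sy xE]]]].
    have s0 : span_with r s 0 by have [y [_ [/(span_withMn 0) sy _]]] := one 0.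
    by exists 0, x; rewrite add0r.
  have [y' [w' [sy' wE]]] := one w.
  exists (y + y' *+ (p ^ k)), w'; split; first by apply: span_withD => //; apply: span_withMn.
  rewrite xE !iw_levelD !iw_levelMn wE iw_levelD iw_levelMn mulrnDl -mulrnA addrA.
  by rewrite expnS.
exists y => //; rewrite [LHS]rdE xE -rdE rmorphD rmorphMn /=.
suff -> : rd n w *+ p ^ n.+1 = 0 by rewrite addr0.
apply/eqP/freeg_eqP => a; rewrite coeffMn coeff0 -mulr_natr; apply/eqP.
by rewrite (_ : _%:R = 0) ?mulr0 //; apply/eqP; rewrite natr_Zpk_eq0.
Qed.

(* Weierstrass division, from its analogues modulo [p ^ n.+1] and [G_n] by compactness. *)
Lemma PPC_span s : ~ in_PP s -> exists r, forall x, span_with r s x.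
Proof.
move=> /span_level[r sp]; exists r => x.
pose val_of (z : option 'I_r -> Lam) := \sum_i z (Some i) * gm ^+ i + z None * s.
(* [None] holds the cofactor of [s]. Membership in $\mathbb{Z}_p[[H]]$ is imposed only modulo
   [rd n], so that [C n] is saturated; [LamH_closed] restores it in the limit. *)
pose C n (z : option 'I_r -> Lam) :=
  (forall i, exists2 c, LamH c & rd n c = rd n (z (Some i))) /\ rd n x = rd n (val_of z).
have rd_val n z z' : (forall i, rd n (z i) = rd n (z' i)) -> rd n (val_of z) = rd n (val_of z').
  move=> e; rewrite !rmorphD !rmorphM !rmorph_sum /= e; congr (_ + _).
  by apply: eq_bigr => i _; rewrite !rmorphM /= e.
have [|||z Cz] := @Lam_koenig _ C.
- move=> n; have [_ [c [Hc [b ->]]] xE] := sp n x.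
  exists (fun o => if o is Some i then c i else b); split => // i.
  by exists (c i).
- move=> n z [zH zx]; split=> [i|]; last exact: rd_le (leqnSn n) zx.
  by have [c Hc ce] := zH i; exists c => //; apply: rd_le (leqnSn n) ce.
- move=> n z z' e [zH zx]; split=> [i|]; last by rewrite zx; exact: rd_val.
  by have [c Hc ce] := zH i; exists c => //; rewrite ce.
exists (fun i => z (Some i)); split=> [i|].
  by apply: LamH_closed => n; have [zH _] := Cz n; exact: zH.
by exists (z None); apply: rd_sep => n; have [_] := Cz n.
Qed.

Lemma PPC_Ore_S s : ~ in_PP s -> Ore_S H s.
Proof.
move=> /PPC_span[r sp]; exists r, (fun i => gm ^+ i) => x.
have [c [Hc [b xE]]] := sp x; exists c; split => //.
by exists b => //; rewrite xE [_ - _]addrAC subrr add0r.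
Qed.

(** * Modules finitely generated over Z_p[[H]] *)

(** Modulo the prime ideal these are the diagonal matrices with nonzero entries, a shape that column
    elimination preserves. *)
Definition dominant_mx k (B : 'M[Lam]_k) :=
  (forall i, ~ in_PP (B i i)) /\ (forall i j, i != j -> in_PP (B i j)).

(** [H] dies in $\Gamma$, so $\mathbb{Z}_p[[H]]$ has only constants as image in
    $\mathbb{F}_p[[\Gamma]]$; the constant is read at [n = 0] and lifted to an integer. *)
Lemma LamH_residue c : LamH c -> exists k : int, in_PP (c - k%:~R).
Proof.
move=> Hc; pose D := iw_map (proj_hom 0) modp c.
exists (Posz (val (coeff 1%g D))) => N; apply/pair_hom0.
have DE : D = << coeff 1%g D *g 1%g >>.
  apply/eqP/freeg_eqP => a; rewrite coeffU.
  have -> : a = 1%g by rewrite -(Gproj_repr a); apply/Gproj1P; exact: Gpow_level0.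
  by rewrite eqxx mulr1.
apply/iw_map_sub0; rewrite LamH_pair // -/D {1}DE freeg_mapU.
rewrite -pmulrn rmorph_nat [RHS]freegU_muln.
by congr (<< _ *g _ >>); rewrite natr_Zp.
Qed.

Lemma PP_sum (I : Type) (r : seq I) (P : pred I) (F : I -> Lam) :
  (forall i, P i -> in_PP (F i)) -> in_PP (\sum_(i <- r | P i) F i).
Proof. by move=> FP; elim/big_ind: _ => //; [exact: PP0 | exact: PP_add]. Qed.

(** At the level [k] equal to the degree, $k < p^k$ keeps the powers $\gamma^i$, $i \le k$, distinct
    in $\Gamma/\Gamma^{p^k}$, and $\gamma^k$ has coefficient 1. *)
Lemma gev_monic (q : {poly int}) : q \is monic -> ~ in_PP (gev q).
Proof.
move=> mq; set k := (size q).-1; have sq : size q = k.+1 by rewrite /k prednK // size_poly_gt0 monic_neq0.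
have qk : q`_k = 1 by have /monicP := mq; rewrite lead_coefE.
have kp : (k < p ^ k)%N by rewrite ltn_expl // prime_gt1.
move=> /(_ k); rewrite (@gev_sum q k.+1) ?sq // rmorph_sum /=.
move=> /(congr1 (coeff (Gproj p k (pi (gam ^+ k)%g)))); rewrite coeff0 raddf_sum /=.
rewrite big_ord_recr /= big1 ?add0r => [|i _].
  rewrite qk mul1r -iw_groupX iw_map_group coeffU eqxx mulr1 => /eqP.
  by rewrite oner_eq0.
rewrite rmorphM /= rmorph_int -iw_groupX iw_map_group mulrzl raddfMz /= coeffU mul1r.
case: eqP => [/(Gam_projP hp)/(_ k.-1)|_]; last by rewrite mul0rz.
rewrite !pi_gam !zp_natr => h; have /h /(natr_Zpk_eq hp) : (k.-1 < k)%N.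
  by rewrite prednK // (leq_ltn_trans _ (ltn_ord i)).
have kp' j : (j <= k)%N -> (j < p ^ k.-1.+1)%N.
  by move=> jk; rewrite prednK ?(leq_ltn_trans jk) // (leq_ltn_trans _ (ltn_ord i)).
rewrite !modn_small ?kp' // ?(ltnW (ltn_ord i)) // => ik.
by have := ltn_ord i; rewrite ik ltnn.
Qed.

(* [gm *: g i = \sum_j C i j *: g j] modulo [N], with [C] congruent to an integral matrix
   [C0] modulo the prime ideal; take the adjugate of ['X - C0], evaluated at [gm], times
   [gm - C]. *)
Lemma fg_dominant (U : lmodType Lam) (N : set U) k (g : 'I_k -> U) :
  N 0 -> (forall x y, N x -> N y -> N (x + y)) -> (forall a x, N x -> N (a *: x)) ->
  (forall x, exists c : 'I_k -> Lam,
     (forall i, LamH (c i)) /\ N (x - \sum_i c i *: g i)) ->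
  exists2 B : 'M[Lam]_k, dominant_mx B & forall i, N (\sum_j B i j *: g j).
Proof.
move=> N0 ND NZ gen.
have [c cP] := choice (fun i => gen (gm *: g i)).
pose C : 'M[Lam]_k := \matrix_(i, j) c i j.
have [r rP] := choice (fun ij : 'I_k * 'I_k => LamH_residue ((cP ij.1).1 ij.2)).
pose C0 : 'M[int]_k := \matrix_(i, j) r (i, j).
pose A := map_mx gev (\adj (char_poly_mx C0)).
pose m := C - map_mx intr C0.
have mP i j : in_PP (m i j) by rewrite !mxE; exact: rP (i, j).
have cp : map_mx gev (char_poly_mx C0) = gm%:M - map_mx intr C0.
  by apply/matrixP => i j; rewrite !mxE rmorphB /= gevC rmorphMn /= gevX.
(* The entries of [C] need not commute with [gam], so the adjugate is that of the integral [C0]; the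
   error [A *m m] has entries in the prime ideal. *)
have AB : A *m (gm%:M - C) = (gev (char_poly C0))%:M - A *m m.
  have -> : gm%:M - C = map_mx gev (char_poly_mx C0) - m.
    by rewrite cp /m opprB addrA subrK.
  rewrite mulmxBr -map_mxM mul_adj_mx map_scalar_mx //.
exists (A *m (gm%:M - C)).
  have AmP i j : in_PP ((A *m m) i j) by rewrite mxE; apply: PP_sum => h _; apply: PP_mull; exact: mP.
  rewrite AB; move: (A *m m) AmP => W WP; split=> [i|i j ij]; rewrite !mxE.
    rewrite eqxx mulr1n => /PP_add/(_ (WP i i)); rewrite subrK.
    exact: gev_monic (char_poly_monic _).
  by rewrite (negPf ij) mulr0n add0r; apply: PP_opp.
move=> i.
have -> : \sum_j (A *m (gm%:M - C)) i j *: g j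
    = \sum_h A i h *: (gm *: g h - \sum_j c h j *: g j).
  rewrite (eq_bigr (fun j => \sum_h (A i h * (gm%:M - C) h j) *: g j)); last first.
    by move=> j _; rewrite mxE scaler_suml.
  rewrite exchange_big; apply: eq_bigr => h _.
  rewrite (eq_bigr (fun j => A i h *: ((gm%:M - C) h j *: g j))); last first.
    by move=> j _; rewrite scalerA.
  rewrite -scaler_sumr; congr (_ *: _).
  rewrite (eq_bigr (fun j => (gm *+ (h == j)) *: g j - c h j *: g j)); last first.
    by move=> j _; rewrite !mxE scalerBl.
  rewrite sumrB; congr (_ - _); rewrite (bigD1 h) //= eqxx mulr1n big1 ?addr0 // => j jh.
  by rewrite eq_sym (negPf jh) scale0r.
by elim/big_ind: _ => // h _; apply: NZ; exact: (cP h).2.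
Qed.

(** If [f] lay in the prime ideal, the matrix from [fg_dominant] would force every generator into
    it, diagonal entries being outside and the others inside; then 1 would lie in it too. *)
Lemma Ore_S_PPC f : Ore_S H f <-> ~ in_PP f.
Proof.
split=> [[k [g gen]] Pf|]; last exact: PPC_Ore_S.
have [|||B [Bd Bo] BN] := @fg_dominant Lam^o [set a * f | a in setT] k g _ _ _ gen.
- by exists 0 => //; rewrite mul0r.
- by move=> _ _ [a _ <-] [b _ <-]; exists (a + b) => //; rewrite mulrDl.
- by move=> a _ [b _ <-]; exists (a * b) => //; rewrite -mulrA.
have NP x : [set a * f | a in setT] x -> in_PP x by case=> a _ <-; exact: PP_mull.
have gP i : in_PP (g i : Lam).
  apply: (PP_prime (Bd i)); have := NP _ (BN i); rewrite (bigD1 i) //=.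
  set S := \sum_(j | _) _ => PS.
  have PS' : in_PP S by apply: PP_sum => j ji; apply: PP_mulr; apply: Bo; rewrite eq_sym.
  by have := PP_sub PS PS'; rewrite addrK.
have [c [_ /NP]] := gen 1; set S := \sum_i _ => P1.
have PS : in_PP S by apply: PP_sum => i _; apply: PP_mull.
by have := PP_add P1 PS; rewrite subrK; exact: PP1.
Qed.

Lemma Ore_SstarP f : Ore_Sstar p H f <-> exists k (a : Lam), ~ in_PP a /\ f = a *+ (p ^ k).
Proof.
split=> [[k [g [/Ore_S_PPC Sg ->]]]|[k [g [/Ore_S_PPC Sg ->]]]]; exists k, g;
  by rewrite mulr_natl.
Qed.

Lemma Ore_SstarM f f' : Ore_Sstar p H f -> Ore_Sstar p H f' -> Ore_Sstar p H (f * f').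
Proof.
move=> /Ore_SstarP[k [g [Sg ->]]] /Ore_SstarP[k' [g' [Sg' ->]]]; apply/Ore_SstarP.
by exists (k + k')%N, (g * g'); split; [exact: PP_mul | rewrite mulrnAl mulrnAr -mulrnA -expnD addnC].
Qed.

Lemma Ore_Sstar_nat k : Ore_Sstar p H (p ^ k)%:R.
Proof. by apply/Ore_SstarP; exists k, 1; split=> //; exact: PP1. Qed.

Lemma PPC_Sstar (a : Lam) : ~ in_PP a -> Ore_Sstar p H a.
Proof. by move=> Sa; apply/Ore_SstarP; exists 0, a; rewrite expn0 mulr1n. Qed.

(** * Gaussian elimination over the localization *)

Section Localization.
Variables (Q : unitRingType) (iota : {rmorphism Lam -> Q}).
Hypothesis hQ : Ore_localization (Ore_Sstar p H) iota.

Lemma loc_unit s : Ore_Sstar p H s -> iota s \is a GRing.unit.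
Proof. by case: hQ => h _ _ _; exact: h. Qed.

(** Writing $\iota(b)^{-1}\iota(r)$ as a right fraction and clearing the kernel of [iota] gives a
    denominator in $S^*$, that is $p^j$ times an element outside the prime ideal; [PP_pdivX] cancels
    $p^j$. *)
Lemma right_Ore (b r : Lam) : ~ in_PP b -> exists y s, ~ in_PP s /\ b * y = r * s.
Proof.
move=> nb; have [_ _ hR h0] := hQ.
have ub := loc_unit (PPC_Sstar nb).
have [s1 [a [Ss1 e]]] := hR ((iota b)^-1 * iota r).
have : iota (r * s1 - b * a) = 0.
  rewrite rmorphB !rmorphM /= -[iota r](mulVKr ub) e -!mulrA mulVr ?loc_unit //.
  by rewrite mulr1 subrr.
move=> /h0[_ [s2 Ss2]]; rewrite mulrBl => /eqP; rewrite subr_eq0 -!mulrA => /eqP e2.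
have /Ore_SstarP[j [s [ns se]]] := Ore_SstarM Ss1 Ss2.
have [|y _ yE] := @PP_pdivX b (a * s2) (r * s) j nb.
  by rewrite -e2 se mulrnAr.
by exists y, s.
Qed.

(* Column elimination: the Ore condition clears the first row and leaves a dominant
   matrix of smaller size. *)
Lemma dominant_invertible k (B : 'M[Lam]_k) : dominant_mx B -> invertible_mx (map_mx iota B).
Proof.
elim: k B => [|k ih] B dB; first by exists 1%:M; split; apply/matrixP => -[].
change 'M[Lam]_(1 + k) in B; have [Bd Bo] := dB : @dominant_mx (1 + k) B.
pose o := lshift k (0 : 'I_1); pose q := @rshift 1 k.
pose b := B o o; have nb : ~ in_PP b := Bd o.
have [y yP] := choice (fun j : 'I_k => right_Ore (B o (q j)) nb).
have [s sP] := choice yP.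
have Py j : in_PP (y j).
  by apply: (PP_prime nb); rewrite (sP j).2; apply: PP_mulr; apply: Bo; rewrite eq_lrshift.
pose T : 'M[Lam]_(1 + k) := block_mx 1%:M (- \row_j y j) 0 (diag_mx (\row_j s j)).
pose c : 'M[Lam]_(k, 1) := dlsubmx B.
pose D := drsubmx B *m diag_mx (\row_j s j) - c *m \row_j y j.
have BT : B *m T = block_mx b%:M 0 c D.
  rewrite -[B]submxK mulmx_block !mulmx1 !mulmx0 !addr0 !mulmxN.
  congr block_mx.
  - by rewrite [LHS]mx11_scalar !mxE.
  - apply/matrixP => i j; rewrite !mxE big_ord1 (bigD1 j) //= big1 ?addr0 => [|h hj].
      by rewrite !mxE eqxx mulr1n !ord1 -(sP j).2 addNr.
    by rewrite !mxE (negPf hj) mulr0n mulr0.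
  - by rewrite addrC.
have DE i j : D i j = B (q i) (q j) * s j - B (q i) o * y j.
  rewrite !mxE big_ord1 !mxE (bigD1 j) //= big1 ?addr0 => [|h hj].
    by rewrite !mxE eqxx mulr1n.
  by rewrite !mxE (negPf hj) mulr0n mulr0.
have Ddom : dominant_mx D.
  split=> [i|i j ij]; rewrite DE.
    move=> /PP_add/(_ (PP_mull (B (q i) o) (Py i))); rewrite subrK.
    exact: PP_mul (Bd _) (sP i).1.
  apply: PP_sub; last exact: PP_mull.
  by apply: PP_mulr; apply: Bo; rewrite eq_rshift.
(* The diagonal entries of [T] are 1 and the [s j], units over [Q], so [B] may be replaced by the
   triangular [B *m T]. *)
apply: (@invertible_factor _ _ _ (map_mx iota T)).
  rewrite -map_mxM BT map_block_mx map_mx0.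
  apply: invertible_lower; last exact: ih.
  rewrite map_scalar_mx; apply: invertible_scalar1.
  exact/loc_unit/PPC_Sstar.
rewrite map_block_mx map_mx0 map_mx1; apply: invertible_upper.
  by exists 1%:M; rewrite mulmx1.
rewrite map_diag_mx; apply: invertible_diag => i; rewrite !mxE.
exact/loc_unit/PPC_Sstar/(sP i).1.
Qed.
End Localization.

(** * The Laplacian of the tower *)

Section Graph.
Variables (m : nat) (E : finType) (s t : E -> 'I_m) (alpha : E -> G).
Notation Xn := (@derived p G (@Graph 'I_m E s t) alpha).
Notation Pinf := (PicInf p s t alpha).

(** The two transpositions cancel: entrywise this is $D - A_\alpha$, acting on row vectors from the
    right. *)
Definition lap_mx : 'M[Lam]_m := of_columns (Dmat s t Lam - (Amat p s t alpha)^T).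

Lemma lap_mxE i j : lap_mx i j = (degree s t i)%:R *+ (i == j)
  - (\sum_(e | (s e == i) && (t e == j)) [: alpha e :]
     + \sum_(e | (s e == j) && (t e == i)) [: (alpha e)^-1%g :]).
Proof.
rewrite !mxE; congr (_ - _); case: (eqVneq j i) => [->|] /=; first by rewrite !mulr1n.
by rewrite eq_sym => /negPf ji; rewrite !mulr0n.
Qed.

Definition embed_vertex n (i : 'I_m) (g : Gquo p n G) : vert (Xn n) := (i, g).

Definition to_div n (v : 'rV[Lam]_m) : Div p (Xn n) :=
  \sum_i freeg_map (@embed_vertex n i) (v 0 i n).

Lemma div_act_embed n i (a b : grpring (Zpadic p) (Gquo p n G)) :
  div_act a (freeg_map (@embed_vertex n i) b : Div p (Xn n))
  = freeg_map (@embed_vertex n i) (a * b).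
Proof.
elim/freeg_lin_ind: a => [|k g a iha]; first by rewrite div_act0 mul0r raddf0.
rewrite div_actDl mulrDl raddfD /= iha; congr (_ + _) => {iha}.
rewrite div_actZl grpring_scalerAl freeg_mapZ; congr (_ *: _).
by rewrite /div_act fgliftE grpring_mulU !freeg_map_comp.
Qed.

Lemma to_divB n v w : to_div n (v - w) = to_div n v - to_div n w.
Proof. by rewrite -sumrB; apply: eq_bigr => i _; rewrite mxE iw_levelD raddfD /= mxE raddfN. Qed.

Lemma to_divD n v w : to_div n (v + w) = to_div n v + to_div n w.
Proof. by rewrite -big_split; apply: eq_bigr => i _; rewrite mxE iw_levelD raddfD. Qed.

Lemma to_div0 n : to_div n 0 = 0.
Proof. by rewrite -(subrr 0) to_divB subrr. Qed.

Lemma to_divZ n a v : to_div n (a *: v) = div_act (a n) (to_div n v).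
Proof.
rewrite /to_div.
have -> : div_act (a n) (\sum_i freeg_map (@embed_vertex n i) (v 0 i n) : Div p (Xn n))
   = \sum_i div_act (a n) (freeg_map (@embed_vertex n i) (v 0 i n) : Div p (Xn n)).
  elim/big_rec2: _ => [|i x y _ <-]; first by rewrite div_actx0.
  exact: div_actD.
by apply: eq_bigr => i _; rewrite mxE div_act_embed.
Qed.

Lemma coeff_to_div n v i (g : Gquo p n G) : coeff (@embed_vertex n i g) (to_div n v) = coeff g (v 0 i n).
Proof.
rewrite raddf_sum /= (bigD1 i) //= coeff_map_inj => [|x y []] //.
rewrite big1 ?addr0 // => j ji.
elim/freeg_lin_ind: (v 0 j n) => [|k x D ih]; first by rewrite raddf0 coeff0.
rewrite raddfD /= coeffD ih addr0 freeg_mapZ freeg_map_basis coeffZ coeffU.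
by rewrite /embed_vertex xpair_eqE (negPf ji) !mulr0.
Qed.

Lemma to_div_push n v : div_push (to_div n.+1 v) = to_div n v.
Proof.
rewrite [div_push _](raddf_sum (freeg_map (@vertex_push p G _ _ s t alpha n))) /=.
apply: eq_bigr => i _; rewrite -(iw_coherent (v 0 i) n) !freeg_map_comp.
exact: eq_freeg_map.
Qed.

Lemma to_div_lift n (D : Div p (Xn n)) : exists v, to_div n v = D.
Proof.
elim/freeg_lin_ind: D => [|k [i g] D [v <-]]; first by exists 0; rewrite to_div0.
exists ((iw_const p G k * [: repr g :]) *: delta_mx 0 i + v).
rewrite to_divD; congr (_ + _); rewrite to_divZ iw_const_level div_actZl /= Gproj_repr.
congr (_ *: _); rewrite /to_div (bigD1 i) //= big1 ?addr0 => [|j ji].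
  rewrite mxE !eqxx /= freeg_map_basis div_actUU.
  by rewrite /vertex_act /= mulg1.
by rewrite mxE (negPf ji) andbF raddf0.
Qed.

Lemma lapdivE n i (g : Gquo p n G) :
  lapdiv p (@embed_vertex n i g) =
  \sum_(e | s e == i) (<< embed_vertex i g >> - << embed_vertex (t e) (g * Gproj p n (alpha e))%g >>)
  + \sum_(e | t e == i) (<< embed_vertex i g >>
       - << embed_vertex (s e) (g * (Gproj p n (alpha e))^-1)%g >>).
Proof.
rewrite /lapdiv; congr (_ + _).
  rewrite (@reindex_fsbig _ _ _ _ _ (fun e : E => (e, g)) [set e | s e == i]); last first.
    split=> [e /= /eqP <- //|e e' _ _ [] //|[e h] /= [<- <-]].
    by exists e => /=.
  by rewrite fsbig_fin_pred.
rewrite (@reindex_fsbig _ _ _ _ _ (fun e : E => (e, (g * (Gproj p n (alpha e))^-1)%g)) [set e | t e == i]); last first.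
  split=> [e /= /eqP <-|e e' _ _ [] //|[e h] /= [<- <-]].
    by rewrite mulgVK.
  by exists e => //=; rewrite mulgK.
by rewrite fsbig_fin_pred.
Qed.

Lemma sum_ends (V : zmodType) (P : pred E) (u : E -> 'I_m) (F : E -> 'I_m -> V) :
  \sum_j \sum_(e | P e && (u e == j)) F e j = \sum_(e | P e) F e (u e).
Proof.
rewrite [RHS](partition_big u xpredT) //=; apply: eq_bigr => j _.
by apply: eq_bigr => e /andP[_ /eqP ->].
Qed.

Lemma to_div_row n i g :
  to_div n ([: g :] *: row i lap_mx) = lapdiv p (@embed_vertex n i (Gproj p n g)).
Proof.
rewrite lapdivE !sumrB addrACA -opprD; set v0 := << embed_vertex i _ >>.
transitivity (\sum_j (freeg_map (@embed_vertex n j) (<< Gproj p n g >> *+ (degree s t i * (i == j)))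
   - (\sum_(e | (s e == i) && (t e == j)) << embed_vertex j (Gproj p n g * Gproj p n (alpha e))%g >>
    + \sum_(e | (t e == i) && (s e == j)) << embed_vertex j (Gproj p n g * (Gproj p n (alpha e))^-1)%g >>)
    : {freeg _ / (Zpadic p)})).
  apply: eq_bigr => j _; rewrite mxE [row i _ 0 j]mxE lap_mxE.
  rewrite iw_levelM iw_levelB iw_levelMn iw_levelMn iw_levelD !iw_level_sum /=.
  rewrite mulrBr raddfB /= -mulrnA mulrnAr mulr1; congr (_ - _).
  rewrite mulrDr raddfD /= !mulr_sumr !raddf_sum /=; congr (_ + _).
    by apply: eq_bigr => e _; rewrite grpring_mulUU freeg_map_basis.
  apply: eq_big => e; first by rewrite andbC.
  move=> _; rewrite grpring_mulUU freeg_map_basis.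
  by have /= -> := lhomV (proj_hom n) (alpha e).
rewrite sumrB big_split /= !sum_ends; congr (_ - _).
rewrite (bigD1 i) //= eqxx muln1 big1 ?addr0 => [|j ji]; last first.
  by rewrite eq_sym (negPf ji) muln0 raddf0.
rewrite raddfMn /= freeg_map_basis mulrnDr; congr (_ + _);
  by rewrite sumr_const.
Qed.

Lemma Pr_to_div n (D : Div p (Xn n)) :
  D \in Pr p (Xn n) <-> exists y, D = to_div n (y *m lap_mx).
Proof.
split.
  elim/zspan_ind => [|x z [y ->] [y' ->]|_ [a [[i g] ->]]].
  - exists 0; rewrite mul0mx to_div0; exact: erefl.
  - by exists (y - y'); rewrite mulmxBl to_divB.
  exists (iw_const p G a *: ([: repr g :] *: delta_mx 0 i)).
  rewrite -!scalemxAl -rowE to_divZ to_div_row Gproj_repr /=.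
  by rewrite freegU_scale div_actZl div_act1.
move=> [y ->]; rewrite mulmx_sum_row.
apply: (big_rec (fun w => to_div n w \in Pr p (Xn n))) => [|i x _ xP].
  by rewrite to_div0; exact: (zspan_closed _).1.
suff rP : to_div n (row i lap_mx) \in Pr p (Xn n).
  rewrite to_divD to_divZ; have aP := div_act_Pr (y 0 i n) rP.
  exact: rpredD aP xP.
have -> : row i lap_mx = [: 1%g :] *: row i lap_mx by rewrite iw_group1 scale1r.
rewrite to_div_row; apply: zspan_gen; exists 1, (embed_vertex i (Gproj p n 1%g)).
exact/esym/scale1r.
Qed.

Lemma aug_coherent v n : pic_push (pic_class (to_div n.+1 v)) = pic_class (to_div n v).
Proof. by rewrite pic_pushE to_div_push. Qed.

Definition aug (v : 'rV[Lam]_m) : Pinf := MkPicInf (aug_coherent v).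

Lemma aug_linear : linear aug.
Proof.
move=> a v w; apply: PicInf_ext => n.
by rewrite [RHS](_ : _ = pic_act (a n) (aug v n) + aug w n) //= pic_actE -pic_classD to_divD to_divZ.
Qed.
HB.instance Definition _ := GRing.isLinear.Build Lam 'rV[Lam]_m Pinf *:%R aug aug_linear.

Lemma pic_class_eq n (D D' : Div p (Xn n)) : pic_class D = pic_class D' <-> D - D' \in Pr p (Xn n).
Proof. exact: zclass_eq. Qed.

Lemma pic_class_eq0 n (D : Div p (Xn n)) : pic_class D = 0 <-> D \in Pr p (Xn n).
Proof.
have <- : pic_class (0 : Div p (Xn n)) = 0.
  by apply: (@addrI _ (pic_class (0 : Div p (Xn n)))); rewrite -pic_classD !addr0.
by apply: iff_trans; first exact: pic_class_eq; rewrite subr0.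
Qed.

(** Lifts are made compatible on the nose: a lift to level [n.+1] misses the previous one by a
    principal divisor, the image of some [y *m lap_mx], and this correction does not change the
    class. *)
Lemma aug_surj x : exists v, aug v = x.
Proof.
have lift0 n : exists v, pic_class (to_div n v) = x n.
  by have [D ->] := pic_classP (x n); have [v <-] := to_div_lift D; exists v.
have step n v : pic_class (to_div n v) = x n ->
    {w | pic_class (to_div n.+1 w) = x n.+1 & to_div n w = to_div n v}.
  move=> vx; apply: cid2; have [w wx] := lift0 n.+1.
  have : pic_class (to_div n v) = pic_class (to_div n w).
    by rewrite vx -(pic_coherent x n) -wx pic_pushE to_div_push.
  move=> /pic_class_eq/Pr_to_div[y yE]; exists (w + y *m lap_mx).
    rewrite -wx; apply/pic_class_eq; rewrite to_divD addrAC subrr add0r.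
    by apply/Pr_to_div; exists y.
  by rewrite to_divD -yE addrC subrK.
pose fix vs n : {v | pic_class (to_div n v) = x n} :=
  if n is k.+1 then let: exist2 w wx _ := step k _ (svalP (vs k)) in exist _ w wx
  else cid (lift0 0).
have vsS n : to_div n (sval (vs n.+1)) = to_div n (sval (vs n)).
  by rewrite /=; case: (step _ _ _) => w wx ww /=.
have coh i n : freeg_map (@Gtrans p n G) (sval (vs n.+1) 0 i n.+1) = sval (vs n) 0 i n.
  rewrite iw_coherent; apply/eqP/freeg_eqP => g.
  by rewrite -!coeff_to_div vsS.
exists (\row_i MkIwasawa (coh i)); apply: PicInf_ext => n /=.
rewrite -(svalP (vs n)); congr pic_class; apply: eq_bigr => i _.
by rewrite mxE.
Qed.

(** Each level gives a solution [y] modulo [rd n], but these solutions need not be compatible;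
    [Lam_koenig] produces a common one. *)
Lemma aug_ker v : aug v = 0 <-> exists y, v = y *m lap_mx.
Proof.
split=> [v0|[y ->]]; last first.
  apply: PicInf_ext => n; apply/pic_class_eq0/Pr_to_div.
  by exists y.
have yP n : exists y, to_div n v = to_div n (y *m lap_mx).
  apply/Pr_to_div/pic_class_eq0.
  exact: (congr1 (fun x : Pinf => x n) v0).
pose C n (y : 'I_m -> Lam) := forall j, rd n (v 0 j) = rd n (((\row_i y i) *m lap_mx) 0 j).
have [|||y Cy] := @Lam_koenig _ C.
- move=> n; have [y yE] := yP n; exists (fun i => y 0 i) => j.
  have -> : \row_i y 0 i = y by apply/rowP => i; rewrite mxE.
  by rewrite !rdE; congr freeg_coef; apply/eqP/freeg_eqP => g; rewrite -!coeff_to_div yE.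
- by move=> n y Cy j; apply: rd_le (leqnSn n) (Cy j).
- move=> n y z e Cy j; rewrite Cy !mxE !rmorph_sum; apply: eq_bigr => i _.
  by rewrite !rmorphM /= !mxE e.
exists (\row_i y i); apply/rowP => j; apply: rd_sep => n; exact: Cy.
Qed.

(** * Injectivity of the Laplacian *)

Lemma sum_starts (V : zmodType) (P : pred E) (u : E -> 'I_m) (F : E -> 'I_m -> V) :
  \sum_j \sum_(e | (u e == j) && P e) F e j = \sum_(e | P e) F e (u e).
Proof.
rewrite -sum_ends; apply: eq_bigr => j _; apply: eq_bigl => e; exact: andbC.
Qed.

(** Self-adjointness: on coefficients, right multiplication by [lap_mx] is the graph Laplacian of
    the function $(v_j, g) \mapsto$ [coeff g (v 0 j n)] on the vertices of [Xn n]. *)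
Lemma coeff_lap n (v : 'rV[Lam]_m) j (g : Gquo p n G) :
  coeff g ((v *m lap_mx) 0 j n) =
  \sum_(e | s e == j) (coeff g (v 0 j n) - coeff (g * Gproj p n (alpha e))%g (v 0 (t e) n))
  + \sum_(e | t e == j) (coeff g (v 0 j n) - coeff (g * (Gproj p n (alpha e))^-1)%g (v 0 (s e) n)).
Proof.
rewrite mxE iw_level_sum raddf_sum /= !sumrB addrACA -opprD.
transitivity (\sum_i ((coeff g (v 0 i n) *+ (degree s t i * (i == j)))
   - (\sum_(e | (s e == i) && (t e == j)) coeff (g * (Gproj p n (alpha e))^-1)%g (v 0 i n)
    + \sum_(e | (t e == i) && (s e == j)) coeff (g * Gproj p n (alpha e))%g (v 0 i n)))).
  apply: eq_bigr => i _; rewrite lap_mxE.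
  rewrite iw_levelB iw_levelMn iw_levelMn iw_levelD !iw_level_sum /=.
  rewrite mulrBr raddfB /= -mulrnA mulrnAr mulr1 raddfMn /=; congr (_ - _).
  rewrite mulrDr raddfD /= !mulr_sumr !raddf_sum /=; congr (_ + _).
    by apply: eq_bigr => e _; rewrite coeff_mulUr.
  apply: eq_big => e; first by rewrite andbC.
  move=> _; rewrite coeff_mulUr.
  have /= -> := lhomV (proj_hom n) (alpha e).
  by rewrite invgK.
rewrite sumrB big_split /= !sum_starts; congr (_ - _); last exact: addrC.
rewrite (bigD1 j) //= eqxx muln1 big1 ?addr0 => [|i ij]; last first.
  by rewrite (negPf ij) muln0 mulr0n.
by rewrite mulrnDr !sumr_const.
Qed.

Hypothesis hXn : forall n, connected_graph (Xn n).

(** The coefficients are harmonic on [Xn n]. An enumeration of $G^{(n)}$ turns its vertices into the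
    finite type that [harmonic_const] expects. *)
Lemma lap_kernel_const n (v : 'rV[Lam]_m) : v *m lap_mx = 0 ->
  forall i j (g h : Gquo p n G), coeff g (v 0 i n) = coeff h (v 0 j n).
Proof.
move=> v0; have [sG [usG allG]] := Gquo_finite hG n.
pose k := size sG; have idx (g : Gquo p n G) : (index g sG < k)%N by rewrite index_mem allG.
pose ix (g : Gquo p n G) : 'I_k := Ordinal (idx g).
pose gx (a : 'I_k) : Gquo p n G := nth 1%g sG a.
have ixK (g : Gquo p n G) : gx (ix g) = g by rewrite /gx /= nth_index.
have gxK a : ix (gx a) = a by apply: val_inj; rewrite /= index_uniq.
pose nb (x : 'I_m * 'I_k) : seq ('I_m * 'I_k) :=
  [seq (t e, ix (gx x.2 * Gproj p n (alpha e))%g) | e <- index_enum E & s e == x.1]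
  ++ [seq (s e, ix (gx x.2 * (Gproj p n (alpha e))^-1)%g) | e <- index_enum E & t e == x.1].
have conn (A : {pred 'I_m * 'I_k}) : (exists x, x \in A) ->
    (forall x y, x \in A -> y \in nb x -> y \in A) -> forall x, x \in A.
  move=> [[i a] xA] Ac [j b].
  pose B (y : vert (Xn n)) := (y.1, ix y.2).
  suff : (B (i, gx a) \in A) = (B (j, gx b) \in A) by rewrite /B /= !gxK xA.
  have [_ /(_ (i, gx a) (j, gx b))] := hXn n.
  elim=> [y z [[e h] [<- <-]]|//|y z _ -> //|y z w _ -> _ -> //].
  apply/idP/idP => [yA|zA].
    apply: (Ac _ _ yA); rewrite mem_cat; apply/orP; left; apply/mapP.
    exists e; first by rewrite mem_filter eqxx mem_index_enum.
    by rewrite /B /= ixK.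
  apply: (Ac _ _ zA); rewrite mem_cat; apply/orP; right; apply/mapP.
  exists e; first by rewrite mem_filter eqxx mem_index_enum.
  by rewrite /B /= ixK mulgK.
pose f (x : 'I_m * 'I_k) := coeff (gx x.2) (v 0 x.1 n).
have harm x : \sum_(y <- nb x) (f x - f y) = 0.
  have : coeff (gx x.2) ((v *m lap_mx) 0 x.1 n) = 0 by rewrite v0 mxE coeff0.
  rewrite coeff_lap => e0; rewrite -[RHS]e0 /nb big_cat /= !big_map !big_filter.
  have fE i (a : Gquo p n G) : f (i, ix a) = coeff a (v 0 i n) by rewrite /f [gx _]ixK.
  by apply: congr2; apply: eq_bigr => e _; rewrite fE; exact: erefl.
move=> i j g h; have := @harmonic_const _ nb conn p hp f harm (i, ix g) (j, ix h).
by rewrite /f /= !ixK.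
Qed.

(* The coordinates are constant on each level, and every constant is [p ^ l] times
   the constant of the next level. *)
Lemma lap_mx_inj (v : 'rV[Lam]_m) : v *m lap_mx = 0 -> v = 0.
Proof.
move=> v0; apply/rowP => i; rewrite mxE; apply: iwasawa_ext => n.
apply/eqP/freeg_eqP => g; rewrite coeff0.
have fall k (g' : Gquo p k G) : coeff g' (v 0 i k) = coeff 1%g (v 0 i k) by exact: lap_kernel_const.
rewrite fall; pose c k := coeff (1%g : Gquo p k G) (v 0 i k).
have cS k : c k = c k.+1 *+ (p ^ l).
  rewrite /c -[v 0 i k](iw_coherent (v 0 i) k).
  have [r [ur rE sr]] := Gtrans_fiber (1%g : Gquo p k G).
  rewrite (coeff_freeg_map_fiber _ ur rE) (eq_bigr (fun=> c k.+1)) => [|a _]; last exact: fall.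
  by rewrite big_const_seq count_predT sr iter_addr_0.
apply: (Zpadic_divisible_eq0 hp) => k.
rewrite -/(c n); have [y ->] : exists y, c n = y *+ (p ^ l) ^ k.
  elim: k => [|k [y yE]]; first by exists (c n); rewrite expn0 mulr1n.
  have : forall j, c n = c (n + j)%N *+ (p ^ l) ^ j.
    elim=> [|j ->]; first by rewrite addn0 expn0.
    by rewrite cS addnS -mulrnA -expnS.
  by move=> /(_ k.+1) ->; exists (c (n + k.+1)%N).
exists (y *+ (p ^ (l * k - k))); rewrite -mulrnA -expnD subnK ?expnM //.
by rewrite leq_pmull // dim_gt0.
Qed.

(** * The localized Laplacian *)

Section LocalizedLaplacian.
Variables (Q : unitRingType) (iota : {rmorphism Lam -> Q}).
Hypotheses (hQ : Ore_localization (Ore_Sstar p H) iota) (hPic : MHG_property H Pinf).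

Lemma common_denominator n (q : 'rV[Q]_n) :
  exists z a, Ore_Sstar p H z /\ iota z *: q = map_mx iota a.
Proof.
have [_ hL _ _] := hQ.
have [z [Sz zP]] : exists z, Ore_Sstar p H z /\
    forall j, j \in enum 'I_n -> exists a, iota z * q 0 j = iota a.
  elim: (enum 'I_n) => [|j r [z [Sz zP]]].
    by exists 1; split=> //; exact: (Ore_Sstar_nat 0).
  have [z' [a [Sz' e]]] := hL (iota z * q 0 j).
  exists (z' * z); split; first exact: Ore_SstarM.
  move=> i; rewrite inE => /orP[/eqP ->|/zP[b ib]].
    by exists a; rewrite rmorphM /= -mulrA e mulVKr // (loc_unit hQ).
  by exists (z' * b); rewrite !rmorphM /= -mulrA ib.
have [a aP] := choice (fun j => zP j (mem_enum _ j)).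
exists z, (\row_j a j); split => //; apply/rowP => j; rewrite !mxE.
exact: aP.
Qed.

Lemma kill_row n (v : 'rV[Lam]_n) : map_mx iota v = 0 ->
  exists2 z, Ore_Sstar p H z & z *: v = 0.
Proof.
move=> v0; have [_ _ _ h0] := hQ.
have [z Sz zP] : exists2 z, Ore_Sstar p H z & forall j, j \in enum 'I_n -> z * v 0 j = 0.
  elim: (enum 'I_n) => [|j r [z Sz zP]]; first by exists 1 => //; exact: (Ore_Sstar_nat 0).
  have [] := h0 (z * v 0 j).
    by have /rowP/(_ j) := v0; rewrite !mxE rmorphM /= => ->; rewrite mulr0.
  move=> [z' Sz' e] _; exists (z' * z); first exact: Ore_SstarM.
  by move=> i; rewrite inE -mulrA => /orP[/eqP ->//|/zP ->]; rewrite mulr0.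
by exists z => //; apply/rowP => j; rewrite !mxE zP ?mem_enum.
Qed.

Lemma torsion_row (v : 'rV[Lam]_m) : p_power_torsion (aug v) ->
  exists z : 'rV[Q]_m, map_mx iota v = z *m map_mx iota lap_mx.
Proof.
move=> [k]; rewrite -raddfMn /= => /aug_ker[y yE].
have uk := loc_unit hQ (Ore_Sstar_nat k).
exists ((iota (p ^ k)%:R)^-1 *: map_mx iota y).
rewrite -scalemxAl -map_mxM -yE; apply/rowP => j; rewrite !mxE.
rewrite (_ : (v *+ p ^ k) 0 j = (p ^ k)%:R * v 0 j) ?rmorphM ?mulKr //.
by rewrite mulr_natl mulmxnE.
Qed.

Lemma torsion_mx k (V : 'M[Lam]_(k, m)) : (forall i, p_power_torsion (aug (row i V))) ->
  exists Z : 'M[Q]_(k, m), map_mx iota V = Z *m map_mx iota lap_mx.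
Proof.
move=> tV; have [z zP] := choice (fun i => torsion_row (tV i)).
exists (\matrix_i z i); apply/row_matrixP => i.
by rewrite row_mul rowK -zP -map_row.
Qed.

Lemma p_torsion0 : p_power_torsion (0 : Pinf).
Proof. by exists 0%N; rewrite mul0rn. Qed.
Lemma p_torsionD (x y : Pinf) : p_power_torsion x -> p_power_torsion y -> p_power_torsion (x + y).
Proof.
move=> [k xk] [k' yk]; exists (k + k')%N.
by rewrite mulrnDl expnD mulrnA xk mul0rn mulnC mulrnA yk mul0rn addr0.
Qed.
Lemma p_torsionZ a (x : Pinf) : p_power_torsion x -> p_power_torsion (a *: x).
Proof. by move=> [k xk]; exists k; rewrite scalerMnr xk scaler0. Qed.

Lemma aug_sum k (c : 'I_k -> Lam) (w : 'I_k -> 'rV[Lam]_m) :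
  aug (\sum_i c i *: w i) = \sum_i c i *: aug (w i).
Proof. by rewrite raddf_sum; apply: eq_bigr => i _; exact: linearZ_LR. Qed.

(* [B] kills the generators [g] up to torsion, and the basis of [Lam ^ m] is a
   combination of lifts [W] of [g] modulo the Laplacian and torsion; both torsions die
   after localization. *)
Lemma lap_left_inverse : exists X : 'M[Q]_m, X *m map_mx iota lap_mx = 1%:M.
Proof.
have [_ [k [g gen]]] := hPic.
have [B Bd BT] := fg_dominant p_torsion0 p_torsionD p_torsionZ gen.
have [w wg] := choice (fun i => aug_surj (g i)).
pose W : 'M[Lam]_(k, m) := \matrix_i w i.
have [Z BW] : exists Z, map_mx iota (B *m W) = Z *m map_mx iota lap_mx.
  apply: torsion_mx => i; rewrite row_mul mulmx_sum_row aug_sum.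
  rewrite (eq_bigr (fun j => B i j *: g j)) => [|j _]; first exact: BT.
  by rewrite rowK wg mxE.
have [c cP] := choice (fun i : 'I_m => gen (aug (delta_mx 0 i))).
pose C : 'M[Lam]_(m, k) := \matrix_(i, j) c i j.
have [Z' CW] : exists Z', map_mx iota (1%:M - C *m W) = Z' *m map_mx iota lap_mx.
  apply: torsion_mx => i; rewrite linearB /= rowE mulmx1 raddfB /= row_mul mulmx_sum_row aug_sum.
  rewrite (eq_bigr (fun j => c i j *: g j)) => [|j _]; first exact: (cP i).2.
  by rewrite rowK wg !mxE.
have [B' [_ B'B]] := dominant_invertible hQ Bd.
(* With [M] the Laplacian over [Q], one has $W = B'ZM$ and $1 = CW + Z'M$. *)
exists (map_mx iota C *m B' *m Z + Z').
rewrite mulmxDl -mulmxA -BW -CW !map_mxM map_mxB map_mx1 map_mxM.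
by rewrite !mulmxA -(mulmxA _ B') B'B mulmx1 addrC subrK.
Qed.

(** Each row is a left fraction $z^{-1}a$; the product of [a] with the Laplacian is killed by some
    $z'$ in $S^*$, whence $z'a = 0$ by [lap_mx_inj]. *)
Lemma loc_lap_inj n (q : 'M[Q]_(n, m)) : q *m map_mx iota lap_mx = 0 -> q = 0.
Proof.
move=> qM; apply/row_matrixP => i; rewrite row0.
have {}qM : row i q *m map_mx iota lap_mx = 0 by rewrite -row_mul qM row0.
have [z [a [Sz za]]] := common_denominator (row i q).
have [|z' Sz'] := @kill_row _ (a *m lap_mx).
  by rewrite map_mxM -za -scalemxAl qM scaler0.
rewrite scalemxAl => /lap_mx_inj a0.
have uz := loc_unit hQ Sz; have uz' := loc_unit hQ Sz'.
have : iota z' *: (iota z *: row i q) = 0.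
  by rewrite za -map_mxZ a0 map_mx0.
by rewrite scalerA => /(congr1 (fun v => (iota z' * iota z)^-1 *: v)); rewrite scalerA mulVr ?unitrMl // scale1r scaler0.
Qed.

Lemma lap_invertible : invertible_mx (map_mx iota lap_mx).
Proof.
have [X XM] := lap_left_inverse; exists X; split => //.
apply/eqP; rewrite -subr_eq0; apply/eqP/loc_lap_inj.
by rewrite mulmxBl -mulmxA XM mulmx1 mul1mx subrr.
Qed.

Lemma lap_coker_torsion (x : 'rV[Lam]_m) :
  exists z y, Ore_Sstar p H z /\ z *: x = y *m lap_mx.
Proof.
have [X XM] := lap_left_inverse.
have [z [a [Sz za]]] := common_denominator (map_mx iota x *m X).
have [|z' Sz' e] := @kill_row _ (z *: x - a *m lap_mx).
  by rewrite map_mxB map_mxM -za -scalemxAl -mulmxA XM mulmx1 map_mxZ subrr.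
exists (z' * z), (z' *: a); split; first exact: Ore_SstarM.
by apply/eqP; rewrite -subr_eq0 -scalemxAl -scalerA -scalerBr e.
Qed.

Lemma cone_lap_torsion : torsion_cohomology (Ore_Sstar p H) (cone lap_mx).
Proof.
have S1 := Ore_Sstar_nat 0.
case=> [n|[|[|n]]] x _ dx.
- exists 1, 0; split=> //; first by rewrite /cterm /= mul0mx.
  by apply: row_rank0; exact: cone_rank_pos.
- have [z [y [Sz zx]]] := lap_coker_torsion x.
  by exists z, y; split => //; rewrite /cterm /= mulmx1.
- exists 1, 0; split=> //; first by rewrite /cterm /= mul0mx.
  have -> : x = 0 := lap_mx_inj dx.
  by rewrite scaler0 mul0mx.
- exists 1, 0; split=> //; first by rewrite /cterm /= mul0mx.
  by apply: row_rank0; exact: cone_rank_neg.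
Qed.

Lemma cone_lap_resolution : projective_resolution (cone lap_mx) Pinf.
Proof.
split.
- move=> [[|n]|n] // _; apply/matrixP => -[] //.
- case=> [n|[|[|n]]] x i0 _ dx.
  + exists 0; first by rewrite /cterm /= mul0mx.
    by apply: row_rank0; exact: cone_rank_pos.
  + by [].
  + exists 0; first by rewrite /cterm /= mul0mx.
    have -> : x = 0 := lap_mx_inj dx.
    by rewrite mul0mx.
  + exists 0; first by rewrite /cterm /= mul0mx.
    by apply: row_rank0; exact: cone_rank_neg.
- exists aug; split=> [x|x _].
    by have [v <-] := aug_surj x; exists v => //; rewrite /cterm /= mulmx1.
  split=> [/aug_ker[y ->]|[y _ ->]].
    by exists y => //; rewrite /cterm /= mulmx1.
  by apply/aug_ker; exists y.
Qed.

End LocalizedLaplacian.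

(** * Evaluation at an Artin representation *)

Section ArtinIhara.
Variables (O : comNzRingType) (d n : nat) (rho : Gquo p n G -> 'M[O]_d).

Lemma out_edges_sum i i' (a : Gquo p n G) :
  \sum_(e \in [set e : edge (Xn n) | esrc e = (i, 1%g) /\ etgt e = (i', a)]) (1 : O)
  = \sum_(e | (s e == i) && (t e == i')) (Gproj p n (alpha e) == a)%:R.
Proof.
rewrite (@reindex_fsbig _ _ _ _ _ (fun e : E => (e, 1%g : Gquo p n G))
  [set e | (s e == i) && (t e == i') && (Gproj p n (alpha e) == a)]); last first.
  split=> [e /= /andP[/andP[/eqP <- /eqP <-] /eqP <-]|e e' _ _ [] //|[e h] /= [[<- ->] [<- <-]]].
    by rewrite mul1g.
  by exists e => //=; rewrite !eqxx mul1g eqxx.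
by rewrite fsbig_fin_pred big_mkcondr /=; apply: eq_bigr => e _; case: eqP.
Qed.

Lemma in_edges_sum i i' (a : Gquo p n G) :
  \sum_(e \in [set e : edge (Xn n) | esrc e = (i', a) /\ etgt e = (i, 1%g)]) (1 : O)
  = \sum_(e | (s e == i') && (t e == i)) (Gproj p n (alpha e)^-1%g == a)%:R.
Proof.
rewrite (@reindex_fsbig _ _ _ _ _ (fun e : E => (e, a))
  [set e | (s e == i') && (t e == i) && (Gproj p n (alpha e)^-1%g == a)]); last first.
  split=> [e /= /andP[/andP[/eqP <- /eqP <-] /eqP <-]|e e' _ _ [] //|[e h] /= [[<- ->] [<- aE]]].
    by rewrite -GprojM mulVg.
  exists e => //=; rewrite !eqxx /= -(Gproj_inv p n (alpha e)).
  by apply/eqP; apply: (@mulIg _ (Gproj p n (alpha e))); rewrite aE mulVg.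
by rewrite fsbig_fin_pred big_mkcondr /=; apply: eq_bigr => e _; case: eqP.
Qed.

(** A loop of [Xn n] at $(v_i, 1)$ occurs in both sums, whence the factor 2 in [edge_count]; in all
    other cases outgoing and incoming edges form disjoint sets. *)
Lemma edge_countE i i' (a : Gquo p n G) : (edge_count s t alpha i i' a)%:R =
  \sum_(e | (s e == i) && (t e == i')) (Gproj p n (alpha e) == a)%:R
  + \sum_(e | (s e == i') && (t e == i)) (Gproj p n (alpha e)^-1%g == a)%:R :> O.
Proof.
have [q [_ qP]] := Gquo_finite hG n.
have fin (A : set (E * Gquo p n G)) : finite_set A.
  apply: (@sub_finite_set _ _ [set` [seq (e, b) | e <- enum E, b <- q]]); last exact: finite_seq.
  by move=> [e b] _ /=; apply/allpairsP; exists (e, b); rewrite mem_enum qP.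
rewrite -out_edges_sum -in_edges_sum /edge_count.
case: ifP => [/andP[/eqP -> /eqP ->]|ia].
  by rewrite natrM mulr_natl mulr2n card_fset_setR.
rewrite card_fset_setR // -fsbigU //.
by move=> e /= [[e1 e2] [e3 _]]; move: ia; rewrite e1 in e3; case: e3 => -> ->; rewrite !eqxx.
Qed.

Lemma Arho_sum i i' k k' :
  (Arho s t alpha rho) (mxtens_index (i, k)) (mxtens_index (i', k')) =
  (\sum_(e | (s e == i) && (t e == i')) rho (Gproj p n (alpha e))
   + \sum_(e | (s e == i') && (t e == i)) rho (Gproj p n (alpha e)^-1%g)) k k'.
Proof.
have [q [uq qP]] := Gquo_finite hG n.
have fin : finite_set [set: Gquo p n G].
  by apply: (@sub_finite_set _ _ [set` q]) => [x _ /=|]; [apply: qP | apply: finite_seq].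
have inS a : a \in fset_set [set: Gquo p n G] by rewrite in_fset_set // inE.
rewrite /Arho fsbig_finite //= summxE.
transitivity (\sum_(a <- fset_set [set: Gquo p n G])
   (\sum_(e | (s e == i) && (t e == i')) (Gproj p n (alpha e) == a)%:R * rho a k k'
   + \sum_(e | (s e == i') && (t e == i)) (Gproj p n (alpha e)^-1%g == a)%:R * rho a k k')).
  by apply: eq_bigr => a _; rewrite -!mulr_suml -mulrDl -edge_countE tensmxE mxE.
have pick (b : Gquo p n G) : \sum_(a <- fset_set [set: Gquo p n G]) (b == a)%:R * rho a k k' = rho b k k'.
  rewrite (bigD1_seq b) ?fset_uniq //= eqxx mul1r big1 ?addr0 // => a.
  by rewrite eq_sym => /negPf ->; rewrite mul0r.
rewrite big_split /= !mxE !summxE; congr (_ + _); rewrite exchange_big /=;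
  by apply: eq_bigr => e _; apply: pick.
Qed.

Lemma Artin_Ihara_hE : Artin_Ihara_h s t alpha rho 1 = \det (Drho s t O d - Arho s t alpha rho).
Proof.
congr (\det _); rewrite expr1n !scale1r.
by rewrite addrC addrA subrK.
Qed.
End ArtinIhara.

(** * The twist by a representation and its augmentation *)

Section Twisting.
Variables (O : idomainType) (alg : {rmorphism Zpadic p -> O}) (n d : nat)
  (rho : Gquo p n G -> 'M[O]_d).

Definition iw_rep (x : Lam) : 'M[O]_d := fglift rho (freeg_coef alg (x n)).

Lemma iw_rep_zmod : zmod_morphism iw_rep.
Proof. by move=> x y; rewrite /iw_rep iw_levelB !raddfB. Qed.
HB.instance Definition _ := GRing.isZmodMorphism.Build Lam 'M[O]_d iw_rep iw_rep_zmod.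

Lemma iw_rep_group g : iw_rep [: g :] = rho (Gproj p n g).
Proof. rewrite /iw_rep -[freeg_coef _ _]/(freeg_coef alg << Gproj p n g >>).
by rewrite freeg_coefU rmorph1 fgliftE. Qed.

(** At level 0 of [twisted] the quotient of $\Gamma$ is trivial and [x] is read at level [n], so the
    augmentation forgets [pi] and leaves the linear extension of [rho]. *)
Lemma twisted_aug x F k k' : twisted pi rho x F -> lamO_aug (F k k' : LamO alg) = iw_rep x k k'.
Proof.
move=> /(_ 0%N k k') /= e; rewrite /lamO_aug /iw_aug e raddf_sum /=.
rewrite /iw_rep /freeg_coef raddf_sum /= summxE; apply: eq_bigr => a _.
by rewrite !liftU mxE Gproj_repr /GRing.scale /= mulr1.
Qed.

Hypothesis hrho : representation rho.

Lemma iw_rep1 : iw_rep 1 = 1%:M.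
Proof. by rewrite -(iw_group1 p (Zpadic p) G) iw_rep_group -hrho.1. Qed.

Lemma iw_rep_lap i i' k k' : iw_rep (lap_mx i i') k k' =
  (Drho s t O d - Arho s t alpha rho) (mxtens_index (i, k)) (mxtens_index (i', k')).
Proof.
rewrite lap_mxE [iw_rep _]raddfB mxE [RHS]mxE [X in _ + X = _]mxE [X in _ = _ + X]mxE Arho_sum.
congr (_ - _); last first.
  congr (fun_of_matrix _ k k'); rewrite [LHS](raddfD iw_rep); congr (_ + _); rewrite [LHS](raddf_sum iw_rep);
    by apply: eq_bigr => e _; exact: iw_rep_group.
rewrite tensmxE /Dmat !mxE raddfMn raddfMn /= iw_rep1 !mulmxnE mxE.
by rewrite -[X in _ = X * _]mulr_natr -natrM mulr_natl mulrnA.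
Qed.

Variables (Q : unitRingType) (iota : {rmorphism Lam -> Q}).
Variables (K : fieldType) (j : {rmorphism LamO alg -> K}) (Psi : {rmorphism Q -> 'M[K]_d}).

Lemma evaluation_lap (hN : invertible_mx (map_mx iota lap_mx)) :
  fraction_field j -> extends_twist iota pi rho j Psi ->
  evaluation j Psi (K1_class hN) = Some (tofrac (Artin_Ihara_h s t alpha rho 1)).
Proof.
move=> [jI _] tw; rewrite /evaluation K1_det_class.
pose F i i' := sval (cid (tw (lap_mx i i'))).
have FP i i' : twisted pi rho (lap_mx i i') (F i i') /\ Psi (iota (lap_mx i i')) = map_mx j (F i i').
  exact: (svalP (cid (tw (lap_mx i i')))).
pose B : 'M[LamO alg]_(m * d) := \matrix_(r, c)
  F (mxtens_unindex r).1 (mxtens_unindex c).1 (mxtens_unindex r).2 (mxtens_unindex c).2.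
have -> : block_matrix Psi (map_mx iota lap_mx) = map_mx j B.
  by apply/matrixP => r c; rewrite block_matrixE mxE (FP _ _).2 !mxE.
(* The determinant lies in the image of [j], so its value is that of the augmentation, a ring
   morphism that passes under the determinant to the entries. *)
rewrite det_map_mx augmentation_value_integral // -det_map_mx Artin_Ihara_hE.
congr (Some (tofrac (\det _))); apply/matrixP => r c.
rewrite [LHS]mxE [B r c]mxE [LHS](twisted_aug _ _ (FP _ _).1) iw_rep_lap.
by rewrite -!surjective_pairing !mxtens_unindexK.
Qed.
End Twisting.

End Graph.
End Tower.

Theorem theorem7p3 (p : nat) (hp : prime p)
    (G : topGroupType) (l : nat) (hG : uniform_pro_p p l G)
    (H : set G) (hHc : closed H) (hHn : normal_subgroup H)
    (pi : G -> Gam p) (hpi : Zpadic_quotient H pi)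
    (m : nat) (E : finType) (s t : E -> 'I_m)
    (hX : connected_graph (Graph s t))
    (alpha : edge (Graph s t) -> G)
    (hXn : forall n, connected_graph (derived p alpha n))
    (hPic : MHG_property H (PicInf p s t alpha))
    (Q : unitRingType) (iota : {rmorphism iwasawa p (Zpadic p) G -> Q})
    (hQ : Ore_localization (Ore_Sstar p H) iota) :
  let N := Dmat s t (iwasawa p (Zpadic p) G) - (Amat p s t alpha)^T in
  exists hN : invertible_mx (map_mx iota (of_columns N)),
    (forall (O : idomainType) (alg : {rmorphism Zpadic p -> O}) (n d : nat)
        (rho : Gquo p n G -> 'M[O]_d)
        (K : fieldType) (j : {rmorphism LamO alg -> K})
        (Psi : {rmorphism Q -> 'M[K]_d}),
      [pchar O] =i pred0 -> representation rho ->
      fraction_field j -> extends_twist iota pi rho j Psi ->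
      evaluation j Psi (K1_class hN)
        = Some (tofrac (Artin_Ihara_h s t alpha rho 1)))
    /\
    ((exists P : tcomplex (Ore_Sstar p H),
        projective_resolution P (PicInf p s t alpha))
     /\
     forall partial : {additive K1 Q -> K0 (Ore_Sstar p H)},
       connecting_map iota partial ->
       forall P : tcomplex (Ore_Sstar p H),
         projective_resolution P (PicInf p s t alpha) ->
         partial (K1_class hN) = K0_class P).
Proof.
move=> N.
pose hN : invertible_mx (map_mx iota (of_columns N)) :=
  lap_invertible hp hG hHn hpi hXn hQ hPic.
have tor := cone_lap_torsion hp hG hHn hpi hXn hQ hPic.
have resC : projective_resolution (cone (of_columns N)) (PicInf p s t alpha) :=
  cone_lap_resolution hp hG hpi hXn.
exists hN; split=> [O alg n d rho K j Psi _ hrho hj hPsi|].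
  exact: (evaluation_lap hG hrho).
split=> [|partial hpartial P resP]; first by exists (MkTcomplex tor).
have [f qf] := cone_resolution_quasi_iso resC resP.
rewrite (hpartial _ _ hN tor).
exact: (@K0_class_quasi_iso _ _ (MkTcomplex tor) P f qf).
Qed.
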